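(* Let $m,n\geq 5$, and let $G\cong K_m$ and $H\cong K_n$ be disjointly embedded, weakly linked graphs in $\mathbb{R}^3$. Suppose that there is a triangle $T^*=p_1p_2p_3$ in $G$ such that a triangle $T\neq T^*$ in $G$ links $H$ if and only if $T$ shares an edge with $T^*$. Let $X=G-\{p_1,p_2,p_3\}$, and for each $x\in X$ let $$T_0(x)=T^*=p_1p_2p_3,\quad T_1(x)=p_3p_2x,\quad T_2(x)=xp_1p_3,\quad T_3(x)=p_2p_1x.$$ Then exactly one of the following holds: (D1) There is a vertex $q$ of $H$ common to all triangles of $H$ linking $G$. Then there are pairwise disjoint sets $I_0,I_1,I_2,I_3$ such that $I_0\cup I_1\cup I_2\cup I_3=H-\{q\}$, and after reversing the orientation of $\mathbb{R}^3$ (if necessary), for each $x\in X$ and $0\leq i\leq 3$ the triangle $T_i(x)$ links $H$ in the star $qO_iI_i$, where $O_i=H-\{q\}-I_i$. Moreover, $I_i$ is nonempty for $1\leq i\leq 3$, and $I_0$ is nonempty if and only if $T^*$ links $H$. (D2) There is no vertex of $H$ common to all triangles of $H$ linking $G$. Then $T^*$ does not link $H$, and there is a triangle $U^*=q_1q_2q_3$ of $H$ such that a triangle $U$ of $H$ links $G$ if and only if $U$ shares exactly one edge with $U^*$. Let $Y=H-\{q_1,q_2,q_3\}$, and for each $y\in Y$ let $$U_1(y)=q_3q_2y,\quad U_2(y)=yq_1q_3,\quad U_3(y)=q_2q_1y.$$ Then after relabelling the $p_i$, $q_i$ and reversing the orientation of $\mathbb{R}^3$ (if necessary), (a) for each $x\in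 X$ the triangles $T_1(x),T_2(x),T_3(x)$ link $H$ in the stars $q_1\{q_2,q_3\}Y$, $q_2\{q_1,q_3\}Y$, $q_3\{q_1,q_2\}Y$, respectively; and (b) for each $y\in Y$ the triangles $U_1(y),U_2(y),U_3(y)$ link $G$ in the stars $p_1X\{p_2,p_3\}$, $p_2X\{p_1,p_3\}$, $p_3X\{p_1,p_2\}$, respectively.
   Context: A complete graph and its vertex set are denoted by the same symbol, so $H-S$ denotes the set of vertices of $H$ not in $S$. An embedded graph is identified with its image in $\mathbb{R}^3$. $\operatorname{Lk}(C,D)$ denotes the linking number of disjoint oriented simple closed curves; reversing the orientation of $\mathbb{R}^3$ changes the sign of every linking number. $C,D$ are linked if $\operatorname{Lk}(C,D)\neq 0$ and strongly linked if $|\operatorname{Lk}(C,D)|\geq 2$. Disjointly embedded graphs are weakly linked if some cycle in one links a cycle in the other, but no cycle in one strongly links a cycle in the other. A cycle links a graph if it links some cycle of that graph. For distinct vertices $p,q,r$, $pqr$ denotes the oriented triangle $p\to q\to r\to p$, and $-T$ is $T$ reversed; orientations are ignored in statements such as ''$T$ shares an edge with $T^*$'' and ''$T\ne T^*$''. Star: given an ordered partition $(\{p\},O,I)$ of the vertices of a complete graph $K$, the star $pOI$ consists of all oriented triangles $pqr$ with $q\in O$, $r\in I$. ''$C$ links $K$ in the star $pOI$'' means that for all oriented triangles $T$ of $K$: $\operatorname{Lk}(C,T)=+1$ if $T\in pOI$, $-1$ if $-T\in pOI$, and $0$ otherwise. Here $O$ or $I$ is allowed to be empty, in which case the condition says that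 $C$ does not link any triangle of $K$. In (D2), after relabelling, the triangles $T_i(x)$, $U_i(y)$ are given by the same formulas in terms of the new labels (the relabelling permutes $p_1,p_2,p_3$ among themselves and $q_1,q_2,q_3$ among themselves). *)

(* Defs.v *)
From HB Require Import structures.
From mathcomp Require Import all_boot all_order all_algebra.
From mathcomp Require Import all_classical all_reals all_analysis.

Set Implicit Arguments.
Unset Strict Implicit.
Unset Printing Implicit Defensive.

Import Order.TTheory GRing.Theory Num.Theory numFieldNormedType.Exports.

Local Open Scope ring_scope.

Section LinkingNumber.
Variable R : realType.
Local Notation pt := 'rV[R]_3.

Definition det3 (u v w : pt) : R := \det (col_mx u (col_mx v w)).

(* A closed polygon is the list s of its vertices; it has an oriented edge from
   each vertex to the next one in cyclic order. *)
Definition poly_edges (s : seq pt) : seq (pt * pt) := zip s (rot 1 s).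

Definition seg_pt (e : pt * pt) (t : R) : pt := e.1 + t *: (e.2 - e.1).

Definition line_meets_edge (v a : pt) (e : pt * pt) : Prop :=
  exists t h : R, 0 <= t <= 1 /\ a + h *: v = seg_pt e t.

(* In the projection of R^3 along v, no vertex of either polygon lies on the
   other polygon.  The edges of A then cross those of B only at interior points
   and transversally.  Self-crossings of A or of B are irrelevant here. *)
Definition regular_direction (A B : seq pt) (v : pt) : Prop :=
  [/\ v != 0,
      forall a e, a \in A -> e \in poly_edges B -> ~ line_meets_edge v a e &
      forall b e, b \in B -> e \in poly_edges A -> ~ line_meets_edge v b e].

(* e passes over f, seen from above when v points upwards. *)
Definition crosses_over (v : pt) (e f : pt * pt) : Prop :=
  exists s t h : R,
    [/\ 0 <= s <= 1, 0 <= t <= 1, 0 < h & seg_pt e s = seg_pt f t + h *: v].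

Definition crossing (v : pt) (e f : pt * pt) : int :=
  if `[< crosses_over v e f >] then sgz (det3 (e.2 - e.1) (f.2 - f.1) v) else 0.

Definition crossing_sum (v : pt) (A B : seq pt) : int :=
  \sum_(e <- poly_edges A) \sum_(f <- poly_edges B) crossing v e f.

(* For disjoint polygons, the signed count of the crossings at which A passes
   over B is the linking number, whatever the regular direction chosen. *)
Definition poly_lk (A B : seq pt) : int :=
  crossing_sum (xget 0 [set v | regular_direction A B v]%classic) A B.

(* An oriented closed curve is given as a list of arcs [0, 1] -> R^3, each one
   ending where the next one (cyclically) starts. *)
Definition curve := seq (R -> pt).

(* The last point of each arc is left out: the next arc starts there. *)
Definition inscribed_polygon (N : nat) (C : curve) : seq pt :=
  flatten [seq [seq a (k%:R / N%:R) | k <- iota 0 N] | a <- C].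

(* The curves are only assumed continuous, so their linking number is that of
   all sufficiently fine inscribed polygons.  The boolean o is the orientation
   of R^3: false is the standard one, true the reversed one. *)
Definition lk (o : bool) (C D : curve) : int :=
  (-1) ^+ o *
  xget 0 [set l : int | \forall N \near \oo,
            poly_lk (inscribed_polygon N C) (inscribed_polygon N D) = l]%classic.

Definition linked (C D : curve) : Prop := lk false C D != 0.

Definition strongly_linked (C D : curve) : Prop := 2 <= `|lk false C D|.

End LinkingNumber.

(* An embedding in R^3 of the complete graph with vertex set V.  For i != j,
   edge i j parametrizes the edge {i, j} from i to j; edge i i is junk. *)
Record embedding (R : realType) (V : finType) := Embedding {
  vert : V -> 'rV[R]_3;
  edge : V -> V -> R -> 'rV[R]_3;
  edge_continuous : forall i j, i != j ->
    {within `[0%R, 1%R], continuous (edge i j)}%classic;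
  edge_start : forall i j, i != j -> edge i j 0 = vert i;
  edge_end : forall i j, i != j -> edge i j 1 = vert j;
  edge_rev : forall i j t, i != j -> 0 <= t <= 1 ->
    edge j i t = edge i j (1 - t);
  vert_inj : injective vert;
  (* an interior point of an edge lies on no other edge, and is not an end or
     another point of its own edge *)
  edge_inj : forall i j k l s t, i != j -> k != l ->
    0 < s < 1 -> 0 <= t <= 1 -> edge i j s = edge k l t ->
    [/\ k = i, l = j & t = s] \/ [/\ k = j, l = i & t = 1 - s]
}.

Definition image_of (R : realType) (V : finType) (g : embedding R V) :
    set 'rV[R]_3 :=
  (range (vert g) `|`
  [set x | exists i j t, [/\ i != j, (0 <= t <= 1)%R & x = edge g i j t]])%classic.

Definition disjointly_embedded (R : realType) (V W : finType)
    (g : embedding R V) (h : embedding R W) : Prop :=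
  (image_of g `&` image_of h = set0)%classic.

Section Cycles.
Variable V : finType.

(* An oriented cycle p_1 -> ... -> p_k -> p_1 is given as [:: p_1; ...; p_k];
   rev c is then the reversed cycle. *)
Definition is_cycle (c : seq V) : bool := uniq c && (2 < size c)%N.

Definition is_triangle (c : seq V) : bool := uniq c && (size c == 3)%N.

Definition cycle_edges (c : seq V) : {set {set V}} :=
  [set [set x; next c x] | x in c].

Definition common_edges (T U : seq V) : {set {set V}} :=
  cycle_edges T :&: cycle_edges U.

Definition same_unoriented (T U : seq V) : Prop := cycle_edges T = cycle_edges U.

Definition star_partition (p : V) (O I : {set V}) : bool :=
  [&& p \notin O, p \notin I, [disjoint O & I] &
      (p |: (O :|: I))%SET == [set: V]%SET].

(* The oriented triangle pqr may be written starting from any of its vertices. *)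
Definition in_star (p : V) (O I : {set V}) (T : seq V) : Prop :=
  exists q r k, [/\ q \in O, r \in I & T = rot k [:: p; q; r]].

End Cycles.

Section Graphs.
Variables (R : realType) (V : finType).

Definition cycle_curve (g : embedding R V) (c : seq V) : curve R :=
  [seq edge g x (next c x) | x <- c].

Definition links_graph (C : curve R) (g : embedding R V) : Prop :=
  exists2 c, is_cycle c & linked C (cycle_curve g c).

Definition links_in_star (o : bool) (C : curve R) (g : embedding R V)
    (p : V) (O I : {set V}) : Prop :=
  star_partition p O I /\
  forall T, is_triangle T ->
    [/\ in_star p O I T -> lk o C (cycle_curve g T) = 1,
        in_star p O I (rev T) -> lk o C (cycle_curve g T) = -1 &
        ~ in_star p O I T -> ~ in_star p O I (rev T) ->
          lk o C (cycle_curve g T) = 0].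

End Graphs.

Definition weakly_linked (R : realType) (V W : finType)
    (g : embedding R V) (h : embedding R W) : Prop :=
  (exists c d, [/\ is_cycle c, is_cycle d &
     linked (cycle_curve g c) (cycle_curve h d)]) /\
  (forall c d, is_cycle c -> is_cycle d ->
     ~ strongly_linked (cycle_curve g c) (cycle_curve h d)).

Definition common_vertex (R : realType) (V W : finType)
    (g : embedding R V) (h : embedding R W) (q : W) : Prop :=
  forall U, is_triangle U -> links_graph (cycle_curve h U) g -> q \in U.

(* T_0, ..., T_3; the same formulas give U_1, U_2, U_3. *)
Definition tri_family (V : finType) (p1 p2 p3 x : V) (i : 'I_4) : seq V :=
  nth [::] [:: [:: p1; p2; p3]; [:: p3; p2; x]; [:: x; p1; p3]; [:: p2; p1; x]] i.

Definition caseD1 (R : realType) (G H : finType)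
    (g : embedding R G) (h : embedding R H) (p1 p2 p3 : G) : Prop :=
  exists q : H, common_vertex g h q /\
  exists I : 'I_4 -> {set H},
  [/\ forall i j, i != j -> [disjoint I i & I j],
      (\bigcup_i I i)%SET = ([set: H] :\ q)%SET,
      exists o : bool, forall x (i : 'I_4), x \notin [:: p1; p2; p3] ->
        links_in_star o (cycle_curve g (tri_family p1 p2 p3 x i)) h
          q ([set: H] :\ q :\: I i)%SET (I i),
      forall i : 'I_4, (1 <= i)%N -> I i != finset.set0 &
      I ord0 != finset.set0 <-> links_graph (cycle_curve g [:: p1; p2; p3]) h].

Definition starsD2 (R : realType) (G H : finType)
    (g : embedding R G) (h : embedding R H) (o : bool)
    (p1 p2 p3 : G) (q1 q2 q3 : H) : Prop :=
  let X := (~: [set p1; p2; p3])%SET in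
  let Y := (~: [set q1; q2; q3])%SET in
  let T x i := cycle_curve g (tri_family p1 p2 p3 x (inord i)) in
  let U y i := cycle_curve h (tri_family q1 q2 q3 y (inord i)) in
  (forall x, x \in X ->
     [/\ links_in_star o (T x 1%N) h q1 [set q2; q3]%SET Y,
         links_in_star o (T x 2%N) h q2 [set q1; q3]%SET Y &
         links_in_star o (T x 3%N) h q3 [set q1; q2]%SET Y]) /\
  (forall y, y \in Y ->
     [/\ links_in_star o (U y 1%N) g p1 X [set p2; p3]%SET,
         links_in_star o (U y 2%N) g p2 X [set p1; p3]%SET &
         links_in_star o (U y 3%N) g p3 X [set p1; p2]%SET]).

Definition caseD2 (R : realType) (G H : finType)
    (g : embedding R G) (h : embedding R H) (p1 p2 p3 : G) : Prop :=
  [/\ ~ (exists q : H, common_vertex g h q),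
      ~ links_graph (cycle_curve g [:: p1; p2; p3]) h &
      exists q1 q2 q3 : H,
      [/\ is_triangle [:: q1; q2; q3],
          forall U, is_triangle U ->
            (links_graph (cycle_curve h U) g <->
             #|common_edges U [:: q1; q2; q3]| = 1%N) &
          exists p1' p2' p3' q1' q2' q3' o,
          [/\ perm_eq [:: p1'; p2'; p3'] [:: p1; p2; p3],
              perm_eq [:: q1'; q2'; q3'] [:: q1; q2; q3] &
              starsD2 g h o p1' p2' p3' q1' q2' q3']]].

(* Main.v *)
(** In the projection along v, the crossings of a closed polygon A with the boundary of a
    triangle are, up to a sum that telescopes along A, its intersections with the triangle
    itself. Coning a polygon B from a generic apex therefore turns the crossing sum into a
    number of intersections in which v does not occur. It vanishes when B lies in a ball
    that misses A, so refining inscribed polygons does not change it. Hence one projection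
    and one subdivision compute the linking numbers of all the cycles of two disjoint
    graphs, and they become sums over pairs of edges, antisymmetric in each edge.

    An integral cochain on a complete graph with values in {-1, 0, 1} on all cycles is a
    star: this needs only cycles of length at most 6. Contracting the triangles that do
    not link H, the triangles of G become the faces T_0, ..., T_3 of a tetrahedron, so
    each cycle U of H yields a vector (Lk(T_i, U))_i that is zero or a root e_i - e_j of
    the root system A_3. If all linked triangles of H share a vertex q, these vectors lie
    on a common line of the root system, which colours H - {q} by I_0, ..., I_3. Otherwise
    two of the stars have no common vertex, and this forces them to be q_1{q_2,q_3}Y and
    q_2{q_1,q_3}Y; the vanishing of the sum of the T_i then determines the other two. *)

(* The definition of [lk] makes two choices, a regular direction and a sufficiently fine polygon,
   for curves that are merely continuous. Both are eliminated with one notion of genericity,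
   avoidance of finitely many planes, under which finitely many conditions hold at once in any ball.
   After [lk_cycles_antisym] everything is finite integer arithmetic.

   On the side of G, weak linking is applied only to the triangles T_i(x) and to the 4-cycles that
   bound the union of two of them. This yields four cochains on H that are bounded, have bounded
   pairwise sums and total sum zero; the structure of H follows from these properties and from T_1,
   T_2, T_3 being linked. T_0 stays apart because the hypothesis on linked triangles does not speak
   of T*. Five vertices in H leave at least two outside q_1q_2q_3, which serves to locate the common
   vertex of two stars.

   Part (b) of (D2) is not a second analysis: a triangle of H acts on G through its linking numbers
   with the T_i(x), and these are known from part (a). *)
Require Import Defs.
From mathcomp Require Import all_boot all_order all_algebra.
From mathcomp Require Import all_classical all_reals all_analysis.
From mathcomp Require Import ring lra zify.
Set Implicit Arguments.
Unset Strict Implicit.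
Unset Printing Implicit Defensive.
Import Order.TTheory GRing.Theory Num.Theory numFieldNormedType.Exports.
Local Open Scope ring_scope.

(** * Sign changes of affine functions *)

Section OneDim.
Variables (R : realType) (I : finType) (l : I -> R -> R) (b : I -> R).
Hypothesis lE : forall i s t, l i t = l i s + (t - s) * b i.

Let inside s := [forall i, 0 <= l i s].
Let enters i := (0 < b i) && `[< exists s, [/\ 0 <= s <= 1, l i s = 0 & inside s] >].

(** The points inside form an interval. If 0 is outside, the interval begins at the largest zero of
    the functions that are negative at 0, and by the last hypothesis a single function vanishes
    there. *)
Lemma count_entries s0 :
  0 <= s0 <= 1 -> inside s0 ->
  (forall i, l i 0 = 0 -> ~~ inside 0) ->
  (forall i j s, 0 <= s <= 1 -> i != j -> l i s = 0 -> l j s = 0 -> ~~ inside s) ->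
  \sum_i (enters i : nat) = (~~ inside 0 : nat).
Proof.
move=> s01 /forallP ins0 end0 distinct.
have [in0|out0] := boolP (inside 0).
  apply: big1 => i _; apply/eqP; rewrite eqb0; apply/negP => /andP[bi /asboolP[s [ss ls _]]].
  have := forallP in0 i; rewrite le_eqVlt => /orP[/eqP/esym/end0|]; first by rewrite in0.
  by move: ls; rewrite (lE i 0 s); nra.
have [j0 lj0] : exists j, l j 0 < 0.
  by move: out0; rewrite negb_forall => /existsP[j]; rewrite -ltNge; exists j.
pose root j := - l j 0 / b j.
have rootP j : l j 0 < 0 -> [/\ 0 < b j, 0 <= root j <= s0 & l j (root j) = 0].
  move=> lj; have := ins0 j; rewrite (lE j 0 s0) subr0 => h.
  have bj : 0 < b j by nra.
  split=> //; last first.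
    by rewrite (lE j 0) subr0 /root divfK ?gt_eqF// subrr.
  have hr : 0 <= - l j 0 / b j by rewrite divr_ge0 ?oppr_ge0 ?ltW.
  by rewrite /root hr ler_pdivrMr //; lra.
have [j lj jmax] := @arg_maxP _ R I j0 (fun j => l j 0 < 0) root lj0.
have [bj /andP[rj0 rjs] lrj] := rootP j lj.
have rj01 : 0 <= root j <= 1 by move: s01 => /andP[_ ?]; rewrite rj0/=; lra.
have inr : inside (root j).
  apply/forallP => k; have [lk|lk] := ltP (l k 0) 0.
    have [bk /andP[rk0 rks] lrk] := rootP k lk.
    have rkj : root k <= root j by exact: jmax.
    rewrite (lE k (root k)) lrk; nra.
  have := ins0 k; rewrite (lE k 0 s0) (lE k 0 (root j)) !subr0 => h.
  have [bk|bk] := leP 0 (b k); first by nra.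
  nra.
rewrite (bigD1 j)//= big1 ?addn0.
  suff -> : enters j by [].
  by rewrite /enters bj; apply/asboolP; exists (root j).
move=> i ij; apply/eqP; rewrite eqb0; apply/negP => /andP[bi /asboolP[s [ss ls ins]]].
have h1 := forallP inr i; have h2 := forallP ins j.
have sr : s = root j.
  apply: le_anti; rewrite (lE j (root j)) lrj in h2.
  rewrite (lE i s) ls in h1; apply/andP; split; first by nra.
  nra.
by rewrite sr in ls; have := distinct _ _ _ rj01 ij ls lrj; rewrite inr.
Qed.
End OneDim.

Section OneDim2.
Variables (R : realType) (I : finType) (l : I -> R -> R) (b : I -> R).
Hypothesis lE : forall i s t, l i t = l i s + (t - s) * b i.
Let inside s := [forall i, 0 <= l i s].

(* The points where all the affine functions l i are nonnegative form an
   interval, which is entered and left at zeros of single functions. *)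
Lemma signed_exits :
  (forall i, l i 0 = 0 -> ~~ inside 0) ->
  (forall i, l i 1 = 0 -> ~~ inside 1) ->
  (forall i j s, 0 <= s <= 1 -> i != j -> l i s = 0 -> l j s = 0 -> ~~ inside s) ->
  \sum_i (if `[< exists s, [/\ 0 <= s <= 1, l i s = 0 & inside s] >]
          then sgz (b i) else 0) = (inside 1 : nat)%:Z - (inside 0 : nat)%:Z.
Proof.
move=> end0 end1 distinct.
have [[s0 [s01 ins0]]|no] := pselect (exists s, 0 <= s <= 1 /\ inside s); last first.
  rewrite big1 => [|i _]; last by case: asboolP => // -[s [? _ ?]]; case: no; exists s.
  have -> : inside 1 = false.
    by apply/negbTE/negP => h; apply: no; exists 1; rewrite ler01 lexx.
  have -> // : inside 0 = false.
  by apply/negbTE/negP => h; apply: no; exists 0; rewrite ler01 lexx.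
have e0 := count_entries lE s01 ins0 end0 distinct.
(* Running the parameter backwards turns exits into entries, so the same count applies to both
   ends. *)
pose l' i s := l i (1 - s).
have l'E i s t : l' i t = l' i s + (t - s) * - b i.
  by rewrite /l' (lE i (1 - s)); ring.
have ins's s : [forall i, 0 <= l' i s] = inside (1 - s) by [].
have s01' : 0 <= 1 - s0 <= 1 by lra.
have := count_entries l'E s01'.
rewrite !ins's subKr subr0 => /(_ ins0) e1.
have {}e1 : \sum_i (((0 < - b i) && `[< exists s, [/\ 0 <= s <= 1, l' i s = 0
     & [forall i, 0 <= l' i s]] >]) : nat) = (~~ inside 1 : nat).
  apply: e1 => [i|i j s s1 ij li lj]; first by rewrite /l' subr0; exact: end1.
  apply: (distinct i j) => //; lra.
transitivity ((~~ inside 0 : nat)%:Z - (~~ inside 1 : nat)%:Z); last first.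
  by case: (inside 0); case: (inside 1).
rewrite -e0 -e1 !(big_morph Posz PoszD (erefl _)) -sumrB.
apply: eq_bigr => i _; rewrite oppr_gt0.
have -> : `[< exists s, [/\ 0 <= s <= 1, l' i s = 0 & [forall i, 0 <= l' i s]] >] =
    `[< exists s, [/\ 0 <= s <= 1, l i s = 0 & inside s] >].
  apply: asbool_equiv_eq; split=> -[s [ss ls ins]]; exists (1 - s).
    by split=> //; lra.
  by rewrite /l' subKr; split=> //; lra.
by case: asboolP => _; rewrite ?andbF ?andbT //; case: sgzP.
Qed.
End OneDim2.

(** * Crossings, intersections and triangles *)

Section Vec.
Variable R : realType.
Local Notation pt := 'rV[R]_3.
Implicit Types u v w x p c d : pt.

Local Notation "u .[1]" := (u ord0 0) (at level 2, format "u .[1]").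
Local Notation "u .[2]" := (u ord0 1) (at level 2, format "u .[2]").
Local Notation "u .[3]" := (u ord0 2%:R) (at level 2, format "u .[3]").

Lemma vec3P u v : u.[1] = v.[1] -> u.[2] = v.[2] -> u.[3] = v.[3] -> u = v.
Proof.
move=> h1 h2 h3; apply/rowP => -[[|[|[|//]]] ?].
- by rewrite (_ : Ordinal _ = 0); [exact: h1|exact: val_inj].
- by rewrite (_ : Ordinal _ = 1); [exact: h2|exact: val_inj].
- by rewrite (_ : Ordinal _ = 2%:R); [exact: h3|exact: val_inj].
Qed.

Lemma det3E u v w : det3 u v w =
  u.[1] * (v.[2] * w.[3] - v.[3] * w.[2]) - u.[2] * (v.[1] * w.[3] - v.[3] * w.[1])
  + u.[3] * (v.[1] * w.[2] - v.[2] * w.[1]).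
Proof.
rewrite /det3; set M : 'M[R]_3 := col_mx u _.
have M0 j : M 0 j = u ord0 j.
  have -> : (0 : 'I_3) = lshift 2 (ord0 : 'I_1) by exact: val_inj.
  exact: col_mxEu.
have M1 j : M 1 j = v ord0 j.
  have -> : (1 : 'I_3) = rshift 1 (lshift 1 (ord0 : 'I_1)) by exact: val_inj.
  transitivity (col_mx v w (lshift 1 (ord0 : 'I_1)) j); [exact: (col_mxEd u)|exact: (col_mxEu v)].
have M2 j : M 2%:R j = w ord0 j.
  have -> : (2%:R : 'I_3) = rshift 1 (rshift 1 (ord0 : 'I_1)) by exact: val_inj.
  transitivity (col_mx v w (rshift 1 (ord0 : 'I_1)) j); [exact: (col_mxEd u)|exact: (col_mxEd v)].
pose f (i j : nat) := nth 0 (nth [::] [:: [:: u.[1]; u.[2]; u.[3]];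
  [:: v.[1]; v.[2]; v.[3]]; [:: w.[1]; w.[2]; w.[3]]] i) j.
have -> : M = \matrix_(i < 3, j < 3) f i j.
  apply/matrixP => i j; rewrite [RHS]mxE.
  have cas (k : 'I_3) : [\/ k = 0, k = 1 | k = 2%:R].
    case: k => -[|[|[|//]]] ?; [apply: Or31|apply: Or32|apply: Or33]; exact: val_inj.
  by case: (cas i) => ->; rewrite ?M0 ?M1 ?M2; case: (cas j) => ->.
rewrite (expand_det_row _ 0) !big_ord_recl big_ord0 /cofactor.
rewrite !(expand_det_row _ ord0) !big_ord_recl !big_ord0 /cofactor !det_mx11 !mxE /=.
rewrite /f /=.
ring.
Qed.

Lemma cramer u v w x : det3 u v w *: x =
  det3 x v w *: u + det3 u x w *: v + det3 u v x *: w.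
Proof. by rewrite !det3E; apply: vec3P; rewrite !mxE; ring. Qed.

Definition disjoint_edges (e f : pt * pt) : Prop :=
  forall s t, 0 <= s <= 1 -> 0 <= t <= 1 -> seg_pt e s <> seg_pt f t.

Definition regular_edges v (e f : pt * pt) : Prop :=
  [/\ ~ line_meets_edge v e.1 f, ~ line_meets_edge v e.2 f,
      ~ line_meets_edge v f.1 e & ~ line_meets_edge v f.2 e].

Definition in_triangle p c d x : Prop :=
  exists r s t, [/\ 0 <= r, 0 <= s, 0 <= t, r + s + t = 1 &
                    x = r *: p + s *: c + t *: d].

Definition intersection (e : pt * pt) p (f : pt * pt) : int :=
  if `[< exists s, 0 <= s <= 1 /\ in_triangle p f.1 f.2 (seg_pt e s) >]
  then sgz (det3 (e.2 - e.1) (f.1 - p) (f.2 - p)) else 0.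

(* For D != 0, every point x is uniquely
   bary c d p x *: p + bary d p c x *: c + bary p c d x *: d + height x *: v
   with barycentric coefficients of sum 1. *)
Definition vol v p c d : R := det3 (c - p) (d - p) v.
Definition bary v p c d x : R := det3 (c - x) (d - x) v / vol v p c d.
Definition height v p c d x : R := det3 (x - p) (c - p) (d - p) / vol v p c d.

Lemma vol_rot v p c d : vol v c d p = vol v p c d.
Proof. by rewrite /vol !det3E !mxE; ring. Qed.

Lemma vol_rot2 v p c d : vol v d p c = vol v p c d.
Proof. by rewrite -(vol_rot v d p c). Qed.

Lemma height_rot v p c d x : height v c d p x = height v p c d x.
Proof. by rewrite /height vol_rot !det3E !mxE; congr (_ / _); ring. Qed.

Lemma bary_decomp v p c d x : vol v p c d != 0 ->
  x = bary v p c d x *: p + bary v c d p x *: c + bary v d p c x *: d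
      + height v p c d x *: v.
Proof.
move=> D0; rewrite /bary /height (vol_rot v d p c) !(vol_rot v p c d).
move: D0; rewrite /vol !det3E !mxE => D0.
by apply: vec3P; rewrite !mxE; field; apply: contraNneq D0 => h; apply/eqP; lra.
Qed.

Lemma bary_sum v p c d x : vol v p c d != 0 ->
  bary v p c d x + bary v c d p x + bary v d p c x = 1.
Proof.
move=> D0; rewrite /bary (vol_rot v d p c) !(vol_rot v p c d).
by move: D0; rewrite /vol !det3E !mxE => D0; field; apply: contraNneq D0 => h; apply/eqP; lra.
Qed.

Lemma bary_height_unique v p c d r s t k : vol v p c d != 0 -> r + s + t = 1 ->
  let x := r *: p + s *: c + t *: d + k *: v in
  bary v p c d x = r /\ height v p c d x = k.
Proof.
move=> D0 sum1 x; have -> : r = 1 - s - t by rewrite -sum1; ring.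
rewrite /x (_ : r = 1 - s - t); last by rewrite -sum1; ring.
by split; rewrite /bary /height; move: D0; rewrite /vol !det3E !mxE => D0; field; apply: contraNneq D0 => h; apply/eqP; lra.
Qed.

Definition bary_slope v p c d w : R := - (det3 w (d - c) v / vol v p c d).
Definition height_slope v p c d w : R := det3 w (c - p) (d - p) / vol v p c d.

Lemma bary_affine v p c d e s t :
  bary v p c d (seg_pt e t) = bary v p c d (seg_pt e s)
  + (t - s) * bary_slope v p c d (e.2 - e.1).
Proof.
rewrite /bary /bary_slope -mulNr mulrA -mulrDl; congr (_ / _).
by rewrite /seg_pt !det3E !mxE; ring.
Qed.

Lemma height_affine v p c d e s t :
  height v p c d (seg_pt e t) = height v p c d (seg_pt e s)
  + (t - s) * height_slope v p c d (e.2 - e.1).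
Proof.
rewrite /height /height_slope mulrA -mulrDl; congr (_ / _).
by rewrite /seg_pt !det3E !mxE; ring.
Qed.
End Vec.

Section Tri.
Variable R : realType.
Local Notation pt := 'rV[R]_3.
Implicit Types u v w x p c d : pt.

Definition nonneg v p c d x : bool :=
  [&& 0 <= bary v p c d x, 0 <= bary v c d p x, 0 <= bary v d p c x &
      0 <= height v p c d x].

Lemma nonneg_rot v p c d x : nonneg v c d p x = nonneg v p c d x.
Proof. by rewrite /nonneg height_rot; do 3!case: (0 <= bary _ _ _ _ _). Qed.

(** The points over the side [cd] are those whose coordinate at [p] vanishes while the other
    coordinates and the height are nonnegative. Height 0 would put a point of [e] on the side,
    against disjointness. *)
Lemma crossing_bary v p c d e : vol v p c d != 0 -> disjoint_edges e (c, d) ->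
  crossing v e (c, d) =
  if `[< exists s, [/\ 0 <= s <= 1, bary v p c d (seg_pt e s) = 0 &
                       nonneg v p c d (seg_pt e s)] >]
  then - (sgz (vol v p c d) * sgz (bary_slope v p c d (e.2 - e.1))) else 0.
Proof.
move=> D0 dis; rewrite /crossing.
have -> : - (sgz (vol v p c d) * sgz (bary_slope v p c d (e.2 - e.1))) =
    sgz (det3 (e.2 - e.1) (d - c) v).
  by rewrite /bary_slope -sgzM mulrN sgzN opprK mulrC divfK.
congr (if _ then _ else _); apply: asbool_equiv_eq; split.
  move=> [s [t [k [s01 t01 k0 es]]]]; exists s; split=> //.
    have [] // := @bary_height_unique R v p c d 0 (1 - t) t k D0.
      by ring.
    rewrite scale0r add0r => <- _; congr bary.
    by rewrite es /seg_pt; apply: vec3P; rewrite !mxE /=; ring.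
  have -> : seg_pt e s = 0 *: p + (1 - t) *: c + t *: d + k *: v.
    by rewrite es /seg_pt; apply: vec3P; rewrite !mxE /=; ring.
  rewrite /nonneg.
  have D1 : vol v c d p != 0 by rewrite vol_rot.
  have D2 : vol v d p c != 0 by rewrite vol_rot2.
  have [-> ->] := @bary_height_unique R v p c d 0 (1 - t) t k D0 ltac:(ring).
  have -> : 0 *: p + (1 - t) *: c + t *: d + k *: v =
     (1 - t) *: c + t *: d + 0 *: p + k *: v by rewrite scale0r addr0 add0r.
  have [-> _] := @bary_height_unique R v c d p (1 - t) t 0 k D1 ltac:(ring).
  have -> : (1 - t) *: c + t *: d + 0 *: p + k *: v =
     t *: d + 0 *: p + (1 - t) *: c + k *: v.
    by apply: vec3P; rewrite !mxE /=; ring.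
  have [-> _] := @bary_height_unique R v d p c t 0 (1 - t) k D2 ltac:(ring).
  by move/andP: t01 => [-> ?]; rewrite lexx subr_ge0 (ltW k0) !andbT.
move=> [s [s01 b0 /and4P[_ bc bd hh]]]; have D := bary_decomp (seg_pt e s) D0.
have S := bary_sum (seg_pt e s) D0; rewrite b0 add0r in S.
set bC := bary v c d p _ in bc D S; set bD := bary v d p c _ in bd D S.
set hx := height v p c d _ in hh D.
have {}D : seg_pt e s = seg_pt (c, d) bD + hx *: v.
  have cE : bC = 1 - bD by rewrite -S; ring.
  by rewrite [LHS]D b0 cE /seg_pt; apply: vec3P; rewrite !mxE /=; ring.
have bD1 : 0 <= bD <= 1 by rewrite bd/=; lra.
exists s, bD, hx; split => //; rewrite lt_neqAle hh andbT eq_sym.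
by apply/negP => /eqP h0; apply: (dis s bD) => //; rewrite D h0 scale0r addr0.
Qed.

Lemma intersection_bary v p c d e : vol v p c d != 0 ->
  intersection e p (c, d) =
  if `[< exists s, [/\ 0 <= s <= 1, height v p c d (seg_pt e s) = 0 &
                       nonneg v p c d (seg_pt e s)] >]
  then sgz (vol v p c d) * sgz (height_slope v p c d (e.2 - e.1)) else 0.
Proof.
move=> D0; rewrite /intersection /=.
have -> : sgz (vol v p c d) * sgz (height_slope v p c d (e.2 - e.1)) =
    sgz (det3 (e.2 - e.1) (c - p) (d - p)).
  by rewrite -sgzM /height_slope mulrC divfK.
congr (if _ then _ else _); apply: asbool_equiv_eq; split.
  move=> [s [s01 [x [y [z [x0 y0 z0 S E]]]]]]; exists s; split => //.
    have [_] := @bary_height_unique R v p c d x y z 0 D0 S.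
    by rewrite scale0r addr0 -E.
  rewrite /nonneg.
  have := @bary_height_unique R v p c d x y z 0 D0 S.
  rewrite /= scale0r addr0 -E => -[-> ->].
  have S1 : y + z + x = 1 by rewrite -S; ring.
  have S2 : z + x + y = 1 by rewrite -S; ring.
  have D1 : vol v c d p != 0 by rewrite vol_rot.
  have D2 : vol v d p c != 0 by rewrite vol_rot2.
  have := @bary_height_unique R v c d p y z x 0 D1 S1.
  rewrite /= scale0r addr0 (_ : y *: c + z *: d + x *: p = seg_pt e s).
    move=> -[-> _]; have := @bary_height_unique R v d p c z x y 0 D2 S2.
    rewrite /= scale0r addr0 (_ : z *: d + x *: p + y *: c = seg_pt e s).
      by move=> -[-> _]; rewrite x0 y0 z0 lexx.
    by rewrite E -addrA addrC.
  by rewrite E addrC addrA.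
move=> [s [s01 h0 /and4P[bp bc bd _]]]; exists s; split => //.
exists (bary v p c d (seg_pt e s)), (bary v c d p (seg_pt e s)), (bary v d p c (seg_pt e s)).
split => //; first exact: bary_sum.
by rewrite [LHS](bary_decomp _ D0) h0 scale0r addr0.
Qed.

Definition triangle_crossing v e p c d : int :=
  crossing v e (c, d) + crossing v e (d, p) + crossing v e (p, c).

Definition generic_triangle v e p c d : Prop :=
  [/\ regular_edges v e (c, d), regular_edges v e (d, p) & regular_edges v e (p, c)] /\
  [/\ disjoint_edges e (c, d), disjoint_edges e (d, p) & disjoint_edges e (p, c)].

Lemma vertex_over_edge v p c d x : vol v p c d != 0 -> bary v p c d x = 0 ->
  nonneg v p c d x -> line_meets_edge v x (c, d).
Proof.
move=> D0 b0 /and4P[_ bc bd _]; have D := bary_decomp x D0.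
have := bary_sum x D0; rewrite b0 add0r => S.
exists (bary v d p c x), (- height v p c d x); split; first by rewrite bd/=; lra.
have cE : bary v c d p x = 1 - bary v d p c x by rewrite -S; ring.
rewrite {1}D b0 cE /seg_pt.
by apply: vec3P; rewrite !mxE /=; ring.
Qed.

Lemma over_vertex v p c d x : vol v p c d != 0 ->
  bary v p c d x = 0 -> bary v c d p x = 0 -> exists k, d + k *: v = x.
Proof.
move=> D0 b0 b1; have S := bary_sum x D0; rewrite b0 b1 !add0r in S.
by exists (height v p c d x); rewrite [RHS](bary_decomp x D0) b0 b1 S !scale0r !add0r scale1r.
Qed.

Lemma on_side v p c d x : vol v p c d != 0 ->
  bary v p c d x = 0 -> height v p c d x = 0 -> nonneg v p c d x ->
  exists2 t, 0 <= t <= 1 & x = seg_pt (c, d) t.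
Proof.
move=> D0 b0 h0 /and4P[_ bc bd _]; have S := bary_sum x D0; rewrite b0 add0r in S.
exists (bary v d p c x); first by rewrite bd/=; lra.
have cE : bary v c d p x = 1 - bary v d p c x by rewrite -S; ring.
rewrite {1}(bary_decomp x D0) b0 cE h0 /seg_pt.
by apply: vec3P; rewrite !mxE /=; ring.
Qed.

Lemma in_triangleP v p c d x : vol v p c d != 0 -> height v p c d x = 0 ->
  nonneg v p c d x -> in_triangle p c d x.
Proof.
move=> D0 h0 /and4P[bp bc bd _].
exists (bary v p c d x), (bary v c d p x), (bary v d p c x).
split => //; first exact: bary_sum.
by rewrite [LHS](bary_decomp x D0) h0 scale0r addr0.
Qed.

(* The signed indicator of the part of the prism over the triangle that lies
   above it jumps along e exactly at the crossings and the intersections. *)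
Lemma edge_triangle v e p c d : vol v p c d != 0 -> generic_triangle v e p c d ->
  ~ in_triangle p c d e.1 -> ~ in_triangle p c d e.2 ->
  intersection e p (c, d) - triangle_crossing v e p c d =
  sgz (vol v p c d) * ((nonneg v p c d e.2 : nat)%:Z - (nonneg v p c d e.1 : nat)%:Z).
Proof.
move=> D0 [[r1 r2 r3] [j1 j2 j3]] T1 T2.
have D1 : vol v c d p != 0 by rewrite vol_rot.
have D2 : vol v d p c != 0 by rewrite vol_rot2.
(* Along [e], zeros of the first three functions are the crossings with the sides, zeros of the
   fourth are the intersections with the triangle. *)
pose l (i : 'I_4) s := nth 0 [:: bary v p c d (seg_pt e s); bary v c d p (seg_pt e s);
  bary v d p c (seg_pt e s); height v p c d (seg_pt e s)] i.
pose w := e.2 - e.1.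
pose b (i : 'I_4) := nth 0 [:: bary_slope v p c d w; bary_slope v c d p w;
  bary_slope v d p c w; height_slope v p c d w] i.
have lE i s t : l i t = l i s + (t - s) * b i.
  case: i => -[|[|[|[|//]]]] i; rewrite /l /b /=; [exact: bary_affine|exact: bary_affine|exact: bary_affine|exact: height_affine].
have insE s : [forall i, 0 <= l i s] = nonneg v p c d (seg_pt e s).
  apply/forallP/and4P => [h|[h1 h2 h3 h4]].
    by split; [have := h (inord 0)|have := h (inord 1)|have := h (inord 2)|have := h (inord 3)];
      rewrite /l inordK.
  by case=> -[|[|[|[|//]]]] i; rewrite /l.
have n1 x : nonneg v c d p x = nonneg v p c d x by exact: nonneg_rot.
have n2 x : nonneg v d p c x = nonneg v p c d x by rewrite -(nonneg_rot v d p c).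
have e0 : seg_pt e 0 = e.1 by rewrite /seg_pt scale0r addr0.
have e1 : seg_pt e 1 = e.2 by rewrite /seg_pt scale1r addrC subrK.
have H := signed_exits lE.
rewrite !insE e0 e1 in H.
have Hend a : ~ in_triangle p c d a -> ~ line_meets_edge v a (c, d) ->
  ~ line_meets_edge v a (d, p) -> ~ line_meets_edge v a (p, c) ->
  forall i : 'I_4, nth 0 [:: bary v p c d a; bary v c d p a; bary v d p c a; height v p c d a] i = 0 -> ~~ nonneg v p c d a.
  move=> t q1 q2 q3 [[|[|[|[|//]]]] i] /= z; apply/negP => nn.
  - exact/q1/(vertex_over_edge D0 z nn).
  - by apply/q2/(vertex_over_edge D1 z); rewrite n1.
  - by apply/q3/(vertex_over_edge D2 z); rewrite n2.
  - exact/t/(in_triangleP D0).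
have [a1 b1 c1 d1] := r1; have [a2 b2 c2 d2] := r2; have [a3 b3 c3 d3] := r3.
have {H} <- : \sum_i (if `[< exists s, [/\ 0 <= s <= 1, l i s = 0 & nonneg v p c d (seg_pt e s)] >]
          then sgz (b i) else 0) = (nonneg v p c d e.2 : nat)%:Z - (nonneg v p c d e.1 : nat)%:Z.
  rewrite -H.
  - apply: eq_bigr => i _; congr (if _ then _ else _).
    by apply: asbool_equiv_eq; split=> -[s [? ? ?]]; exists s; split=> //; rewrite ?insE// -insE.
  - by move=> i; rewrite /l e0; exact: Hend.
  - by move=> i; rewrite /l e1; exact: Hend.
  (* Where two coordinates vanish, [e] is above or below a vertex, against regularity; where a
     coordinate and the height vanish, [e] meets a side, against disjointness. *)
  move=> i j s s01 ij li lj; rewrite insE; apply/negP => nn.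
  have nn1 : nonneg v c d p (seg_pt e s) by rewrite n1.
  have nn2 : nonneg v d p c (seg_pt e s) by rewrite n2.
  have V1 x : ~ line_meets_edge v x e -> forall k, x + k *: v = seg_pt e s -> False.
    by move=> h k E; apply: h; exists s, k.
  have V2 f : disjoint_edges e f -> (exists2 t, 0 <= t <= 1 & seg_pt e s = seg_pt f t) -> False.
    by move=> h [t t01]; exact: h.
  wlog ltij : i j ij li lj / (i < j)%N.
    move=> W; have [|] := ltnP i j; first exact: W.
    by rewrite leq_eqVlt eq_sym => /orP[/eqP/val_inj E|]; [rewrite E eqxx in ij|
      apply: W => //; rewrite eq_sym].
  have P1 := @over_vertex v p c d (seg_pt e s) D0.
  have P2 := @over_vertex v c d p (seg_pt e s) D1.
  have P3 := @over_vertex v d p c (seg_pt e s) D2.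
  have S1 := @on_side v p c d (seg_pt e s) D0.
  have S2 := @on_side v c d p (seg_pt e s) D1.
  have S3 := @on_side v d p c (seg_pt e s) D2.
  move: i j ij li lj ltij; rewrite /l => -[[|[|[|[|//]]]] i] -[[|[|[|[|//]]]] j] //= _ li lj _.
  - by have [k] := P1 li lj; exact: V1.
  - by have [k] := P3 lj li; exact: V1.
  - exact: (V2 _ j1 (S1 li lj nn)).
  - by have [k] := P2 li lj; exact: V1.
  - by apply: (V2 _ j2 (S2 li _ nn1)); rewrite height_rot.
  - by apply: (V2 _ j3 (S3 li _ nn2)); rewrite -(height_rot v d p c).
rewrite !big_ord_recl big_ord0 /l /b /= /triangle_crossing.
rewrite (intersection_bary e D0) (crossing_bary D0 j1) (crossing_bary D1 j2) (crossing_bary D2 j3).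
rewrite (vol_rot2 v p c d) !(vol_rot v p c d) -/w.
have -> : nonneg v c d p = nonneg v p c d by apply: funext.
have -> : nonneg v d p c = nonneg v p c d by apply: funext.
by do 4!case: ifP => _; ring.
Qed.

End Tri.

(** * Degenerate case: triangles in a vertical plane *)

Section Vert.
Variable R : realType.
Local Notation pt := 'rV[R]_3.
Implicit Types u v w x p c d : pt.

Lemma plane_coords u v w x : det3 w u v != 0 ->
  x = (det3 x u v / det3 w u v) *: w + (det3 w x v / det3 w u v) *: u +
      (det3 w u x / det3 w u v) *: v.
Proof.
move=> D0; rewrite -[LHS](scalerK D0) cramer !scalerDr !scalerA.
by congr (_ *: _ + _ *: _ + _ *: _); rewrite mulrC.
Qed.

(** Here [vol] is 0 and the prism degenerates. Unless it is parallel to the plane of the triangle,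
    in which case all signs are 0, [e] meets this plane at most once. Being above exactly one of the
    two sides at [p] amounts to lying between them, that is, in the triangle. *)
Lemma edge_vertical_triangle v e p c k :
  disjoint_edges e (c + k *: v, p) -> disjoint_edges e (p, c) ->
  triangle_crossing v e p c (c + k *: v) = intersection e p (c, c + k *: v).
Proof.
move=> j2 j3; rewrite /triangle_crossing /crossing /intersection /=.
set w := e.2 - e.1; set del := det3 w (c - p) v.
have -> : det3 w (c + k *: v - c) v = 0 by rewrite !det3E !mxE; ring.
have -> : det3 w (p - (c + k *: v)) v = - del by rewrite /del !det3E !mxE; ring.
have -> : det3 w (c - p) (c + k *: v - p) = k * del by rewrite /del !det3E !mxE; ring.
rewrite sgz0 sgzN sgzM if_same add0r.
have [->|del0] := eqVneq del 0; first by rewrite sgz0 mulr0 oppr0 !if_same.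
(* [pla] vanishes on the vertical plane through [p] and [c], where [lam] and [hei] are coordinates
   along [c - p] and [v]. In these coordinates [(y, z)] the triangle lies between the lines [z = 0]
   and [z = y * k] for [0 <= y <= 1]. *)
pose pla s := det3 (seg_pt e s - p) (c - p) v / del.
pose lam s := det3 w (seg_pt e s - p) v / del.
pose hei s := det3 w (c - p) (seg_pt e s - p) / del.
have decomp s : pla s = 0 -> seg_pt e s = p + (lam s *: (c - p) + hei s *: v).
  move=> ps; rewrite [RHS]addrC; apply/eqP; rewrite -subr_eq; apply/eqP.
  by rewrite [LHS](plane_coords _ del0) -/(pla s) -/(lam s) -/(hei s) ps scale0r add0r.
have coords s y z : seg_pt e s = p + (y *: (c - p) + z *: v) ->
    [/\ pla s = 0, lam s = y & hei s = z].
  move=> E; rewrite /pla /lam /hei E.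
  have -> : p + (y *: (c - p) + z *: v) - p = y *: (c - p) + z *: v by rewrite addrC addKr.
  move: del0; rewrite /del !det3E !mxE => del0.
  by split; field; apply: contraNneq del0 => h; apply/eqP; lra.
have uniq s t : pla s = 0 -> pla t = 0 -> s = t.
  move=> hs ht; suff : pla t - pla s = t - s by rewrite hs ht; lra.
  rewrite /pla /seg_pt -/w; move: del0; rewrite /del !det3E !mxE => del0.
  by field; apply: contraNneq del0 => h; apply/eqP; lra.
have hA : crosses_over v e (p, c) <->
    exists s : R, [/\ 0 <= s <= 1, pla s = 0, 0 <= lam s <= 1 & 0 < hei s].
  split=> [[s [t [h [s01 t01 h0 E]]]]|[s [s01 ps l01 h0]]].
    exists s; have [|-> -> ->] := coords s t h; last by [].
    by rewrite E /seg_pt addrA.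
  by exists s, (lam s), (hei s); split => //; rewrite decomp // /seg_pt addrA.
have hB : crosses_over v e (c + k *: v, p) <->
    exists s : R, [/\ 0 <= s <= 1, pla s = 0, 0 <= lam s <= 1 & 0 < hei s - lam s * k].
  split=> [[s [t [h [s01 t01 h0 E]]]]|[s [s01 ps l01 h0]]].
    exists s; have [|-> -> ->] := coords s (1 - t) (h + (1 - t) * k).
      by rewrite E /seg_pt; apply: vec3P; rewrite !mxE /=; ring.
    by split=> //; lra.
  exists s, (1 - lam s), (hei s - lam s * k); split => //; first lra.
  by rewrite decomp // /seg_pt; apply: vec3P; rewrite !mxE /=; ring.
have hC : (exists s, 0 <= s <= 1 /\ in_triangle p c (c + k *: v) (seg_pt e s)) <->
    exists s : R, [/\ 0 <= s <= 1, pla s = 0, lam s <= 1 & exists t, 0 <= t <= lam s /\ hei s = t * k].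
  split=> [[s [s01 [x [y [z [x0 y0 z0 S E]]]]]]|[s [s01 ps l1 [t [t0 h]]]]].
    exists s; have [|-> -> ->] := coords s (y + z) (z * k).
      rewrite E (_ : x = 1 - y - z); last by rewrite -S; ring.
      by apply: vec3P; rewrite !mxE /=; ring.
    by split=> //; [lra|exists z; split=> //; lra].
  exists s; split=> //; exists (1 - lam s), (lam s - t), t; split; [lra|lra|lra|ring|].
  by rewrite decomp // h; apply: vec3P; rewrite !mxE /=; ring.
rewrite (asbool_equiv_eq hA) (asbool_equiv_eq hB) (asbool_equiv_eq hC).
have [[s [s01 ps]]|no] := pselect (exists s, 0 <= s <= 1 /\ pla s = 0); last first.
  have nos : forall s, 0 <= s <= 1 -> pla s = 0 -> False by move=> s ? ?; apply: no; exists s.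
  by do 3!(case: asboolP => [[? [/nos h /h //]]|_]); rewrite ?addr0.
have only (P : R -> Prop) : (exists s : R, [/\ 0 <= s <= 1, pla s = 0 & P s]) <-> P s.
  split=> [[t [t01 pt Pt]]|Ps]; last by exists s.
  by rewrite (uniq s t).
have n1 : 0 <= lam s <= 1 -> hei s <> 0.
  move=> l01 h0; apply: (j3 s (lam s)) => //.
  by rewrite decomp // h0 scale0r addr0.
have n2 : 0 <= lam s <= 1 -> hei s <> lam s * k.
  move=> l01 h0; apply: (j2 s (1 - lam s)); [by []|lra|].
  by rewrite decomp // h0 /seg_pt; apply: vec3P; rewrite !mxE /=; ring.
have -> : `[< exists s : R, [/\ 0 <= s <= 1, pla s = 0, 0 <= lam s <= 1 & 0 < hei s] >] =
    (0 <= lam s <= 1) && (0 < hei s).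
  apply/asboolP/andP => [[t [t01 pt ? ?]]|[? ?]]; last by exists s.
  by rewrite (uniq s t).
have -> : `[< exists s : R, [/\ 0 <= s <= 1, pla s = 0, 0 <= lam s <= 1 & 0 < hei s - lam s * k] >] =
    (0 <= lam s <= 1) && (0 < hei s - lam s * k).
  apply/asboolP/andP => [[t [t01 pt ? ?]]|[? ?]]; last by exists s.
  by rewrite (uniq s t).
have -> : `[< exists s : R, [/\ 0 <= s <= 1, pla s = 0, lam s <= 1 & exists t, 0 <= t <= lam s /\ hei s = t * k] >] =
    `[< lam s <= 1 /\ exists t, 0 <= t <= lam s /\ hei s = t * k >].
  apply: asbool_equiv_eq; split => [[t [t01 pt ? ?]]|[? ?]]; last by exists s.
  by rewrite (uniq s t).
have [l01|l01] := boolP (0 <= lam s <= 1); last first.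
  rewrite /= addr0; case: asboolP => // -[l1 [t [t0 _]]]; case/negP: l01; lra.
have {}n1 := n1 l01; have {}n2 := n2 l01.
have {l01}/andP[l0 l1] := l01; rewrite /= l1.
move: n1 n2 l0 l1; generalize (lam s) (hei s) => y z n1 n2 y0 y1.
have [k0|k0|k0] := sgzP k.
- rewrite mul0r if_same; move: n2; rewrite k0 !mulr0 subr0 => _.
  by case: ifP; rewrite ?addr0 ?addNr.
- rewrite mul1r; case: asboolP => [[_ [t [/andP[t0 ty] zE]]]|no].
    have z0 : 0 < z by rewrite lt_neqAle eq_sym; apply/andP; split; [exact/eqP|nra].
    have z1 : z - y * k <= 0 by nra.
    by rewrite z0 ltNge z1 add0r.
  have [z0|z0] := ltP 0 z; have [z1|z1] := ltP 0 (z - y * k); rewrite ?addr0 ?addNr //.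
    case: no; split=> //; exists (z / k); rewrite divfK ?gt_eqF//; split=> //.
    by apply/andP; split; [exact: divr_ge0 (ltW z0) (ltW k0)|rewrite ler_pdivrMr //; lra].
  by exfalso; nra.
rewrite mulN1r; case: asboolP => [[_ [t [/andP[t0 ty] zE]]]|no].
  have z0 : z <= 0 by nra.
  have z1 : 0 < z - y * k.
    by rewrite lt_neqAle subr_ge0 eq_sym subr_eq0; apply/andP; split; [exact/eqP|nra].
  by rewrite (ltNge 0 z) z0 z1 addr0.
have [z0|z0] := ltP 0 z; have [z1|z1] := ltP 0 (z - y * k); rewrite ?addr0 ?addNr //.
  by exfalso; nra.
case: no; split=> //; exists (z / k); rewrite divfK ?lt_eqF//; split=> //.
apply/andP; split; last by rewrite ler_ndivrMr //; lra.
by rewrite nmulr_lge0 ?invr_lt0.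
Qed.
End Vert.

(** * General position *)

Section OffPlanes.
Variable R : realType.
Local Notation pt := 'rV[R]_3.
Implicit Types u v w x p c d n : pt.

Local Notation "u .[1]" := (u ord0 0) (at level 2, format "u .[1]").
Local Notation "u .[2]" := (u ord0 1) (at level 2, format "u .[2]").
Local Notation "u .[3]" := (u ord0 2%:R) (at level 2, format "u .[3]").

Definition dot u v : R := u.[1] * v.[1] + u.[2] * v.[2] + u.[3] * v.[3].

Lemma mulmx_tr_dot u v : (u *m v^T) 0 0 = dot u v.
Proof.
rewrite mxE !big_ord_recl big_ord0 !mxE addr0 addrA /dot.
by congr (_ + _ * _ + _ * _); congr (_ _ _); apply: val_inj.
Qed.

(** The left kernel of a 3-by-2 matrix is never zero. Unlike the cross product, this also serves
    dependent [u] and [w]. *)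
Lemma exists_normal u w : exists n, [/\ n != 0, dot u n = 0 & dot w n = 0].
Proof.
pose A : 'M[R]_(3, 1 + 1) := row_mx u^T w^T; pose n := nz_row (kermx A).
have n0 : n != 0.
  rewrite nz_row_eq0 -mxrank_eq0 mxrank_ker subn_eq0 -ltnNge.
  exact: leq_ltn_trans (rank_leq_col A) _.
have : n *m A = 0 by apply/sub_kermxP; exact: nz_row_sub.
rewrite /A mul_mx_row => /eqP; rewrite row_mx_eq0 => /andP[/eqP h1 /eqP h2].
have dotC x : dot x n = dot n x by rewrite /dot; ring.
by exists n; split=> //; rewrite dotC -mulmx_tr_dot ?h1 ?h2 mxE.
Qed.

Lemma dot_gt0 n : n != 0 -> 0 < dot n n.
Proof.
move=> n0; rewrite lt_neqAle; apply/andP; split; last by rewrite /dot; nra.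
apply: contraNneq n0 => /esym h; rewrite /dot in h.
by apply/eqP/vec3P; rewrite mxE; nra.
Qed.

(** Each pair is a normal vector and a point of a plane. Density of [P] would not survive
    conjunctions; avoiding finitely many planes does, and it still leaves points in every ball. *)
Definition off_planes (P : pt -> Prop) : Prop :=
  exists L : seq (pt * pt), (forall nc, nc \in L -> nc.1 != 0) /\
    forall p, (forall nc, nc \in L -> dot (p - nc.2) nc.1 != 0) -> P p.

Lemma off_planes1 n c : n != 0 -> off_planes (fun p => dot (p - c) n != 0).
Proof.
move=> n0; exists [:: (n, c)]; split=> [nc|p h]; first by rewrite inE => /eqP ->.
by apply: (h (n, c)); rewrite inE.
Qed.

Lemma off_planes_mono (P Q : pt -> Prop) :
  (forall p, P p -> Q p) -> off_planes P -> off_planes Q.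
Proof. by move=> PQ [L [L0 h]]; exists L; split=> // p /h/PQ. Qed.

Lemma off_planesT (P : pt -> Prop) : (forall p, P p) -> off_planes P.
Proof. by move=> h; exists [::]. Qed.

Lemma off_planes_and (P Q : pt -> Prop) : off_planes P -> off_planes Q ->
  off_planes (fun p => P p /\ Q p).
Proof.
move=> [L [L0 hL]] [M [M0 hM]]; exists (L ++ M); split.
  by move=> nc; rewrite mem_cat => /orP[/L0|/M0].
move=> p h; split; [apply: hL|apply: hM] => nc ncL; apply: h.
  by rewrite mem_cat ncL.
by rewrite mem_cat ncL orbT.
Qed.

Lemma off_planes_all (T : eqType) (s : seq T) (P : T -> pt -> Prop) :
  (forall i, i \in s -> off_planes (P i)) ->
  off_planes (fun p => forall i, i \in s -> P i p).
Proof.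
elim: s => [|i s ih] h; first exact: off_planesT.
have h1 := h i (mem_head _ _).
have h2 : off_planes (fun p => forall i, i \in s -> P i p).
  by apply: ih => j ys; apply: h; rewrite inE ys orbT.
apply: off_planes_mono (off_planes_and h1 h2) => p [Px Ps] j.
by rewrite inE => /predU1P[->|/Ps].
Qed.

Lemma avoid_finite (s : seq R) : exists2 d, 0 < d & forall t, 0 < t < d -> t \notin s.
Proof.
elim: s => [|a s [d d0 h]]; first by exists 1.
have [a0|a0] := leP a 0.
  exists d => // t td; rewrite inE negb_or h // andbT.
  by apply/negP => /eqP; move: td => /andP[? _]; lra.
exists (Num.min d a); first by rewrite lt_min d0.
move=> t /andP[t0]; rewrite lt_min => /andP[td ta].
by rewrite inE negb_or h ?t0// lt_eqF.
Qed.

Lemma exists_transversal (L : seq pt) : (forall n, n \in L -> n != 0) ->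
  exists v, forall n, n \in L -> dot v n != 0.
Proof.
elim: L => [|n L ih] h; first by exists 0.
have [v hv] : exists v, forall n, n \in L -> dot v n != 0.
  by apply: ih => m mL; apply: h; rewrite inE mL orbT.
have n0 := h n (mem_head _ _).
have [v0|vn0] := eqVneq (dot v n) 0; last first.
  by exists v => m; rewrite inE => /predU1P[->|/hv].
(* A small step along [n] leaves the plane orthogonal to [n]; the listed step lengths are those that
   would land in one of the other planes. *)
have [d d0 hd] := avoid_finite [seq - dot v m / dot n m | m <- L].
have {}hd := hd (d / 2) ltac:(lra).
exists (v + (d / 2) *: n) => m; rewrite inE => /predU1P[->|mL].
  have -> : dot (v + (d / 2) *: n) n = dot v n + d / 2 * dot n n.
    by rewrite /dot !mxE; ring.
  have := dot_gt0 n0; rewrite v0 add0r => nn; apply: lt0r_neq0.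
  by rewrite mulr_gt0 //; lra.
have -> : dot (v + (d / 2) *: n) m = dot v m + d / 2 * dot n m.
  by rewrite /dot !mxE; ring.
have [->|nm] := eqVneq (dot n m) 0; first by rewrite mulr0 addr0 hv.
apply: contraNneq hd => E; apply/mapP; exists m => //.
have -> : dot v m = - (d / 2 * dot n m) by lra.
by rewrite opprK mulfK.
Qed.

Lemma off_planes_ball (P : pt -> Prop) p0 (r : R) : off_planes P -> 0 < r ->
  exists2 p, `|p - p0| < r & P p.
Proof.
move=> [L [L0 hL]] r0.
have [v hv] : exists v, forall n, n \in [seq nc.1 | nc <- L] -> dot v n != 0.
  by apply: exists_transversal => n /mapP[nc /L0 ? ->].
have [d d0 hd] := avoid_finite [seq - dot (p0 - nc.2) nc.1 / dot v nc.1 | nc <- L].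
pose e := r / (1 + `|v|).
have v1 : 0 < 1 + `|v| by rewrite ltr_pwDl.
have e0 : 0 < e by exact: divr_gt0.
(* Below [d] the point [p0 + t *: v] is off all planes; below [e] it stays within [r] of [p0]. The 1
   in the denominator of [e] covers [v = 0]. *)
pose t := Num.min d e / 2.
have m0 : 0 < Num.min d e by rewrite lt_min d0.
have t0 : 0 < t by rewrite /t; lra.
have tm : t < Num.min d e by rewrite /t; lra.
move: (tm); rewrite lt_min => /andP[td te].
exists (p0 + t *: v).
  rewrite addrC addKr normrZ gtr0_norm //.
  apply: le_lt_trans (_ : t * (1 + `|v|) < r); first by rewrite ler_pM2l // lerDr.
  by rewrite -ltr_pdivlMr.
apply: hL => -[n c] ncL /=; have vn : dot v n != 0.
  by apply: hv; apply/mapP; exists (n, c).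
have -> : dot (p0 + t *: v - c) n = dot (p0 - c) n + t * dot v n.
  by rewrite /dot !mxE; ring.
have := hd t; rewrite t0 td => /(_ isT); apply: contraNneq => E.
apply/mapP; exists (n, c) => //=; have -> : dot (p0 - c) n = - (t * dot v n) by lra.
by rewrite opprK mulfK.
Qed.

(** A direction outside the plane spanned by [a] and [f] can lead from [a] to a point of [f] only by
    a step of length 0, which would put [a] on [f]. *)
Lemma off_planes_vertex_edge a f :
  (forall t, 0 <= t <= 1 -> a <> seg_pt f t) ->
  off_planes (fun v => ~ line_meets_edge v a f).
Proof.
move=> nf; have [n [n0 h1 h2]] := exists_normal (a - f.1) (f.2 - f.1).
apply: off_planes_mono (off_planes1 0 n0) => v vn [t [k [t01 E]]].
rewrite subr0 in vn.
have : k * dot v n = 0.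
  have -> : k * dot v n = dot (a + k *: v) n - dot a n by rewrite /dot !mxE; ring.
  rewrite E; have -> : dot (seg_pt f t) n - dot a n = t * dot (f.2 - f.1) n - dot (a - f.1) n.
    by rewrite /dot /seg_pt !mxE; ring.
  by rewrite h1 h2 mulr0 subr0.
move/eqP; rewrite mulf_eq0 (negbTE vn) orbF => /eqP k0.
by apply: (nf t t01); rewrite -E k0 scale0r addr0.
Qed.

Lemma seg_pt0 (e : pt * pt) : seg_pt e 0 = e.1.
Proof. by rewrite /seg_pt scale0r addr0. Qed.

Lemma seg_pt1 (e : pt * pt) : seg_pt e 1 = e.2.
Proof. by rewrite /seg_pt scale1r addrC subrK. Qed.

Lemma off_planes_regular_edges e f : disjoint_edges e f ->
  off_planes (fun v => regular_edges v e f).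
Proof.
move=> dj.
have z01 : 0 <= (0 : R) <= 1 by rewrite lexx ler01.
have o01 : 0 <= (1 : R) <= 1 by rewrite ler01 lexx.
have h1 : off_planes (fun v => ~ line_meets_edge v e.1 f).
  by apply: off_planes_vertex_edge => t t01; rewrite -seg_pt0; exact: dj.
have h2 : off_planes (fun v => ~ line_meets_edge v e.2 f).
  by apply: off_planes_vertex_edge => t t01; rewrite -seg_pt1; exact: dj.
have h3 : off_planes (fun v => ~ line_meets_edge v f.1 e).
  by apply: off_planes_vertex_edge => t t01; rewrite -seg_pt0 => /esym; exact: dj.
have h4 : off_planes (fun v => ~ line_meets_edge v f.2 e).
  by apply: off_planes_vertex_edge => t t01; rewrite -seg_pt1 => /esym; exact: dj.
by apply: off_planes_mono (off_planes_and (off_planes_and h1 h2) (off_planes_and h3 h4))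
  => v [[? ?] [? ?]].
Qed.

(** For an edge [f] in the direction of [v] no apex makes [vol] nonzero, hence the last alternative.
    The two alternatives feed [edge_triangle] and [edge_vertical_triangle]. *)
Definition generic_apex v e f p : Prop :=
  [/\ disjoint_edges e (f.2, p), disjoint_edges e (p, f.1) &
   (vol v p f.1 f.2 != 0 /\ [/\ generic_triangle v e p f.1 f.2,
      ~ in_triangle p f.1 f.2 e.1 & ~ in_triangle p f.1 f.2 e.2])
   \/ exists k, f.2 = f.1 + k *: v].

Lemma off_planes_disjoint e c : (forall s, 0 <= s <= 1 -> seg_pt e s <> c) ->
  off_planes (fun p => disjoint_edges e (p, c) /\ disjoint_edges e (c, p)).
Proof.
move=> nc; have [n [n0 h1 h2]] := exists_normal (e.2 - e.1) (c - e.1).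
apply: off_planes_mono (off_planes1 c n0) => p pn.
have key s t : 0 <= s <= 1 -> seg_pt e s <> c + t *: (p - c).
  move=> s01 E; have : t * dot (p - c) n = 0.
    have -> : t * dot (p - c) n = dot (c + t *: (p - c)) n - dot c n.
      by rewrite /dot !mxE; ring.
    rewrite -E; have -> : dot (seg_pt e s) n - dot c n = s * dot (e.2 - e.1) n - dot (c - e.1) n.
      by rewrite /dot /seg_pt !mxE; ring.
    by rewrite h1 h2 mulr0 subr0.
  move/eqP; rewrite mulf_eq0 (negbTE pn) orbF => /eqP t0.
  by apply: (nc s s01); rewrite E t0 scale0r addr0.
split=> s t s01 t01; last exact: key.
have -> : seg_pt (p, c) t = c + (1 - t) *: (p - c) by apply: vec3P; rewrite !mxE /=; ring.
exact: key.
Qed.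

Lemma off_planes_not_in_triangle f a : (forall t, 0 <= t <= 1 -> a <> seg_pt f t) ->
  off_planes (fun p => ~ in_triangle p f.1 f.2 a).
Proof.
move=> na; have [n [n0 h1 h2]] := exists_normal (f.2 - f.1) (a - f.1).
apply: off_planes_mono (off_planes1 f.1 n0) => p pn [x [y [z [x0 y0 z0 S E]]]].
have yE : y = 1 - x - z by rewrite -S; ring.
have : x * dot (p - f.1) n = 0.
  have -> : x * dot (p - f.1) n = dot (a - f.1) n - z * dot (f.2 - f.1) n.
    by rewrite E yE /dot !mxE; ring.
  by rewrite h1 h2 mulr0 subr0.
move/eqP; rewrite mulf_eq0 (negbTE pn) orbF => /eqP xE.
apply: (na z); first lra.
by rewrite E yE xE /seg_pt; apply: vec3P; rewrite !mxE; ring.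
Qed.

Lemma off_planes_line_meets v a c : (forall k, a + k *: v <> c) ->
  off_planes (fun p => ~ line_meets_edge v a (p, c) /\ ~ line_meets_edge v a (c, p)).
Proof.
move=> nac; have [n [n0 h1 h2]] := exists_normal v (a - c).
apply: off_planes_mono (off_planes1 c n0) => p pn.
have key k t : a + k *: v <> c + t *: (p - c).
  move=> E; have : t * dot (p - c) n = 0.
    have -> : t * dot (p - c) n = dot (c + t *: (p - c)) n - dot c n.
      by rewrite /dot !mxE; ring.
    rewrite -E; have -> : dot (a + k *: v) n - dot c n = k * dot v n + dot (a - c) n.
      by rewrite /dot !mxE; ring.
    by rewrite h1 h2 mulr0 addr0.
  move/eqP; rewrite mulf_eq0 (negbTE pn) orbF => /eqP t0.
  by apply: (nac k); rewrite E t0 scale0r addr0.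
split=> -[t [k [_]]]; last exact: key.
have -> : seg_pt (p, c) t = c + (1 - t) *: (p - c) by apply: vec3P; rewrite !mxE /=; ring.
exact: key.
Qed.

Lemma off_planes_apex_over v e : off_planes (fun p => ~ line_meets_edge v p e).
Proof.
have [n [n0 h1 h2]] := exists_normal v (e.2 - e.1).
apply: off_planes_mono (off_planes1 e.1 n0) => p pn [t [k [_ E]]].
move/eqP: pn; apply.
have -> : dot (p - e.1) n = dot (p + k *: v) n - dot e.1 n - k * dot v n.
  by rewrite /dot !mxE; ring.
rewrite E h1 mulr0 subr0.
have -> : dot (seg_pt e t) n - dot e.1 n = t * dot (e.2 - e.1) n.
  by rewrite /dot /seg_pt !mxE; ring.
by rewrite h2 mulr0.
Qed.

Lemma off_planes_vol v c d : v != 0 ->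
  off_planes (fun p => vol v p c d != 0) \/ exists k, d = c + k *: v.
Proof.
move=> v0; pose w := d - c.
(* This is the cross product of [v] and [d - c], so [vol v p c d] is its scalar product with
   [p - c]. If it is zero, [d - c] is a multiple of [v]. *)
pose n : pt := \row_i nth 0 [:: v.[2] * w.[3] - v.[3] * w.[2];
   v.[3] * w.[1] - v.[1] * w.[3]; v.[1] * w.[2] - v.[2] * w.[1]] i.
have [n0|n0] := eqVneq n 0; last first.
  left; apply: off_planes_mono (off_planes1 c n0) => p.
  apply: contraNneq; rewrite /vol det3E /dot !mxE /= => E.
  lra.
right.
have e1 : v.[2] * w.[3] = v.[3] * w.[2].
  by apply/eqP; rewrite -subr_eq0; apply/eqP; move/rowP/(_ 0): n0; rewrite mxE [RHS]mxE.
have e2 : v.[3] * w.[1] = v.[1] * w.[3].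
  by apply/eqP; rewrite -subr_eq0; apply/eqP; move/rowP/(_ 1): n0; rewrite mxE [RHS]mxE.
have e3 : v.[1] * w.[2] = v.[2] * w.[1].
  by apply/eqP; rewrite -subr_eq0; apply/eqP; move/rowP/(_ 2%:R): n0; rewrite mxE [RHS]mxE.
suff [k wE] : exists k, w = k *: v by exists k; rewrite -wE /w addrC subrK.
clear n0; clear n; move: w e1 e2 e3 => w e1 e2 e3.
have [v1|v1] := eqVneq v.[1] 0; last first.
  by exists (w.[1] / v.[1]); apply: vec3P; rewrite mxE mulrAC; apply/esym; apply: (canLR (mulfK v1)); lra.
have [v2|v2] := eqVneq v.[2] 0; last first.
  by exists (w.[2] / v.[2]); apply: vec3P; rewrite mxE mulrAC; apply/esym; apply: (canLR (mulfK v2)); lra.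
have [v3|v3] := eqVneq v.[3] 0; last first.
  by exists (w.[3] / v.[3]); apply: vec3P; rewrite mxE mulrAC; apply/esym; apply: (canLR (mulfK v3)); lra.
by case/eqP: v0; apply: vec3P; rewrite mxE.
Qed.

Lemma off_planes_generic_apex v e f : v != 0 -> disjoint_edges e f ->
  regular_edges v e f -> off_planes (generic_apex v e f).
Proof.
move=> v0 dj [r1 r2 r3 r4].
have z01 : 0 <= (0 : R) <= 1 by rewrite lexx ler01.
have o01 : 0 <= (1 : R) <= 1 by rewrite ler01 lexx.
have d1 : off_planes (fun p => disjoint_edges e (p, f.1) /\ disjoint_edges e (f.1, p)).
  by apply: off_planes_disjoint => s s01; rewrite -seg_pt0; exact: dj.
have d2 : off_planes (fun p => disjoint_edges e (p, f.2) /\ disjoint_edges e (f.2, p)).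
  by apply: off_planes_disjoint => s s01; rewrite -seg_pt1; exact: dj.
have d12 := off_planes_and d1 d2.
have [vol0|vert] := off_planes_vol f.1 f.2 v0; last first.
  by apply: off_planes_mono d12 => p [[? ?] [? ?]]; split=> //; right.
have t1 : off_planes (fun p => ~ in_triangle p f.1 f.2 e.1).
  by apply: off_planes_not_in_triangle => t t01; rewrite -seg_pt0; exact: dj.
have t2 : off_planes (fun p => ~ in_triangle p f.1 f.2 e.2).
  by apply: off_planes_not_in_triangle => t t01; rewrite -seg_pt1; exact: dj.
have m a c : (exists2 t, 0 <= t <= 1 & c = seg_pt f t) -> ~ line_meets_edge v a f ->
    off_planes (fun p => ~ line_meets_edge v a (p, c) /\ ~ line_meets_edge v a (c, p)).
  move=> [t t01 ->] na; apply: off_planes_line_meets => k E.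
  by apply: na; exists t, k.
have f1 : exists2 t, 0 <= t <= 1 & f.1 = seg_pt f t by exists 0; rewrite ?seg_pt0.
have f2 : exists2 t, 0 <= t <= 1 & f.2 = seg_pt f t by exists 1; rewrite ?seg_pt1.
have m1 := off_planes_and (m e.1 f.1 f1 r1) (m e.1 f.2 f2 r1).
have m2 := off_planes_and (m e.2 f.1 f1 r2) (m e.2 f.2 f2 r2).
have all := off_planes_and (off_planes_and d12 (off_planes_and m1 m2))
  (off_planes_and (off_planes_and t1 t2) (off_planes_and vol0 (off_planes_apex_over v e))).
apply: off_planes_mono all => p.
move=> [[[[? ?] [? ?]] [[[? ?] [? ?]] [[? ?] [? ?]]]] [[? ?] [? ?]]].
split=> //; left; split=> //; split=> //.
Qed.
End OffPlanes.

(** * Linking numbers of closed chains of edges *)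

Section Chains.
Variable R : realType.
Local Notation pt := 'rV[R]_3.
Implicit Types (u v x p c d n : pt) (e f : pt * pt) (E F : seq (pt * pt)).

Lemma seg_pt_rev e t : seg_pt (e.2, e.1) t = seg_pt e (1 - t).
Proof. by rewrite /seg_pt /=; apply: vec3P; rewrite !mxE; ring. Qed.

Lemma crossing_revr v e f : crossing v e (f.2, f.1) = - crossing v e f.
Proof.
rewrite /crossing /=.
have -> : det3 (e.2 - e.1) (f.1 - f.2) v = - det3 (e.2 - e.1) (f.2 - f.1) v.
  by rewrite !det3E !mxE; ring.
have -> : `[< crosses_over v e (f.2, f.1) >] = `[< crosses_over v e f >].
  apply: asbool_equiv_eq; split=> -[s [t [h [s01 t01 h0]]]] E; exists s, (1 - t), h; split=> //; [lra| |lra|].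
    by rewrite -seg_pt_rev.
  by rewrite seg_pt_rev subKr.
by rewrite sgzN; case: ifP => //; rewrite oppr0.
Qed.

(** Looking from the opposite side exchanges over and under. The symmetry of linking numbers in the
    two curves rests on this. *)
Lemma crossing_opp v e f : crossing (- v) f e = crossing v e f.
Proof.
rewrite /crossing.
have -> : det3 (f.2 - f.1) (e.2 - e.1) (- v) = det3 (e.2 - e.1) (f.2 - f.1) v.
  by rewrite !det3E !mxE; ring.
congr (if _ then _ else _).
apply: asbool_equiv_eq; split=> -[s [t [h [s01 t01 h0]]]] E; exists t, s, h; split=> //.
  by rewrite E scalerN subrK.
by rewrite E scalerN addrK.
Qed.

Lemma crossing_revl v e f : crossing v (e.2, e.1) f = - crossing v e f.
Proof. by rewrite -crossing_opp crossing_revr crossing_opp. Qed.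

Lemma line_meets_edge_opp v x e : line_meets_edge (- v) x e <-> line_meets_edge v x e.
Proof.
split=> -[t [k [t01 E]]]; exists t, (- k); split=> //.
  by rewrite scaleNr -scalerN.
by rewrite scaleNr scalerN opprK.
Qed.

Lemma line_meets_edge_rev v x e : line_meets_edge v x (e.2, e.1) <-> line_meets_edge v x e.
Proof.
split=> -[t [k [t01 E]]]; exists (1 - t), k; split; [lra| |lra|].
  by rewrite -seg_pt_rev.
by rewrite seg_pt_rev subKr.
Qed.

Lemma regular_edges_opp v e f : regular_edges v e f -> regular_edges (- v) f e.
Proof. by case=> h1 h2 h3 h4; split; rewrite line_meets_edge_opp. Qed.

Lemma regular_edges_rev v e f : regular_edges v e f -> regular_edges v (e.2, e.1) f.
Proof. by case=> h1 h2 h3 h4; split => //; rewrite line_meets_edge_rev. Qed.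

Definition chain_lk v E F : int := \sum_(e <- E) \sum_(f <- F) crossing v e f.

(** Zero boundary, tested against all integer functions of the vertices: this is the form in which
    sums along the chain telescope. *)
Definition closed_chain E : Prop :=
  forall phi : pt -> int, \sum_(e <- E) (phi e.2 - phi e.1) = 0.

Definition disjoint_chains E F : Prop :=
  forall e f, e \in E -> f \in F -> disjoint_edges e f.

Definition regular_chains v E F : Prop :=
  v != 0 /\ forall e f, e \in E -> f \in F -> regular_edges v e f.

Lemma chain_lk_opp v E F : chain_lk (- v) F E = chain_lk v E F.
Proof.
rewrite /chain_lk exchange_big; apply: eq_bigr => e _; apply: eq_bigr => f _.
exact: crossing_opp.
Qed.

Lemma regular_chains_opp v E F : regular_chains v E F -> regular_chains (- v) F E.
Proof.
by move=> [v0 h]; split=> [|f e fF eE]; [rewrite oppr_eq0|exact/regular_edges_opp/h].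
Qed.

Lemma off_planes_regular_chains E F : disjoint_chains E F ->
  off_planes (fun v => regular_chains v E F).
Proof.
move=> dj; apply: off_planes_and.
  have [n [n0 _ _]] := exists_normal (0 : pt) 0.
  apply: off_planes_mono (off_planes1 0 n0) => v.
  by apply: contraNneq => ->; rewrite /dot !mxE; apply/eqP; ring.
have h : off_planes (fun v => forall e, e \in E -> forall f, f \in F -> regular_edges v e f).
  apply: off_planes_all => e eE; apply: off_planes_all => f fF.
  exact/off_planes_regular_edges/dj.
by apply: off_planes_mono h => v h e f eE; exact: h.
Qed.

Lemma sum_triangle_crossing v E f p : closed_chain E ->
  (forall e, e \in E -> generic_apex v e f p) ->
  \sum_(e <- E) triangle_crossing v e p f.1 f.2 = \sum_(e <- E) intersection e p f.
Proof.
move=> cE gen.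
(* The case is fixed before summing: the jumps of the indicator cancel only if the same alternative
   of [generic_apex] is used for every edge of [E]. *)
have [[vol0 vert]|deg] := pselect (vol v p f.1 f.2 != 0 /\ ~ exists k, f.2 = f.1 + k *: v).
  apply/esym/eqP; rewrite -subr_eq0 -sumrB; apply/eqP.
  transitivity (\sum_(e <- E) sgz (vol v p f.1 f.2) *
      ((nonneg v p f.1 f.2 e.2 : nat)%:Z - (nonneg v p f.1 f.2 e.1 : nat)%:Z)).
    rewrite !big_seq; apply: eq_bigr => e eE.
    have [_ _ [[_ [g t1 t2]]|//]] := gen e eE.
    by rewrite -edge_triangle // -surjective_pairing.
  by rewrite -big_distrr /= (cE (fun x => (nonneg v p f.1 f.2 x : nat)%:Z)) mulr0.
rewrite !big_seq; apply: eq_bigr => e eE.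
have [d1 d2 [[vol0 _]|[k fE]]] := gen e eE; last first.
  by rewrite [in RHS](surjective_pairing f) fE edge_vertical_triangle // -fE.
have [[k fE]|//] := pselect (exists k, f.2 = f.1 + k *: v); last by move=> h; case: deg.
by rewrite [in RHS](surjective_pairing f) fE edge_vertical_triangle // -fE.
Qed.

(* Replacing each edge of F by the boundary of its triangle with apex p adds
   edges that cancel in pairs, so the linking number of E with F is a number of
   intersections that does not depend on v. *)
Lemma chain_lk_apex v E F p : closed_chain E -> closed_chain F ->
  (forall e f, e \in E -> f \in F -> generic_apex v e f p) ->
  chain_lk v E F = \sum_(f <- F) \sum_(e <- E) intersection e p f.
Proof.
move=> cE cF gen.
transitivity (\sum_(f <- F) \sum_(e <- E) triangle_crossing v e p f.1 f.2); last first.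
  rewrite !big_seq; apply: eq_bigr => f fF; apply: sum_triangle_crossing => // e eE.
  exact: gen.
rewrite exchange_big /chain_lk; apply: eq_bigr => e _.
rewrite /triangle_crossing.
have -> : \sum_(f <- F) (crossing v e (f.1, f.2) + crossing v e (f.2, p) + crossing v e (p, f.1)) =
    \sum_(f <- F) crossing v e f + \sum_(f <- F) (crossing v e (f.2, p) - crossing v e (f.1, p)).
  rewrite -big_split; apply: eq_bigr => f _ /=.
  by rewrite -surjective_pairing -addrA -(crossing_revr v e (f.1, p)).
by rewrite (cF (fun x => crossing v e (x, p))) addr0.
Qed.

Lemma off_planes_apex v E F : disjoint_chains E F -> regular_chains v E F ->
  off_planes (fun p => forall e f, e \in E -> f \in F -> generic_apex v e f p).
Proof.
move=> dj [v0 reg].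
have h : off_planes (fun p => forall e, e \in E -> forall f, f \in F -> generic_apex v e f p).
  apply: off_planes_all => e eE; apply: off_planes_all => f fF.
  by apply: off_planes_generic_apex => //; [exact: dj|exact: reg].
by apply: off_planes_mono h => p h e f eE; exact: h.
Qed.

(** One apex is chosen generic for both directions; the resulting number of intersections mentions
    neither. *)
Theorem chain_lk_indep v v' E F : closed_chain E -> closed_chain F ->
  disjoint_chains E F -> regular_chains v E F -> regular_chains v' E F ->
  chain_lk v E F = chain_lk v' E F.
Proof.
move=> cE cF dj r r'.
have [p _ [g g']] := off_planes_ball 0
  (off_planes_and (off_planes_apex dj r) (off_planes_apex dj r')) ltr01.
by rewrite (chain_lk_apex cE cF g) (chain_lk_apex cE cF g').
Qed.

Lemma ball_in_triangle x0 (r : R) p c d x : `|p - x0| < r -> `|c - x0| < r -> `|d - x0| < r ->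
  in_triangle p c d x -> `|x - x0| < r.
Proof.
move=> pr cr dr [i [j [k [i0 j0 k0 S ->]]]].
have -> : i *: p + j *: c + k *: d - x0 = i *: (p - x0) + j *: (c - x0) + k *: (d - x0).
  have -> : i = 1 - j - k by rewrite -S; ring.
  by apply: vec3P; rewrite !mxE; ring.
have n1 : `|i *: (p - x0)| <= i * `|p - x0| by rewrite normrZ ger0_norm.
have n2 : `|j *: (c - x0)| <= j * `|c - x0| by rewrite normrZ ger0_norm.
have n3 : `|k *: (d - x0)| <= k * `|d - x0| by rewrite normrZ ger0_norm.
have := ler_normD (i *: (p - x0) + j *: (c - x0)) (k *: (d - x0)).
have := ler_normD (i *: (p - x0)) (j *: (c - x0)).
move=> m1 m2.
have a1 : i * `|p - x0| <= i * r by rewrite ler_wpM2l // ltW.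
have a2 : j * `|c - x0| <= j * r by rewrite ler_wpM2l // ltW.
have a3 : k * `|d - x0| <= k * r by rewrite ler_wpM2l // ltW.
have lt : i * `|p - x0| + j * `|c - x0| + k * `|d - x0| < i * r + j * r + k * r.
  have [ip|ip] := eqVneq i 0; last first.
    have : i * `|p - x0| < i * r by rewrite ltr_pM2l // lt_neqAle eq_sym ip.
    lra.
  have [jp|jp] := eqVneq j 0; last first.
    have : j * `|c - x0| < j * r by rewrite ltr_pM2l // lt_neqAle eq_sym jp.
    lra.
  have -> : k = 1 by move: S; rewrite ip jp !add0r.
  rewrite ip jp; lra.
have : i * r + j * r + k * r = r by rewrite -!mulrDl S mul1r.
lra.
Qed.

Lemma seg_pt_ball x0 (r : R) e t : `|e.1 - x0| < r -> `|e.2 - x0| < r ->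
  0 <= t <= 1 -> `|seg_pt e t - x0| < r.
Proof.
move=> h1 h2 t01; apply: (ball_in_triangle h1 h1 h2).
exists 0, (1 - t), t; split; [lra|lra|lra|ring|].
by rewrite /seg_pt; apply: vec3P; rewrite !mxE; ring.
Qed.

(** The apex is taken inside the ball. By convexity all the triangles of the cone then lie in the
    ball, and [E] meets none of them. *)
Lemma chain_lk_ball v E F x0 (r : R) : closed_chain E -> closed_chain F ->
  regular_chains v E F ->
  (forall f, f \in F -> `|f.1 - x0| < r /\ `|f.2 - x0| < r) ->
  (forall e s, e \in E -> 0 <= s <= 1 -> r <= `|seg_pt e s - x0|) ->
  chain_lk v E F = 0.
Proof.
move=> cE cF reg inF outE.
have [r0|r0] := ltP 0 r; last first.
  have -> : F = [::].
    case: F inF {cF reg} => // f F /(_ f (mem_head _ _))[h _].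
    by move: (lt_le_trans h r0); rewrite normr_lt0.
  by rewrite /chain_lk big1 // => e _; rewrite big_nil.
have dj : disjoint_chains E F.
  move=> e f eE fF s t s01 t01 E'; have [h1 h2] := inF f fF.
  by have := outE e s eE s01; rewrite E' leNgt (seg_pt_ball h1 h2 t01).
have [p pr g] := off_planes_ball x0 (off_planes_apex dj reg) r0.
rewrite (chain_lk_apex cE cF g) big_seq big1 // => f fF.
rewrite big_seq big1 // => e eE; rewrite /intersection.
case: asboolP => // -[s [s01 T]]; have [h1 h2] := inF f fF.
by have := outE e s eE s01; rewrite leNgt (ball_in_triangle pr h1 h2 T).
Qed.

Lemma chain_lk_ballr v E F x0 (r : R) : closed_chain E -> closed_chain F ->
  regular_chains v E F ->
  (forall f, f \in E -> `|f.1 - x0| < r /\ `|f.2 - x0| < r) ->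
  (forall e s, e \in F -> 0 <= s <= 1 -> r <= `|seg_pt e s - x0|) ->
  chain_lk v E F = 0.
Proof.
move=> cE cF reg inE outF; rewrite -chain_lk_opp.
exact: (chain_lk_ball cF cE (regular_chains_opp reg) inE outF).
Qed.
End Chains.

(** * Fine inscribed polygons *)

Section Compactness.
Variable R : realType.

(** Compactness in the manner of a Lebesgue number: a property that holds near each point for all
    small [r] holds everywhere for one [r]. It gives both uniform continuity and the positive
    distance of disjoint arcs. *)
Lemma unit_interval_uniform (P : R -> R -> Prop) :
  (forall x, 0 <= x <= 1 -> exists2 d, 0 < d &
     forall s r, 0 <= s <= 1 -> `|s - x| < d -> 0 < r < d -> P r s) ->
  exists2 r, 0 < r & forall s, 0 <= s <= 1 -> P r s.
Proof.
move=> loc.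
have K := (compact_near_coveringP _).1 (@segment_compact R 0 1).
have near0 (d : R) : 0 < d -> (0^'+)%classic [set r | 0 < r < d]%classic.
  move=> d0; near=> r; apply/andP; split; near: r; first exact: nbhs_right_gt.
  exact: nbhs_right_lt.
have : \forall r \near (0^'+)%classic, (`[0, 1] `<=` (fun s => 0 <= s <= 1 -> P r s))%classic.
  apply: K => x /=; rewrite in_itv /= => x01; have [d d0 h] := loc x x01.
  exists ([set s | `|s - x| < d]%classic, [set r | 0 < r < d]%classic).
    split; last exact: near0.
    by apply/nbhs_ballP; exists d => //= s; rewrite /ball /= distrC.
  by move=> [s r] [/= sx rd] s01; exact: h.
move=> H; have [r [Hr /= /andP[r0 _]]] := @filter_ex _ (0^'+)%classic _ _ (filterI H (near0 1 ltr01)).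
by exists r => // s s01; apply: Hr => //; rewrite /= in_itv.
Unshelve. all: by end_near.
Qed.

Lemma within_continuous_dist (f : R -> 'rV[R]_3) x (e : R) :
  {within `[0%R, 1%R], continuous f}%classic -> 0 <= x <= 1 -> 0 < e ->
  exists2 d, 0 < d & forall s, 0 <= s <= 1 -> `|s - x| < d -> `|f s - f x| < e.
Proof.
move=> /subspace_continuousP cf x01 e0.
have := cf x; rewrite /= in_itv /= => /(_ x01)/cvgr_dist_lt/(_ e e0).
rewrite near_withinE near_simpl => /nbhs_ballP[d /= d0 h].
exists d => // s s01 sx; rewrite distrC; apply: h.
  by rewrite /ball /= distrC.
by rewrite in_itv.
Qed.

Lemma within_continuous_unif (f : R -> 'rV[R]_3) (e : R) :
  {within `[0%R, 1%R], continuous f}%classic -> 0 < e ->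
  exists2 d, 0 < d & forall s t, 0 <= s <= 1 -> 0 <= t <= 1 ->
    `|s - t| <= d -> `|f s - f t| < e.
Proof.
move=> cf e0.
have [|d d0 h] := @unit_interval_uniform
    (fun d s => forall t, 0 <= t <= 1 -> `|s - t| <= d -> `|f s - f t| < e).
  move=> x x01; have [|d d0 h] := @within_continuous_dist f x (e / 2) cf x01; first lra.
  exists (d / 2) => [|s r s01 sx rd t t01 st]; first lra.
  have h1 : `|f s - f x| < e / 2 by apply: h => //; lra.
  have h2 : `|f t - f x| < e / 2.
    apply: h => //; have := ler_normD (t - s) (s - x).
    rewrite (distrC t) [X in `|X|](_ : _ = t - x); last by ring.
    lra.
  have := ler_normB (f s - f x) (f t - f x).
  have -> : f s - f x - (f t - f x) = f s - f t by rewrite opprB addrA subrK.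
  lra.
by exists d => // s t s01 t01; exact: h.
Qed.

Lemma disjoint_arcs_dist (f g : R -> 'rV[R]_3) :
  {within `[0%R, 1%R], continuous f}%classic ->
  {within `[0%R, 1%R], continuous g}%classic ->
  (forall s t, 0 <= s <= 1 -> 0 <= t <= 1 -> f s <> g t) ->
  exists2 r, 0 < r & forall s t, 0 <= s <= 1 -> 0 <= t <= 1 -> r <= `|f s - g t|.
Proof.
move=> cf cg fg.
have step x : 0 <= x <= 1 -> exists2 r, 0 < r & forall t, 0 <= t <= 1 -> r <= `|f x - g t|.
  move=> x01; apply: (@unit_interval_uniform (fun r t => r <= `|f x - g t|)) => y y01.
  have fy : 0 < `|f x - g y| / 2.
    by rewrite divr_gt0 // normr_gt0 subr_eq0; apply/eqP; exact: fg.
  have [d d0 h] := within_continuous_dist cg y01 fy.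
  exists (Num.min d (`|f x - g y| / 2)); first by rewrite lt_min d0.
  move=> t r t01; rewrite !lt_min => /andP[td _] /andP[r0 /andP[_ rf]].
  have ht := h t t01 td.
  have := ler_normD (f x - g t) (g t - g y).
  rewrite [X in `|X|](_ : _ = f x - g y); last by rewrite addrA subrK.
  lra.
have [|r r0 h] := @unit_interval_uniform
    (fun r s => forall t, 0 <= t <= 1 -> r <= `|f s - g t|).
  move=> x x01; have [r r0 h] := step x x01.
  have [|d d0 hd] := @within_continuous_dist f x (r / 2) cf x01; first lra.
  exists (Num.min d (r / 2)); first by rewrite lt_min d0; lra.
  move=> s r'; rewrite !lt_min => s01 /andP[sd _] /andP[r'0 /andP[_ r'r]] t t01.
  have := hd s s01 sd; have := h t t01.
  have := ler_normD (f x - f s) (f s - g t).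
  rewrite [X in `|X|](_ : _ = f x - g t); last by rewrite addrA subrK.
  rewrite (distrC (f x) (f s)); lra.
by exists r => // s t s01 t01; exact: h.
Qed.
End Compactness.

Section Polygons.
Variable R : realType.
Local Notation pt := 'rV[R]_3.
Implicit Types (v : pt) (A B : seq pt) (E F : seq (pt * pt)).

Lemma poly_edges_closed A : closed_chain (poly_edges A).
Proof.
move=> phi; rewrite sumrB /poly_edges.
have s1 : (size A <= size (rot 1 A))%N by rewrite size_rot.
have s2 : (size (rot 1 A) <= size A)%N by rewrite size_rot.
rewrite -(big_map snd xpredT phi) -(big_map fst xpredT phi).
rewrite -/(unzip2 _) -/(unzip1 _) unzip1_zip // unzip2_zip //.
by apply/eqP; rewrite subr_eq0; apply/eqP/perm_big; rewrite perm_rot.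
Qed.

Lemma poly_edges_fst A a : a \in A -> exists2 e, e \in poly_edges A & e.1 = a.
Proof.
have s1 : (size A <= size (rot 1 A))%N by rewrite size_rot.
by rewrite -{1}(unzip1_zip s1) => /mapP[e eA ->]; exists e.
Qed.

Lemma poly_edges_mem A e : e \in poly_edges A -> e.1 \in A /\ e.2 \in A.
Proof.
have s1 : (size A <= size (rot 1 A))%N by rewrite size_rot.
have s2 : (size (rot 1 A) <= size A)%N by rewrite size_rot.
move=> eA; split; first by rewrite -(unzip1_zip s1); exact: map_f.
by rewrite -(mem_rot 1) -(unzip2_zip s2); exact: map_f.
Qed.

Lemma regular_directionP A B v :
  regular_direction A B v <-> regular_chains v (poly_edges A) (poly_edges B).
Proof.
split=> [[v0 h1 h2]|[v0 h]].
  split=> // e f eA fB; have [e1 e2] := poly_edges_mem eA.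
  by have [f1 f2] := poly_edges_mem fB; split; [exact: h1|exact: h1|exact: h2|exact: h2].
split=> // a e /poly_edges_fst[f fA <-] eB; first by have [] := h f e fA eB.
by have [] := h e f eB fA.
Qed.

Lemma poly_lk_chain A B v : disjoint_chains (poly_edges A) (poly_edges B) ->
  regular_chains v (poly_edges A) (poly_edges B) ->
  poly_lk A B = chain_lk v (poly_edges A) (poly_edges B).
Proof.
move=> dj reg; rewrite /poly_lk -[crossing_sum _ _ _]/(chain_lk _ _ _).
apply: chain_lk_indep => //; try exact: poly_edges_closed.
apply/regular_directionP.
have ex : exists v, [set v | regular_direction A B v]%classic v.
  by exists v; apply/regular_directionP.
exact: (xgetPex 0 ex).
Qed.

Definition arc_edges (N : nat) (a : R -> pt) : seq (pt * pt) :=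
  [seq (a (k%:R / N%:R), a (k.+1%:R / N%:R)) | k <- iota 0 N].

Definition curve_edges N (C : curve R) : seq (pt * pt) :=
  flatten [seq arc_edges N a | a <- C].

Definition closed_curve (C : curve R) : Prop :=
  [seq a 1 | a <- C] = rot 1 [seq a 0 | a <- C].

(** The end left out of each arc is the start of the next one, so rotating the list of samples pairs
    each sample with its successor on the same arc. *)
Lemma poly_edges_inscribed N (C : curve R) : (0 < N)%N -> closed_curve C ->
  poly_edges (inscribed_polygon N C) = curve_edges N C.
Proof.
move=> N0 cC.
pose M (a : R -> pt) := [seq a (k%:R / N%:R) | k <- iota 1 N.-1].
pose A (a : R -> pt) := [seq a (k%:R / N%:R) | k <- iota 0 N].
pose B (a : R -> pt) := [seq a (k.+1%:R / N%:R) | k <- iota 0 N].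
have AE a : A a = a 0 :: M a.
  by rewrite /A /M -(prednK N0) /= mul0r.
have BE a : B a = rcons (M a) (a 1).
  have -> : B a = [seq a (k%:R / N%:R) | k <- iota 1 N].
    by rewrite (iotaDl 1 0) -map_comp.
  have -> : iota 1 N = rcons (iota 1 N.-1) N.
    by case: N N0 {M A B AE} => // n _; rewrite -(addn1 n) iotaD cats1 /= add1n addn1.
  by rewrite map_rcons divff // pnatr_eq0 -lt0n.
(* Closedness is not inherited by the tail of a list, so the induction runs over open chains of arcs
   ending at a given point [x0]. *)
have rotE x0 (D : curve R) : D != [::] -> [seq a 1 | a <- D] = rcons (behead [seq a 0 | a <- D]) x0 ->
    flatten [seq B a | a <- D] = rcons (behead (flatten [seq A a | a <- D])) x0.
  elim: D => [//|a [|b D] ih _] /=; first by case=> <-; rewrite !cats0 BE AE.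
  case=> ab /(ih isT); rewrite BE /= => ->; rewrite ab (AE a) (AE b) /=.
  by rewrite cat_rcons -rcons_cons -rcons_cat.
rewrite /poly_edges /inscribed_polygon -/A /curve_edges.
have -> : rot 1 (flatten [seq A a | a <- C]) = flatten [seq B a | a <- C].
  case: C cC => [//|a C] cC.
  rewrite (rotE (a 0)) //; last by rewrite cC /= rot1_cons.
  by rewrite /= AE /= rot1_cons.
elim: C {cC} => //= a C ih; rewrite zip_cat ?ih; last by rewrite !size_map.
by congr (_ ++ _); rewrite /A /B /arc_edges; elim: (iota 0 N) => //= k s ->.
Qed.

Definition fine_arc (N : nat) (r : R) (a : R -> pt) : Prop :=
  forall s t, 0 <= s <= 1 -> 0 <= t <= 1 -> `|s - t| <= N%:R^-1 -> `|a s - a t| < r.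

(** An edge of a polygon inscribed at resolution [N] or finer stays within [r] of a point of its own
    arc. Distance [3 * r] between the curves thus leaves [2 * r] between an edge and the other
    curve, and the edges of the two polygons remain disjoint. *)
Definition tame N r (C D : curve R) : Prop :=
  [/\ (0 < N)%N, 0 < r, forall a, a \in C -> fine_arc N r a, forall a, a \in D -> fine_arc N r a &
   forall a b s t, a \in C -> b \in D -> 0 <= s <= 1 -> 0 <= t <= 1 -> 3 * r <= `|a s - b t|].

Lemma tame_sym N r C D : tame N r C D -> tame N r D C.
Proof.
by case=> N0 r0 h1 h2 h; split=> // a b s t aD bC s01 t01; rewrite distrC; exact: h.
Qed.

Lemma frac01 k N : (0 < N)%N -> (k <= N)%N -> 0 <= (k%:R / N%:R : R) <= 1.
Proof.
move=> N0 kN; rewrite divr_ge0 //= ler_pdivrMr ?ltr0n // mul1r ler_nat //.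
Qed.

Lemma arc_edge_near N0 N r (a : R -> pt) e : (0 < N0)%N -> (N0 <= N)%N -> 0 < r -> fine_arc N0 r a ->
  e \in arc_edges N a ->
  exists s, [/\ 0 <= s <= 1, `|e.1 - a s| < r & `|e.2 - a s| < r].
Proof.
move=> N00 NN r0 fa /mapP[k]; rewrite mem_iota add0n => /andP[_ kN] ->.
have N1 : (0 < N)%N by exact: leq_trans N00 NN.
exists (k%:R / N%:R); rewrite frac01 // 1?ltnW // subrr normr0; split=> //=.
apply: fa; rewrite ?frac01 // 1?ltnW //.
rewrite -mulrBl -natrB // subSnn mul1r gtr0_norm ?invr_gt0 ?ltr0n //.
by rewrite lef_pV2 ?posrE ?ltr0n // ler_nat.
Qed.

Lemma curve_edge_far N0 N r (C D : curve R) e b t s : tame N0 r C D -> (N0 <= N)%N ->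
  e \in curve_edges N C -> b \in D -> 0 <= t <= 1 -> 0 <= s <= 1 -> 2 * r <= `|seg_pt e s - b t|.
Proof.
move=> [N00 r0 f1 f2 far] NN /flattenP[_ /mapP[a aC ->] ea] bD t01 s01.
have [u [u01 e1 e2]] := arc_edge_near N00 NN r0 (f1 a aC) ea.
have h := seg_pt_ball e1 e2 s01; have := far a b u t aC bD u01 t01.
have := ler_normD (a u - seg_pt e s) (seg_pt e s - b t).
rewrite [X in `|X|](_ : _ = a u - b t); last by rewrite addrA subrK.
rewrite (distrC (a u) (seg_pt e s)); lra.
Qed.

Lemma curve_edges_disjoint N0 N K r (C D : curve R) : tame N0 r C D -> (N0 <= N)%N -> (N0 <= K)%N ->
  disjoint_chains (curve_edges N C) (curve_edges K D).
Proof.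
move=> T NN KN e f eC /flattenP[_ /mapP[b bD ->] fb] s t s01 t01 E.
case: (T) => N00 r0 f1 f2 far.
have [u [u01 e1 e2]] := arc_edge_near N00 KN r0 (f2 b bD) fb.
have h := seg_pt_ball e1 e2 t01.
have := curve_edge_far T NN eC bD u01 s01; rewrite E; lra.
Qed.

Lemma curve_edges_closed N C : (0 < N)%N -> closed_curve C -> closed_chain (curve_edges N C).
Proof. by move=> N0 cC; rewrite -poly_edges_inscribed //; exact: poly_edges_closed. Qed.

Lemma sum_arc_edges N a (phi : pt * pt -> int) :
  \sum_(e <- arc_edges N a) phi e =
  \sum_(0 <= k < N) phi (a (k%:R / N%:R), a (k.+1%:R / N%:R)).
Proof. by rewrite /arc_edges big_map /index_iota subn0. Qed.

Lemma sum_nat_mul N M (phi : nat -> int) :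
  \sum_(0 <= j < N * M) phi j = \sum_(0 <= k < N) \sum_(0 <= i < M) phi (k * M + i)%N.
Proof.
elim: N => [|N ih]; first by rewrite mul0n !big_geq.
rewrite big_nat_recr //= -ih mulSn addnC (@big_cat_nat _ _ _ (N * M)) ?leq_addr //=.
congr (_ + _); rewrite -{1}[(N * M)%N]add0n big_addn addKn.
by apply: eq_bigr => i _; rewrite addnC.
Qed.

Lemma chain_lk_cat v E E' F : chain_lk v (E ++ E') F = chain_lk v E F + chain_lk v E' F.
Proof. exact: big_cat. Qed.

(* The closed polygon formed by the refinement of one edge and by the reversed
   edge lies in a ball that misses F. *)
Lemma chain_lk_refine N0 N M r v (C D : curve R) F : tame N0 r C D ->
  (N0 <= N)%N -> (0 < M)%N -> closed_curve C -> closed_chain F ->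
  (forall e a s t, e \in F -> a \in C -> 0 <= s <= 1 -> 0 <= t <= 1 -> r <= `|seg_pt e s - a t|) ->
  regular_chains v (curve_edges N C) F -> regular_chains v (curve_edges (N * M) C) F ->
  chain_lk v (curve_edges N C) F = chain_lk v (curve_edges (N * M) C) F.
Proof.
move=> [N00 r0 f1 f2 _] NN M0 cC cF far [v0 reg] [_ reg'].
have N1 : (0 < N)%N by exact: leq_trans N00 NN.
rewrite /chain_lk !big_flatten !big_map !big_seq; apply: eq_bigr => a aC.
rewrite !sum_arc_edges sum_nat_mul !big_nat; apply: eq_bigr => k /andP[_ kN].
pose P i := a ((k * M + i)%:R / (N * M)%:R).
have P0 : P 0%N = a (k%:R / N%:R).
  by rewrite /P addn0 !natrM -mulf_div divff ?mulr1 // pnatr_eq0 -lt0n.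
have PM : P M = a (k.+1%:R / N%:R).
  by rewrite /P -{2}[M]mul1n -mulnDl addn1 !natrM -mulf_div divff ?mulr1 // pnatr_eq0 -lt0n.
pose L := [seq (P i, P i.+1) | i <- iota 0 M].
have memL e : e \in L -> e \in curve_edges (N * M) C.
  move=> /mapP[i]; rewrite mem_iota add0n => /andP[_ iM] ->.
  apply/flattenP; exists (arc_edges (N * M) a); first exact: map_f.
  apply/mapP; exists (k * M + i)%N; last by rewrite /P addnS.
  rewrite mem_iota add0n leq0n /=.
  by nia.
have mem1 : (P 0%N, P M) \in curve_edges N C.
  apply/flattenP; exists (arc_edges N a); first exact: map_f.
  by apply/mapP; exists k; rewrite ?P0 ?PM // mem_iota.
have PE i : (i <= M)%N -> `|P i - a (k%:R / N%:R)| < r.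
  move=> iM; have kMi : (k * M + i <= N * M)%N by nia.
  have NM : (0 < N * M)%N by rewrite muln_gt0 N1.
  apply: (f1 a aC); [exact: frac01|exact: frac01 N1 (ltnW kN)|].
  have -> : (k * M + i)%:R / (N * M)%:R - k%:R / N%:R = i%:R / M%:R / N%:R :> R.
    by rewrite natrD !natrM; field; rewrite !pnatr_eq0 -!lt0n N1 M0.
  have /andP[i0 i1] := frac01 M0 iM.
  rewrite ger0_norm ?divr_ge0 // ler_pdivrMr ?ltr0n //.
  apply: le_trans i1 _; rewrite -ler_pdivrMl ?invr_gt0 ?ltr0n // invrK mulr1 ler_nat //.
rewrite -P0 in PE.
have := @chain_lk_ballr R v (L ++ [:: (P M, P 0%N)]) F (a (k%:R / N%:R)) r _ cF.
rewrite chain_lk_cat {2}/chain_lk big_seq1.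
have -> : \sum_(f <- F) crossing v (P M, P 0%N) f = - \sum_(f <- F) crossing v (P 0%N, P M) f.
  by rewrite -sumrN; apply: eq_bigr => f _; rewrite -crossing_revl.
rewrite /chain_lk big_map -P0 -PM => H.
apply/esym/eqP; rewrite -subr_eq0; apply/eqP.
rewrite -[RHS]H.
- rewrite /index_iota subn0; congr (_ - _); apply: eq_bigr => i _.
  by rewrite /P addnS.
- move=> phi; rewrite big_cat big_seq1 big_map /=.
  have := telescope_sumr (phi \o P) (leq0n M); rewrite /index_iota subn0 /= => ->.
  by rewrite addrA subrK subrr.
- split=> // e f; rewrite mem_cat inE => /orP[/memL|/eqP->]; first exact: reg'.
  by move=> fF; have := regular_edges_rev (reg _ _ mem1 fF).
- move=> e; rewrite mem_cat inE => /orP[/mapP[i]|/eqP->].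
    by rewrite mem_iota add0n => /andP[_ iM] ->; split; apply: PE => //; exact: ltnW.
  by split; exact: PE.
move=> e s eF s01; rewrite P0; apply: far => //; apply: frac01 => //; exact: ltnW.
Qed.
End Polygons.

Section Curves.
Variable R : realType.
Local Notation pt := 'rV[R]_3.
Implicit Types (v : pt) (C D : curve R).

(** Two resolutions can be compared by [chain_lk_refine] only in one projection, which must be
    regular for both pairs of polygons. *)
Lemma exists_regular (E F E' F' : seq (pt * pt)) :
  disjoint_chains E F -> disjoint_chains E' F' ->
  exists v, regular_chains v E F /\ regular_chains v E' F'.
Proof.
move=> d d'; have [v _ h] := off_planes_ball (0 : pt)
  (off_planes_and (off_planes_regular_chains d) (off_planes_regular_chains d')) ltr01.
by exists v.
Qed.

Lemma poly_lk_inscribed N0 r N K C D v : tame N0 r C D -> (N0 <= N)%N -> (N0 <= K)%N ->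
  closed_curve C -> closed_curve D ->
  regular_chains v (curve_edges N C) (curve_edges K D) ->
  poly_lk (inscribed_polygon N C) (inscribed_polygon K D) =
  chain_lk v (curve_edges N C) (curve_edges K D).
Proof.
move=> T NN KN cC cD; case: (T) => N00 _ _ _ _.
have dj := curve_edges_disjoint T NN KN.
rewrite -!poly_edges_inscribed // in dj *; try exact: leq_trans N00 _.
exact: poly_lk_chain.
Qed.

Lemma curve_edges_far N0 r K C D : tame N0 r C D -> (N0 <= K)%N ->
  forall e a s t, e \in curve_edges K D -> a \in C -> 0 <= s <= 1 -> 0 <= t <= 1 ->
  r <= `|seg_pt e s - a t|.
Proof.
move=> T KN e a s t eD aC s01 t01; have := curve_edge_far (tame_sym T) KN eD aC t01 s01.
by case: T => _ ? _ _ _; lra.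
Qed.

Lemma poly_lk_refinel N0 r N M K C D : tame N0 r C D ->
  (N0 <= N)%N -> (N0 <= K)%N -> (0 < M)%N -> closed_curve C -> closed_curve D ->
  poly_lk (inscribed_polygon N C) (inscribed_polygon K D) =
  poly_lk (inscribed_polygon (N * M) C) (inscribed_polygon K D).
Proof.
move=> T NN KN M0 cC cD.
have NMN : (N0 <= N * M)%N by exact: leq_trans NN (leq_pmulr _ M0).
have K0 : (0 < K)%N by case: T => N00 _ _ _ _; exact: leq_trans N00 KN.
have [v [r1 r2]] := exists_regular (curve_edges_disjoint T NN KN)
  (curve_edges_disjoint T NMN KN).
rewrite (poly_lk_inscribed T NN KN cC cD r1) (poly_lk_inscribed T NMN KN cC cD r2).
apply: (chain_lk_refine T) => //; first exact: curve_edges_closed.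
exact: curve_edges_far T KN.
Qed.

Lemma poly_lk_refiner N0 r N M K C D : tame N0 r C D ->
  (N0 <= N)%N -> (N0 <= K)%N -> (0 < M)%N -> closed_curve C -> closed_curve D ->
  poly_lk (inscribed_polygon N C) (inscribed_polygon K D) =
  poly_lk (inscribed_polygon N C) (inscribed_polygon (K * M) D).
Proof.
move=> T NN KN M0 cC cD.
have KMN : (N0 <= K * M)%N by exact: leq_trans KN (leq_pmulr _ M0).
have N1 : (0 < N)%N by case: T => N00 _ _ _ _; exact: leq_trans N00 NN.
have [v [r1 r2]] := exists_regular (curve_edges_disjoint T NN KN)
  (curve_edges_disjoint T NN KMN).
rewrite (poly_lk_inscribed T NN KN cC cD r1) (poly_lk_inscribed T NN KMN cC cD r2).
rewrite -(chain_lk_opp v) -[RHS](chain_lk_opp v).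
apply: (chain_lk_refine (tame_sym T)) => //; first exact: curve_edges_closed.
- exact: curve_edges_far (tame_sym T) NN.
- exact: regular_chains_opp.
exact: regular_chains_opp.
Qed.

(** Both resolutions have the common refinement [N * M], reached by refining one curve at a time. *)
Lemma poly_lk_stable N0 r N M C D : tame N0 r C D -> closed_curve C -> closed_curve D ->
  (N0 <= N)%N -> (N0 <= M)%N ->
  poly_lk (inscribed_polygon N C) (inscribed_polygon N D) =
  poly_lk (inscribed_polygon M C) (inscribed_polygon M D).
Proof.
move=> T cC cD NN MN; have N00 : (0 < N0)%N by case: T.
have N1 := leq_trans N00 NN; have M1 := leq_trans N00 MN.
have NMN : (N0 <= N * M)%N by exact: leq_trans NN (leq_pmulr _ M1).
have MNN : (N0 <= M * N)%N by rewrite mulnC.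
rewrite (poly_lk_refinel T NN NN M1 cC cD) (poly_lk_refiner T NMN NN M1 cC cD).
rewrite (poly_lk_refinel T MN MN N1 cC cD) (poly_lk_refiner T MNN MN N1 cC cD).
by rewrite mulnC.
Qed.

Lemma lk_tame N0 r N C D v : tame N0 r C D -> closed_curve C -> closed_curve D ->
  (N0 <= N)%N -> regular_chains v (curve_edges N C) (curve_edges N D) ->
  lk false C D = chain_lk v (curve_edges N C) (curve_edges N D).
Proof.
move=> T cC cD NN reg; rewrite /lk expr0 mul1r -(poly_lk_inscribed T NN NN cC cD reg).
set S := [set l | _]%classic.
have SN : S (poly_lk (inscribed_polygon N C) (inscribed_polygon N D)).
  exists N0 => // M /= MN; exact: (poly_lk_stable T cC cD MN NN).
(* [xget] returns some eventual value, not a prescribed one; two eventual values agree at any index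
   beyond both thresholds. *)
have [M1 _ h1] := xgetPex 0 (ex_intro S _ SN); have [M2 _ h2] := SN.
by rewrite -(h1 (maxn M1 M2)) ?(h2 (maxn M1 M2)) //= ?leq_maxl ?leq_maxr.
Qed.
End Curves.

Lemma finite_antitone_witness (R : realType) (T : finType) (P : T -> R -> Prop) :
  (forall x r r', 0 < r' -> r' <= r -> P x r -> P x r') ->
  (forall x, exists2 r, 0 < r & P x r) -> exists2 r, 0 < r & forall x, P x r.
Proof.
move=> anti ex.
suff [r r0 h] : exists2 r, 0 < r & forall x, x \in enum T -> P x r.
  by exists r => // x; apply: h; rewrite mem_enum.
elim: (enum T) => [|x s [r r0 h]]; first by exists 1.
have [r' r'0 h'] := ex x; have m0 : 0 < Num.min r r' by rewrite lt_min r0.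
exists (Num.min r r') => // y; rewrite inE => /predU1P[->|/h].
  by apply: anti h' => //; rewrite ge_min lexx orbT.
by apply: anti => //; rewrite ge_min lexx.
Qed.

(** * Cycles of embedded complete graphs *)

Section Embeddings.
Variables (R : realType) (V : finType).
Local Notation pt := 'rV[R]_3.

Lemma next_neq (c : seq V) x : is_cycle c -> x \in c -> next c x != x.
Proof.
move=> /andP[uc sc] xc; have [i s cE] := rot_to xc.
rewrite -(next_rot i uc) cE; have : uniq (x :: s) by rewrite -cE rot_uniq.
have : (2 < size (x :: s))%N by rewrite -cE size_rot.
case: s {cE} => [//|y s] _ /= /andP[]; rewrite inE negb_or eqxx => /andP[xy _] _.
by rewrite eq_sym.
Qed.

Lemma map_next (c : seq V) : uniq c -> [seq next c x | x <- c] = rot 1 c.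
Proof.
case: c => [//|x c] uc; rewrite rot1_cons.
apply: (@eq_from_nth _ x); first by rewrite size_map size_rcons.
move=> i; rewrite size_map => ic; rewrite (nth_map x) // next_nth mem_nth // index_uniq //.
rewrite nth_rcons; move: ic => /=; rewrite ltnS leq_eqVlt => /orP[/eqP->|ic].
  by rewrite ltnn eqxx nth_default.
by rewrite ic; exact: set_nth_default.
Qed.

Lemma cycle_curve_closed (g : embedding R V) c : is_cycle c -> closed_curve (cycle_curve g c).
Proof.
move=> cc; have /andP[uc _] := cc; rewrite /closed_curve /cycle_curve -!map_comp.
have -> : [seq ((fun a => a 0) \o (fun x => edge g x (next c x))) x | x <- c] = [seq vert g x | x <- c].
  by apply/eq_in_map => x xc /=; rewrite edge_start // eq_sym next_neq.
have -> : [seq ((fun a => a 1) \o (fun x => edge g x (next c x))) x | x <- c] =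
    [seq vert g x | x <- [seq next c x | x <- c]].
  by rewrite -map_comp; apply/eq_in_map => x xc /=; rewrite edge_end // eq_sym next_neq.
by rewrite map_next // map_rot.
Qed.
End Embeddings.

Lemma exists_natinv_le (R : realType) (d : R) : 0 < d -> exists N : nat, (0 < N)%N && (N%:R^-1 <= d).
Proof.
move=> d0; exists (Num.truncn d^-1).+1; rewrite ltn0Sn /=.
rewrite -[leRHS]invrK lef_pV2 ?posrE ?invr_gt0 ?ltr0n // ltW //.
by apply: truncnS_gt.
Qed.

Lemma tame_embeddings (R : realType) (V W : finType) (g : embedding R V) (h : embedding R W) :
  disjointly_embedded g h ->
  exists (N : nat) (r : R), (0 < N)%N /\ 0 < r /\
    [/\ forall i j, i != j -> fine_arc N r (edge g i j),
        forall k l, k != l -> fine_arc N r (edge h k l) &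
        forall i j k l s t, i != j -> k != l -> 0 <= s <= 1 -> 0 <= t <= 1 ->
          3 * r <= `|edge g i j s - edge h k l t|].
Proof.
move=> dj.
have [|| r r0 hr] := @finite_antitone_witness R (V * V * W * W)%type (fun x r =>
    x.1.1.1 != x.1.1.2 -> x.1.2 != x.2 -> forall s t, 0 <= s <= 1 -> 0 <= t <= 1 ->
    3 * r <= `|edge g x.1.1.1 x.1.1.2 s - edge h x.1.2 x.2 t|).
- move=> [[[i j] k] l] r r' r'0 r'r /= H ij kl s t s01 t01; have := H ij kl s t s01 t01; lra.
- move=> [[[i j] k] l] /=; have [->|ij] := eqVneq i j; first by exists 1.
  have [->|kl] := eqVneq k l; first by exists 1.
  have [|r r0 H] := disjoint_arcs_dist (@edge_continuous _ _ g _ _ ij) (@edge_continuous _ _ h _ _ kl).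
    move=> s t s01 t01 E.
    have : (image_of g `&` image_of h)%classic (edge g i j s).
      by split; right; [exists i, j, s|exists k, l, t].
    by rewrite dj.
  by exists (r / 3) => [|_ _ s t s01 t01]; [lra|have := H s t s01 t01; lra].
have U (U : finType) (f : embedding R U) : exists2 d, 0 < d & forall x : U * U, x.1 != x.2 ->
    forall s t, 0 <= s <= 1 -> 0 <= t <= 1 -> `|s - t| <= d -> `|edge f x.1 x.2 s - edge f x.1 x.2 t| < r.
  apply: (@finite_antitone_witness R (U * U)%type (fun x d => x.1 != x.2 ->
    forall s t, 0 <= s <= 1 -> 0 <= t <= 1 -> `|s - t| <= d -> `|edge f x.1 x.2 s - edge f x.1 x.2 t| < r)).
    move=> x d d' d'0 d'd H x12 s t s01 t01 st; apply: H => //; lra.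
  move=> [i j] /=; have [->|ij] := eqVneq i j; first by exists 1.
  by have [d d0 H] := within_continuous_unif (@edge_continuous _ _ f _ _ ij) r0; exists d.
have [d d0 hd] := U V g; have [d' d'0 hd'] := U W h.
have m0 : 0 < Num.min d d' by rewrite lt_min d0.
have [N /andP[N0 Nd]] := exists_natinv_le m0.
move: Nd; rewrite le_min => /andP[Nd Nd'].
exists N, r; split=> //; split=> //; split.
- move=> i j ij s t s01 t01 st; apply: (hd (i, j)) => //; exact: le_trans st _.
- move=> i j ij s t s01 t01 st; apply: (hd' (i, j)) => //; exact: le_trans st _.
by move=> i j k l s t ij kl; exact: (hr (i, j, k, l)).
Qed.

(* Cutting cycles into edges: one sufficiently fine subdivision and one
   projection serve all the cycles of both graphs. *)
Theorem lk_cycles_bilinear (R : realType) (V W : finType) (g : embedding R V) (h : embedding R W) :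
  disjointly_embedded g h ->
  exists X : V -> V -> W -> W -> int,
  [/\ forall i j k l, i != j -> k != l -> X j i k l = - X i j k l,
      forall i j k l, i != j -> k != l -> X i j l k = - X i j k l,
      forall c d, is_cycle c -> is_cycle d -> lk false (cycle_curve g c) (cycle_curve h d) =
        \sum_(x <- c) \sum_(y <- d) X x (next c x) y (next d y) &
      forall c d, is_cycle c -> is_cycle d -> lk false (cycle_curve h d) (cycle_curve g c) =
        \sum_(x <- c) \sum_(y <- d) X x (next c x) y (next d y)].
Proof.
move=> dj; have [N [r [N0 [r0 [fg fh far]]]]] := tame_embeddings dj.
(* All edges of the graph in one list. Each cycle uses only arcs from it, and so inherits the
   resolution, the distance and the regular direction found for the whole list. *)
pose arcs (U : finType) (f : embedding R U) : curve R :=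
  [seq edge f x.1 x.2 | x <- enum [pred x : U * U | x.1 != x.2]].
have mem_arcs (U : finType) (f : embedding R U) i j : i != j -> edge f i j \in arcs U f.
  by move=> ij; apply/mapP; exists (i, j); rewrite ?mem_enum.
have T : tame N r (arcs V g) (arcs W h).
  split=> //.
  - by move=> a /mapP[[i j]]; rewrite mem_enum => ij ->; exact: fg.
  - by move=> a /mapP[[i j]]; rewrite mem_enum => ij ->; exact: fh.
  move=> a b s t /mapP[[i j]]; rewrite mem_enum => ij -> /mapP[[k l]]; rewrite mem_enum => kl ->.
  exact: far.
have djE := curve_edges_disjoint T (leqnn N) (leqnn N).
have [v [[v0 reg] _]] := exists_regular djE djE.
pose X i j k l := chain_lk v (arc_edges N (edge g i j)) (arc_edges N (edge h k l)).
(* The subdivision into equal parts is symmetric under [t -> 1 - t], so an edge and its reverse have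
   the same pieces with opposite directions. This makes [X] antisymmetric. *)
have arc_rev (U : finType) (f : embedding R U) i j : i != j ->
    arc_edges N (edge f j i) = rev [seq (e.2, e.1) | e <- arc_edges N (edge f i j)].
  move=> ij; apply: (@eq_from_nth _ (0, 0)); first by rewrite size_rev !size_map.
  move=> k; rewrite size_map size_iota => kN.
  rewrite nth_rev ?size_map ?size_iota // (nth_map 0%N) ?size_iota // nth_iota // add0n.
  have kN' : (N - k.+1 < N)%N by rewrite ltn_subrL.
  rewrite (nth_map (0, 0)) ?size_map ?size_iota // (nth_map 0%N) ?size_iota // nth_iota // add0n /=.
  rewrite !(edge_rev _ ij) ?frac01 // 1?ltnW //.
  have NN : N%:R != 0 :> R by rewrite pnatr_eq0 -lt0n.
  congr (edge f i j _, edge f i j _).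
    rewrite -subSn // subSS natrB ?(ltnW kN) // mulrBl divff //.
  by rewrite natrB // mulrBl divff.
have main c d : is_cycle c -> is_cycle d ->
    let S := \sum_(x <- c) \sum_(y <- d) X x (next c x) y (next d y) in
    lk false (cycle_curve g c) (cycle_curve h d) = S /\
    lk false (cycle_curve h d) (cycle_curve g c) = S.
  move=> cc cd S.
  have sub (U : finType) (f : embedding R U) z : is_cycle z -> {subset cycle_curve f z <= arcs U f}.
    by move=> cz a /mapP[x xz ->]; apply: mem_arcs; rewrite eq_sym next_neq.
  have subE (C D : curve R) : {subset C <= D} -> {subset curve_edges N C <= curve_edges N D}.
    move=> CD e /flattenP[_ /mapP[a aC ->] ea]; apply/flattenP.
    by exists (arc_edges N a) => //; apply: map_f; exact: CD.
  have Tcd : tame N r (cycle_curve g c) (cycle_curve h d).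
    case: T => ? ? h1 h2 h3; split=> // [a aC|a aC|a b s t aC bD].
    - exact/h1/(sub _ _ _ cc).
    - exact/h2/(sub _ _ _ cd).
    by apply: h3; [exact: (sub _ _ _ cc)|exact: (sub _ _ _ cd)].
  have rcd : regular_chains v (curve_edges N (cycle_curve g c)) (curve_edges N (cycle_curve h d)).
    by split=> // e f eC fD; apply: reg; [exact: subE (sub _ _ _ cc) _ eC|exact: subE (sub _ _ _ cd) _ fD].
  have E : chain_lk v (curve_edges N (cycle_curve g c)) (curve_edges N (cycle_curve h d)) = S.
    rewrite /S /X /chain_lk /curve_edges /cycle_curve -map_comp big_flatten big_map.
    apply: eq_bigr => x _; rewrite [RHS]exchange_big; apply: eq_bigr => e _ /=.
    by rewrite -map_comp big_flatten big_map.
  have c1 := cycle_curve_closed g cc; have c2 := cycle_curve_closed h cd.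
  rewrite (lk_tame Tcd c1 c2 (leqnn N) rcd).
  by rewrite (lk_tame (tame_sym Tcd) c2 c1 (leqnn N) (regular_chains_opp rcd)) chain_lk_opp.
exists X; split.
- move=> i j k l ij _; rewrite /X /chain_lk (arc_rev _ g _ _ ij).
  rewrite (perm_big _ (permEl (perm_rev _))) big_map -sumrN; apply: eq_bigr => e _.
  by rewrite -sumrN; apply: eq_bigr => f _; rewrite crossing_revl.
- move=> i j k l _ kl; rewrite /X /chain_lk (arc_rev _ h _ _ kl).
  rewrite -sumrN; apply: eq_bigr => e _.
  rewrite (perm_big _ (permEl (perm_rev _))) big_map -sumrN.
  by apply: eq_bigr => f _; rewrite crossing_revr.
- by move=> c d cc cd; have [] := main c d cc cd.
by move=> c d cc cd; have [] := main c d cc cd.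
Qed.

(** * Cochains on complete graphs and stars *)

Section Cochains.
Variable V : finType.
Implicit Types (u w : V -> V -> int) (a b c d e p q x y z : V) (s : seq V) (I J : {set V}).

Definition antisym w : Prop := forall x y, w y x = - w x y.

Definition tri w x y z : int := w x y + w y z + w z x.

Definition cyc w s : int := \sum_(x <- s) w x (next s x).

Definition bounded w : Prop := forall s, is_cycle s -> `|cyc w s| <= 1.

Lemma cyc_zip w s : uniq s -> cyc w s = \sum_(e <- zip s (rot 1 s)) w e.1 e.2.
Proof.
move=> us; rewrite /cyc.
have -> : zip s (rot 1 s) = [seq (x, next s x) | x <- s].
  by rewrite -map_next //; elim: {1 3 5}s => //= x t ->.
by rewrite big_map.
Qed.

Lemma cyc_tri w x y z : uniq [:: x; y; z] -> cyc w [:: x; y; z] = tri w x y z.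
Proof. by move=> u; rewrite cyc_zip // /= !big_cons big_nil /= addr0 addrA. Qed.

Lemma cyc4 w a b c d : uniq [:: a; b; c; d] ->
  cyc w [:: a; b; c; d] = w a b + w b c + w c d + w d a.
Proof. by move=> u; rewrite cyc_zip // /= !big_cons big_nil /= addr0 !addrA. Qed.

Lemma cyc5 w a b c d e : uniq [:: a; b; c; d; e] ->
  cyc w [:: a; b; c; d; e] = w a b + w b c + w c d + w d e + w e a.
Proof. by move=> u; rewrite cyc_zip // /= !big_cons big_nil /= addr0 !addrA. Qed.

Lemma cyc6 w a b c d e q : uniq [:: a; b; c; d; e; q] ->
  cyc w [:: a; b; c; d; e; q] = w a b + w b c + w c d + w d e + w e q + w q a.
Proof. by move=> u; rewrite cyc_zip // /= !big_cons big_nil /= addr0 !addrA. Qed.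

Lemma cyc_rot w n s : uniq s -> cyc w (rot n s) = cyc w s.
Proof.
move=> us; rewrite /cyc (perm_big s) ?perm_rot //.
by apply: eq_bigr => x _; rewrite next_rot.
Qed.

Lemma antisym_diag w x : antisym w -> w x x = 0.
Proof. by move=> /(_ x x); lia. Qed.

(** Equal triangle sums mean that [u] and [w] differ by a coboundary, with potential [u p x - w p x]
    for a fixed vertex [p]; it telescopes around every cycle. *)
Lemma tri_eq_cyc u w : antisym u -> antisym w -> (forall x y z, tri u x y z = tri w x y z) ->
  forall s, is_cycle s -> cyc u s = cyc w s.
Proof.
move=> au aw E s /andP[us ss].
have [p _] : exists p : V, true by case: s ss {us} => // p; exists p.
apply/eqP; rewrite -subr_eq0 -sumrB; apply/eqP.
pose phi x := u p x - w p x.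
transitivity (\sum_(x <- s) (phi (next s x) - phi x)).
  apply: eq_bigr => x _; have := E p x (next s x).
  rewrite /tri /phi (au p (next s x)) (aw p (next s x)); lia.
rewrite sumrB; apply/eqP; rewrite subr_eq0; apply/eqP.
rewrite -(big_map (next s) xpredT phi) map_next //.
by apply: perm_big; rewrite perm_rot.
Qed.

(** Edges from [I] to [p] weigh 1, their reverses -1, all others 0. For [p] outside [I], with [O]
    the remaining vertices, the sum over a triangle is 1 exactly on the star pOI. *)
Definition star p I x y : int := ((x \in I) && (y == p) : nat)%:Z - ((y \in I) && (x == p) : nat)%:Z.

Lemma star_antisym p I : antisym (star p I).
Proof. by move=> x y; rewrite /star opprB. Qed.

Lemma tri_antisym w x y z : antisym w -> tri w y x z = - tri w x y z.
Proof. by move=> a; rewrite /tri (a x y) (a y z) (a z x) -!opprD; congr (- _); lia. Qed.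

Lemma tri_rot w x y z : tri w y z x = tri w x y z.
Proof. by rewrite /tri; lia. Qed.

Lemma tri_swap w x y z : antisym w -> tri w x z y = - tri w x y z.
Proof. by move=> an; rewrite -tri_rot tri_antisym // -tri_rot tri_rot -tri_rot; congr (- _); rewrite /tri; lia. Qed.

Lemma tri_cocycle w a b c d : antisym w ->
  tri w b c d - tri w a c d + tri w a b d - tri w a b c = 0.
Proof.
by move=> an; rewrite /tri (an a c) (an a d) (an b d); lia.
Qed.

Lemma tri_xxy w x y : antisym w -> tri w x x y = 0.
Proof. by move=> an; rewrite /tri (antisym_diag _ an) (an x y); lia. Qed.

Lemma tri_xyx w x y : antisym w -> tri w x y x = 0.
Proof. by move=> an; rewrite tri_rot tri_xxy. Qed.

Lemma tri_xyy w x y : antisym w -> tri w x y y = 0.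
Proof. by move=> an; rewrite -tri_rot tri_xxy. Qed.

Lemma tri_neq0_uniq w x y z : antisym w -> tri w x y z != 0 -> uniq [:: x; y; z].
Proof.
move=> an; rewrite /= !inE negb_or andbT => h.
apply/andP; split; [apply/andP; split|]; apply: contraNneq h => ->.
- by rewrite tri_xxy.
- by rewrite -tri_rot -tri_rot tri_xxy.
by rewrite -tri_rot tri_xxy.
Qed.

Lemma tri_star p I x y : x != p -> y != p -> tri (star p I) p x y = (y \in I : nat)%:Z - (x \in I : nat)%:Z.
Proof.
move=> xp yp; rewrite /tri /star !eqxx (negbTE xp) (negbTE yp) !andbT !andbF /=.
by case: (p \in I); case: (x \in I); case: (y \in I).
Qed.

Lemma tri_star0 p I x y z : x != p -> y != p -> z != p -> tri (star p I) x y z = 0.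
Proof.
by move=> xp yp zp; rewrite /tri /star (negbTE xp) (negbTE yp) (negbTE zp) !andbF.
Qed.

(** By the cocycle identity the triangles at [p] determine all others. *)
Lemma eq_tri_star w p I : antisym w ->
  (forall x y, x != p -> y != p -> tri w p x y = (y \in I : nat)%:Z - (x \in I : nat)%:Z) ->
  forall x y z, tri w x y z = tri (star p I) x y z.
Proof.
move=> an h; have an' := @star_antisym p I.
have h' x y : tri w p x y = tri (star p I) p x y.
  have [->|xp] := eqVneq x p; first by rewrite !tri_xxy.
  have [->|yp] := eqVneq y p; last by rewrite h // tri_star.
  by rewrite !tri_xyx.
move=> x y z; have := tri_cocycle p x y z an; have := tri_cocycle p x y z an'.
rewrite !h'; lia.
Qed.
End Cochains.

(** * Bounded cochains are stars *)

Section StarLemma.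
Variable V : finType.
Implicit Types (u w : V -> V -> int) (a b c d e p q x y z : V) (s : seq V) (I J : {set V}).

Lemma bounded3 w a b c : bounded w -> uniq [:: a; b; c] ->
  -1 <= w a b + w b c + w c a <= 1.
Proof. by move=> bw u; rewrite -ler_norml; have := bw [:: a; b; c]; rewrite cyc_tri // /is_cycle u; apply. Qed.

Lemma bounded4 w a b c d : bounded w -> uniq [:: a; b; c; d] ->
  -1 <= w a b + w b c + w c d + w d a <= 1.
Proof. by move=> bw u; rewrite -ler_norml; have := bw [:: a; b; c; d]; rewrite cyc4 // /is_cycle u; apply. Qed.

Lemma bounded5 w a b c d e : bounded w -> uniq [:: a; b; c; d; e] ->
  -1 <= w a b + w b c + w c d + w d e + w e a <= 1.
Proof. by move=> bw u; rewrite -ler_norml; have := bw [:: a; b; c; d; e]; rewrite cyc5 // /is_cycle u; apply. Qed.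

Lemma bounded6 w a b c d e q : bounded w -> uniq [:: a; b; c; d; e; q] ->
  -1 <= w a b + w b c + w c d + w d e + w e q + w q a <= 1.
Proof. by move=> bw u; rewrite -ler_norml; have := bw [:: a; b; c; d; e; q]; rewrite cyc6 // /is_cycle u; apply. Qed.

Lemma uniq_select (T : eqType) (t0 : T) (t : seq T) (ks : seq nat) : uniq t ->
  uniq ks && all (gtn (size t)) ks -> uniq [seq nth t0 t k | k <- ks].
Proof.
move=> ut /andP[uk /allP lt]; rewrite map_inj_in_uniq // => i j /lt/= it /lt/= jt /eqP.
by rewrite nth_uniq // => /eqP.
Qed.

(** The three values add up to [tri w a b c], which is 1, by the cocycle identity. Any two of them
    add up to the sum over a 4-cycle, at most 1, so the third is nonnegative. *)
Lemma tri_replace w a b c d : antisym w -> bounded w -> uniq [:: a; b; c; d] ->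
  tri w a b c = 1 ->
  [\/ [/\ tri w d b c = 1, tri w a d c = 0 & tri w a b d = 0],
      [/\ tri w d b c = 0, tri w a d c = 1 & tri w a b d = 0] |
      [/\ tri w d b c = 0, tri w a d c = 0 & tri w a b d = 1]].
Proof.
move=> an bw u T.
have h1 := bounded4 bw (uniq_select a u (ks := [:: 0; 3; 1; 2]%N) isT).
have h2 := bounded4 bw (uniq_select a u (ks := [:: 0; 1; 3; 2]%N) isT).
have h3 := bounded4 bw (uniq_select a u (ks := [:: 0; 1; 2; 3]%N) isT).
have h4 := bounded3 bw (uniq_select a u (ks := [:: 0; 1; 3]%N) isT).
have h5 := bounded3 bw (uniq_select a u (ks := [:: 3; 1; 2]%N) isT).
have h6 := bounded3 bw (uniq_select a u (ks := [:: 0; 3; 2]%N) isT).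
move: T h1 h2 h3 h4 h5 h6; rewrite /tri /= => T h1 h2 h3 h4 h5 h6.
have := an a b; have := an a c; have := an a d.
have := an b c; have := an b d; have := an c d => e1 e2 e3 e4 e5 e6.
suff [[? [? ?]]|[[? [? ?]]|[? [? ?]]]] :
    (w d b + w b c + w c d = 1 /\ w a d + w d c + w c a = 0 /\ w a b + w b d + w d a = 0) \/
    (w d b + w b c + w c d = 0 /\ w a d + w d c + w c a = 1 /\ w a b + w b d + w d a = 0) \/
    (w d b + w b c + w c d = 0 /\ w a d + w d c + w c a = 0 /\ w a b + w b d + w d a = 1).
- exact: Or31.
- exact: Or32.
- exact: Or33.
lia.
Qed.

(** If no vertex can replace [c], every further vertex replaces exactly one of [a] and [b] by
    [tri_replace]. Then [c] is the centre, and [I] consists of [b] and the vertices that replace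
    it. *)
Lemma star_of_class w a b c : antisym w -> bounded w -> uniq [:: a; b; c] ->
  tri w a b c = 1 -> (forall d, d \notin [:: a; b; c] -> tri w a b d <> 1) ->
  exists p I, p \notin I /\ forall x y z, tri w x y z = tri (star p I) x y z.
Proof.
move=> an bw u T noC.
have cls d : d \notin [:: a; b; c] ->
    [/\ tri w d b c = 1, tri w a d c = 0 & tri w a b d = 0] \/
    [/\ tri w d b c = 0, tri w a d c = 1 & tri w a b d = 0].
  move=> dn; have := @tri_replace w a b c d an bw _ T.
  rewrite -[[:: a; b; c; d]]/(rcons [:: a; b; c] d) rcons_uniq dn u => /(_ isT)[h|h|[_ _ h]].
  - by left.
  - by right.
  by case: (noC d dn).
pose I := [set x | (x != c) && (tri w c a x == 1)]%SET.
have [ab ac bc] : [/\ a != b, a != c & b != c].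
  by move: u; rewrite /= !inE negb_or !andbT => /andP[/andP[]].
have IE x : x != c -> (x \in I : nat)%:Z = tri w c a x.
  move=> xc; rewrite inE xc /=; have [xa|xa] := eqVneq x a.
    by rewrite xa tri_xyy.
  have [xb|xb] := eqVneq x b; first by rewrite xb -tri_rot T.
  have [|[_ E _]|[_ E _]] := cls x; first by rewrite !inE !negb_or xa xb.
    by rewrite -tri_rot E.
  by rewrite -tri_rot E.
exists c, I; split; first by rewrite inE eqxx.
apply: eq_tri_star => // x y xc yc; rewrite !IE //.
have [->|xy] := eqVneq x y; first by rewrite tri_xyy // subrr.
have [->|xa] := eqVneq x a; first by rewrite [X in _ - X]tri_xyy ?subr0.
have [->|ya] := eqVneq y a.
  by rewrite [X in X - _]tri_xyy // sub0r -tri_antisym // tri_rot.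
have notin z : z != a -> z != b -> z != c -> z \notin [:: a; b; c].
  by move=> za zb zc; rewrite !inE !negb_or za zb.
have [xb|xb] := eqVneq x b.
  have yb : y != b by rewrite -xb eq_sym.
  have := cls y (notin y ya yb yc); move: T; rewrite xb /tri.
  have := an a b; have := an a c; have := an a y; have := an b c; have := an b y; have := an c y.
  move=> e1 e2 e3 e4 e5 e6 T' [[E1 E2 E3]|[E1 E2 E3]]; lra.
have [yb|yb] := eqVneq y b.
  have := cls x (notin x xa xb xc); move: T; rewrite yb /tri.
  have := an a b; have := an a c; have := an a x; have := an b c; have := an b x; have := an c x.
  move=> e1 e2 e3 e4 e5 e6 T' [[E1 E2 E3]|[E1 E2 E3]]; lra.
have uxy : uniq [:: c; a; b; x; y].
  by rewrite /= !inE !negb_or ![c == _]eq_sym ac bc xc yc ab ![a == _]eq_sym xa ya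
    ![b == _]eq_sym xb yb xy.
have h1 := bounded3 bw (uniq_select a uxy (ks := [:: 0; 3; 4]%N) isT).
have h2 := bounded4 bw (uniq_select a uxy (ks := [:: 0; 3; 4; 2]%N) isT).
have h3 := bounded4 bw (uniq_select a uxy (ks := [:: 0; 4; 3; 2]%N) isT).
have h4 := bounded4 bw (uniq_select a uxy (ks := [:: 0; 1; 3; 4]%N) isT).
have h5 := bounded4 bw (uniq_select a uxy (ks := [:: 0; 1; 4; 3]%N) isT).
have h6 := bounded5 bw (uniq_select a uxy (ks := [:: 0; 1; 4; 3; 2]%N) isT).
have h7 := bounded5 bw (uniq_select a uxy (ks := [:: 0; 1; 3; 4; 2]%N) isT).
move: h1 h2 h3 h4 h5 h6 h7; rewrite /= => h1 h2 h3 h4 h5 h6 h7.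
have := an a b; have := an a c; have := an a x; have := an a y; have := an b c; have := an b x;
have := an b y; have := an c x; have := an c y; have := an x y.
move: (cls x (notin x xa xb xc)) (cls y (notin y ya yb yc)) T; rewrite /tri.
move=> [[E1 E2 E3]|[E1 E2 E3]] [[E4 E5 E6]|[E4 E5 E6]] T e1 e2 e3 e4 e5 e6 e7 e8 e9 e10; lra.
Qed.

(* If each vertex of the linked triangle abc could be replaced by a further
   vertex (by g, d, e, for c, a, b), then one of the cycles c a e d b, c a b g e and
   c d e g a b would be strongly linked. *)
Lemma bounded_star w : antisym w -> bounded w -> (0 < #|V|)%N ->
  exists p I, p \notin I /\ forall x y z, tri w x y z = tri (star p I) x y z.
Proof.
move=> an bw V0.
have [[a [b [c T]]]|no] := pselect (exists a b c, tri w a b c = 1); last first.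
  have [p _] : exists p : V, p \in V by apply/card_gt0P.
  exists p, finset.set0; split; first by rewrite inE.
  move=> x y z; have -> : tri w x y z = 0.
    have [u|nu] := boolP (uniq [:: x; y; z]); last first.
      by apply/eqP; apply: contraNT nu; exact: tri_neq0_uniq.
    have := bounded3 bw u; rewrite -/(tri w x y z) => /andP[].
    have := tri_antisym x y z an.
    have n1 : tri w x y z <> 1 by move=> h; apply: no; exists x, y, z.
    have n2 : tri w y x z <> 1 by move=> h; apply: no; exists y, x, z.
    lia.
  by rewrite /tri /star !inE.
have u : uniq [:: a; b; c] by apply: (tri_neq0_uniq an); rewrite T.
have T1 : tri w b c a = 1 by rewrite tri_rot.
have T2 : tri w c a b = 1 by rewrite -tri_rot.
have u1 : uniq [:: b; c; a] := uniq_select a u (ks := [:: 1; 2; 0]%N) isT.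
have u2 : uniq [:: c; a; b] := uniq_select a u (ks := [:: 2; 0; 1]%N) isT.
have [[g [gn Tg]]|noC] := pselect (exists d, d \notin [:: a; b; c] /\ tri w a b d = 1); last first.
  by apply: (star_of_class an bw u T) => y yn Ty; apply: noC; exists y.
have [[d [dn Td]]|noA] := pselect (exists d, d \notin [:: b; c; a] /\ tri w b c d = 1); last first.
  by apply: (star_of_class an bw u1 T1) => y yn Ty; apply: noA; exists y.
have [[e [en Te]]|noB] := pselect (exists d, d \notin [:: c; a; b] /\ tri w c a d = 1); last first.
  by apply: (star_of_class an bw u2 T2) => y yn Ty; apply: noB; exists y.
exfalso.
have ug : uniq [:: a; b; c; g] by rewrite -[[:: a; b; c; g]]/(rcons [:: a; b; c] g) rcons_uniq gn.
have ud : uniq [:: b; c; a; d] by rewrite -[[:: b; c; a; d]]/(rcons [:: b; c; a] d) rcons_uniq dn.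
have ue : uniq [:: c; a; b; e] by rewrite -[[:: c; a; b; e]]/(rcons [:: c; a; b] e) rcons_uniq en.
have Rg := tri_replace an bw ug T.
have Rd := tri_replace an bw ud T1.
have Re := tri_replace an bw ue T2.
have {Rg} Eg : tri w g b c = 0 /\ tri w a g c = 0 by case: Rg => -[]; rewrite ?Tg.
have {Rd} Ed : tri w d c a = 0 /\ tri w b d a = 0 by case: Rd => -[]; rewrite ?Td.
have {Re} Ee : tri w e a b = 0 /\ tri w c e b = 0 by case: Re => -[]; rewrite ?Te.
have gd : g != d.
  by apply/negP => /eqP gd; move: Td; rewrite -gd tri_rot Eg.1.
have ge : g != e.
  by apply/negP => /eqP ge; move: Te; rewrite -ge tri_rot tri_rot Eg.2.
have de : d != e.
  by apply/negP => /eqP de; move: Te; rewrite -de tri_rot Ed.1.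
have U : uniq [:: a; b; c; d; e; g].
  move: u gn dn en; rewrite /= !inE !negb_or !andbT => /andP[/andP[-> ->] ->].
  move=> /and3P[ga gb gc] /and3P[db dc da] /and3P[ec ea eb].
  by rewrite ![a == _]eq_sym ![b == _]eq_sym ![c == _]eq_sym ![_ == g]eq_sym ga gb gc da db dc ea eb ec gd ge de.
have h1 := bounded5 bw (uniq_select a U (ks := [:: 2; 0; 4; 3; 1]%N) isT).
have h2 := bounded5 bw (uniq_select a U (ks := [:: 2; 0; 1; 5; 4]%N) isT).
have h3 := bounded6 bw (uniq_select a U (ks := [:: 2; 3; 4; 5; 0; 1]%N) isT).
move: h1 h2 h3 T Tg Td Te Eg Ed Ee; rewrite /tri /= => h1 h2 h3 T Tg Td Te [Eg1 Eg2] [Ed1 Ed2] [Ee1 Ee2].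
have := an a b; have := an a c; have := an a d; have := an a e; have := an a g.
have := an b c; have := an b d; have := an b e; have := an b g.
have := an c d; have := an c e; have := an c g; have := an d e; have := an d g; have := an e g.
lra.
Qed.
End StarLemma.

(** * Pairs and quadruples of stars *)

Ltac distinct := rewrite /= ?inE ?negb_or ?andbT; repeat (apply/andP; split); by [|rewrite eq_sym].

Section StarPairs.
Variable V : finType.
Implicit Types (u w : V -> V -> int) (a b c d e p q x y z : V) (s t : seq V) (I J : {set V}).

Definition addw u w x y : int := u x y + w x y.

Lemma cyc_addw u w s : cyc (addw u w) s = cyc u s + cyc w s.
Proof. exact: big_split. Qed.

Lemma addw_antisym u w : antisym u -> antisym w -> antisym (addw u w).
Proof. by move=> au aw x y; rewrite /addw au aw opprD. Qed.

Lemma tri_addw u w x y z : tri (addw u w) x y z = tri u x y z + tri w x y z.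
Proof. by rewrite /tri /addw; ring. Qed.

Lemma bounded_eq u w : antisym u -> antisym w ->
  (forall x y z, tri u x y z = tri w x y z) -> bounded u -> bounded w.
Proof. by move=> au aw E bu s cs; rewrite -(tri_eq_cyc au aw E) // bu. Qed.

(** Only edges at [p] have nonzero weight, so only the two neighbours of [p] in the cycle count. *)
Lemma cyc_star p I x s : uniq (p :: x :: s) ->
  cyc (star p I) (p :: x :: s) = (last x s \in I : nat)%:Z - (x \in I : nat)%:Z.
Proof.
move=> u; rewrite cyc_zip // rot1_cons /= big_cons /=.
have xp : x != p by move: u; rewrite /= inE negb_or eq_sym => /andP[/andP[]].
have -> : star p I p x = - (x \in I : nat)%:Z.
  by rewrite /star eqxx (negbTE xp) andbT andbF sub0r.
rewrite addrC; congr (_ - _).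
have : p \notin x :: s by move: u => /= /andP[].
elim: s x {u xp} => [|y s ih] x; rewrite !inE => pn /=.
  rewrite big_cons big_nil /= /star eqxx eq_sym (negbTE pn) andbF andbT.
  by rewrite addr0 subr0.
move: pn; rewrite negb_or => /andP[px pys].
rewrite big_cons ih //= {1}/star; move: pys; rewrite negb_or => /andP[py _].
by rewrite ![_ == p]eq_sym (negbTE px) (negbTE py) !andbF add0r.
Qed.

Lemma pair_bound_adj a b I J y t : bounded (addw (star a I) (star b J)) ->
  uniq (a :: b :: y :: t) ->
  `|(last y t \in I : nat)%:Z - (b \in I : nat)%:Z + ((a \in J : nat)%:Z - (y \in J : nat)%:Z)| <= 1.
Proof.
move=> bw u; have := bw (a :: b :: y :: t); rewrite /is_cycle u => /(_ isT).
rewrite cyc_addw cyc_star // -(cyc_rot (star b J) 1 u) rot1_cons -cats1 /= cyc_star.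
  by rewrite cats1 last_rcons.
by rewrite -cat_cons -cat_cons cats1 -rot1_cons rot_uniq.
Qed.

(** The cycle in which [a] and [b] are not adjacent; with [s] or [t] empty, one vertex is a
    neighbour of both. The adjacent case is [pair_bound_adj]. *)
Lemma pair_bound a b I J x s y t : bounded (addw (star a I) (star b J)) ->
  uniq ((a :: x :: s) ++ (b :: y :: t)) ->
  `|(last y t \in I : nat)%:Z - (x \in I : nat)%:Z +
    ((last x s \in J : nat)%:Z - (y \in J : nat)%:Z)| <= 1.
Proof.
move=> bw u; have := bw ((a :: x :: s) ++ (b :: y :: t)).
rewrite /is_cycle u size_cat /= !addnS => /(_ isT).
rewrite cyc_addw -(cyc_rot (star b J) (size (a :: x :: s)) u) rot_size_cat.
rewrite cyc_star // last_cat /= cyc_star ?last_cat //.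
by rewrite -[_ :: _ :: _]/((b :: y :: t) ++ (a :: x :: s)) uniq_catC.
Qed.

Definition no_common_vertex u w : Prop :=
  forall v, exists x y z, [/\ x != v, y != v & z != v] /\ (tri u x y z != 0 \/ tri w x y z != 0).

Lemma tri_star_neq0 a I x y z : a \notin I -> tri (star a I) x y z != 0 ->
  (exists2 i, i \in [:: x; y; z] & i \in I) /\
  (exists2 i, i \in [:: x; y; z] & (i \notin I) && (i != a)).
Proof.
move=> aI h; suff /andP[/hasP[i ? ?] /hasP[j ? ?]] :
    has (mem I) [:: x; y; z] && has (fun i => (i \notin I) && (i != a)) [:: x; y; z].
  by split; [exists i|exists j].
have nI v : v == a -> v \in I = false by move=> /eqP->; exact: negbTE.
move: h (nI x) (nI y) (nI z); rewrite /tri /star /=.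
case: (x \in I); case: (y \in I); case: (z \in I);
  case: (x == a); case: (y == a); case: (z == a) => //= _ h1 h2 h3;
  by [have := h1 isT|have := h2 isT|have := h3 isT].
Qed.

(** The cycle [a b x y] with [y] in [I] and [x] outside [J] would have sum 2, as would [a b x] if
    [x = y]. *)
Lemma star_pair_adj a b I J : bounded (addw (star a I) (star b J)) -> a != b ->
  a \notin I -> b \notin J -> b \notin I -> a \in J ->
  (exists x, x \in I) -> (exists2 x, x \notin J & x != b) -> False.
Proof.
move=> bw ab aI bJ bI aJ [y yI] [x xJ xb].
have xa : x != a by apply: contraNneq xJ => ->.
have ya : y != a by apply: contraNneq aI => <-.
have yb : y != b by apply: contraNneq bI => <-.
have [xy|xy] := eqVneq x y.
  have := @pair_bound_adj a b I J x [::] bw.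
  rewrite /= !inE !negb_or ab ![_ == x]eq_sym xa xb => /(_ isT).
  by rewrite {1}xy yI (negbTE bI) aJ (negbTE xJ).
have := @pair_bound_adj a b I J x [:: y] bw.
rewrite /= !inE !negb_or ab ![_ == x]eq_sym xa xb (eq_sym a y) (eq_sym b y) ya yb.
rewrite xy => /(_ isT).
by rewrite yI (negbTE bI) aJ (negbTE xJ).
Qed.

(** All linked triangles of this star contain the edge [bp], so either end can serve as centre. *)
Lemma star_singleton b p : p != b ->
  forall x y z, tri (star b [set p]) x y z = tri (star p (~: [set b; p])) x y z.
Proof.
move=> pb; apply: eq_tri_star; first exact: star_antisym.
move=> x y xp yp; rewrite !inE (negbTE xp) (negbTE yp) !orbF.
rewrite /tri /star !inE eqxx (negbTE pb) (negbTE xp) (negbTE yp).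
by case: (x == b); case: (y == b).
Qed.

(** Suppose that [z] is in [I] but not in [J]. A linked triangle that avoids [b] supplies a vertex
    [m] outside [I], different from [a] and [b]. The cycle [a m y b z] excludes every [y] in [J]
    other than [m], so [J] is a singleton; recentred at [m], the second star contradicts
    [star_pair_adj]. *)
Lemma star_pair_incl a b I J : bounded (addw (star a I) (star b J)) -> a != b ->
  no_common_vertex (star a I) (star b J) ->
  a \notin I -> b \notin J -> b \notin I -> a \notin J ->
  (exists x, x \in J) -> (I \subset J).
Proof.
move=> bw ab nc aI bJ bI aJ [y0 y0J].
apply/fintype.subsetP => z zI; apply/negPn/negP => zJ.
have [x' [y' [z' [[x'b y'b z'b] [|]]]]] := nc b; last first.
  by rewrite tri_star0 // eqxx.
move=> /(tri_star_neq0 aI)[_ [m mm /andP[mI ma]]].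
have mb : m != b by move: mm; rewrite !inE => /or3P[]/eqP->.
have za : z != a by apply: contraNneq aI => <-.
have zb : z != b by apply: contraNneq bI => <-.
have mz : m != z by apply: contraNneq mI => ->.
have uniqJ y : y \in J -> y = m.
  move=> yJ; apply/eqP/negPn/negP => yo.
  have ya : y != a by apply: contraNneq aJ => <-.
  have yb : y != b by apply: contraNneq bJ => <-.
  have yz : y != z by apply: contraNneq zJ => <-.
  have u : uniq ([:: a; m; y] ++ [:: b; z]) by distinct.
  by have := pair_bound bw u; rewrite /= zI (negbTE mI) yJ (negbTE zJ).
have mJ : m \in J by rewrite -(uniqJ y0 y0J).
have JE : J = [set m].
  by apply/setP => y; rewrite !inE; apply/idP/eqP => [/uniqJ|->].
have bw' : bounded (addw (star a I) (star m (~: [set b; m]))).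
  apply: bounded_eq bw => [| |x y v].
  - exact/addw_antisym/star_antisym/star_antisym.
  - exact/addw_antisym/star_antisym/star_antisym.
  by rewrite (tri_addw (star a I) (star b J)) (tri_addw (star a I) (star m _)) JE star_singleton.
apply: (star_pair_adj bw') => //.
- by rewrite eq_sym.
- by rewrite !inE eqxx orbT.
- by rewrite !inE negb_or ab eq_sym.
- by exists z.
by exists b; rewrite ?inE ?eqxx // eq_sym.
Qed.

Lemma no_common_vertexC u w : no_common_vertex u w -> no_common_vertex w u.
Proof.
by move=> h v; have [x [y [z [? [?|?]]]]] := h v; exists x, y, z; split=> //; [right|left].
Qed.

Lemma bounded_addwC u w : bounded (addw u w) -> bounded (addw w u).
Proof. by move=> h s /h; rewrite !cyc_addw addrC. Qed.

(** Two inclusions give [I = J]. The absence of a common vertex supplies a third vertex [c] outside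
    [I] and two vertices [y], [y1] inside; a fourth vertex [v] outside would give the cycle
    [a c y b v y1] the sum 2. *)
Lemma star_pair_core a b I J : bounded (addw (star a I) (star b J)) -> a != b ->
  no_common_vertex (star a I) (star b J) ->
  a \notin I -> b \notin J -> b \notin I -> a \notin J ->
  (exists x, x \in I) -> (exists x, x \in J) ->
  exists c, [/\ uniq [:: a; b; c], I = ~: [set a; b; c] & J = ~: [set a; b; c]].
Proof.
move=> bw ab nc aI bJ bI aJ nI nJ.
have IJ : I = J.
  apply/eqP; rewrite finset.eqEsubset (star_pair_incl bw ab nc) //=.
  apply: (star_pair_incl (bounded_addwC bw)) => //; first by rewrite eq_sym.
  exact: no_common_vertexC.
have [x' [y' [z' [[x'b y'b z'b] [|]]]]] := nc b; last first.
  by rewrite tri_star0 // eqxx.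
move=> /(tri_star_neq0 aI)[_ [c oin /andP[cI ca]]].
have cb : c != b by move: oin; rewrite !inE => /or3P[]/eqP->.
have [y yI] := nI.
have [y1 y1I yy1] : exists2 y1, y1 \in I & y1 != y.
  have [x2 [y2 [z2 [[x2y y2y z2y] h]]]] := nc y.
  have [[i ii iI] _] : (exists2 i, i \in [:: x2; y2; z2] & i \in I) /\ True.
    case: h => [/(tri_star_neq0 aI)[]//|/(tri_star_neq0 bJ)[]]; by rewrite IJ.
  by exists i => //; move: ii; rewrite !inE => /or3P[]/eqP->.
have uc : uniq [:: a; b; c] by rewrite /= !inE !negb_or ab eq_sym ca eq_sym cb.
exists c; suff IE : I = ~: [set a; b; c] by rewrite -IJ.
apply/setP => v; rewrite !inE !negb_or.
apply/idP/andP => [vI|[/andP[va vb] vc]].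
  by split; [apply/andP; split|]; apply: contraTneq vI => ->.
apply/negPn/negP => vI.
have ne v1 v2 : v1 \in I -> v2 \notin I -> v1 != v2 by move=> h; apply: contraNneq => <-.
have yc := ne y c yI cI; have y1c := ne y1 c y1I cI; have yv := ne y v yI vI.
have y1v := ne y1 v y1I vI; have ya := ne y a yI aI; have y1a := ne y1 a y1I aI.
have yb := ne y b yI bI; have y1b := ne y1 b y1I bI.
have u : uniq ([:: a; c; y] ++ [:: b; v; y1]) by distinct.
by have := pair_bound bw u; rewrite /= -IJ y1I (negbTE cI) yI (negbTE vI).
Qed.

Lemma star_flip p I : p \notin I -> forall x y z,
  tri (star p (~: (p |: I))) x y z = - tri (star p I) x y z.
Proof.
move=> pI x y z; have an : antisym (fun x y => - star p I x y).
  by move=> v v'; rewrite star_antisym.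
have -> : - tri (star p I) x y z = tri (fun x y => - star p I x y) x y z.
  by rewrite /tri !opprD.
symmetry; apply: eq_tri_star => // v v' vp v'p.
have -> : tri (fun x y => - star p I x y) p v v' = - tri (star p I) p v v'.
  by rewrite /tri !opprD.
by rewrite tri_star // !inE (negbTE vp) (negbTE v'p) /=; case: (v \in I); case: (v' \in I).
Qed.

(** Negating both stars exchanges [I] and [J] with their complementary parts. This reduces [b] in
    [I], [a] in [J] to the opposite position, treated in [star_pair_core]; the mixed positions fall
    to [star_pair_adj]. *)
Lemma star_pair a b I J : bounded (addw (star a I) (star b J)) ->
  no_common_vertex (star a I) (star b J) -> a \notin I -> b \notin J ->
  (exists x y z, tri (star a I) x y z != 0) -> (exists x y z, tri (star b J) x y z != 0) ->
  exists c, uniq [:: a; b; c] /\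
    ((I = ~: [set a; b; c] /\ J = ~: [set a; b; c]) \/
     (~: (a |: I) = ~: [set a; b; c] /\ ~: (b |: J) = ~: [set a; b; c])).
Proof.
move=> bw nc aI bJ [x1 [y1 [z1 /(tri_star_neq0 aI)[[i1 _ i1I] [m1 _ /andP[m1I m1a]]]]]].
move=> [x2 [y2 [z2 /(tri_star_neq0 bJ)[[i2 _ i2J] [m2 _ /andP[m2J m2b]]]]]].
have ab : a != b.
  apply/negP => /eqP ab; have [x [y [z [[xa ya za]]]]] := nc a.
  by rewrite -ab !tri_star0 // eqxx => -[].
have ba : b != a by rewrite eq_sym.
have aI' : a \notin ~: (a |: I) by rewrite !inE eqxx.
have bJ' : b \notin ~: (b |: J) by rewrite !inE eqxx.
have bw' : bounded (addw (star a (~: (a |: I))) (star b (~: (b |: J)))).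
  have an : antisym (fun x y => - addw (star a I) (star b J) x y).
    by move=> x y; rewrite addw_antisym //; exact: star_antisym.
  have an' := addw_antisym (@star_antisym _ a (~: (a |: I))) (@star_antisym _ b (~: (b |: J))).
  apply: (bounded_eq an an').
    move=> x y z; rewrite tri_addw !star_flip // -opprD -tri_addw.
    by rewrite {1}/tri -!opprD.
  by move=> s /bw; rewrite /cyc sumrN normrN.
have nc' : no_common_vertex (star a (~: (a |: I))) (star b (~: (b |: J))).
  by move=> v; have [x [y [z [? h]]]] := nc v; exists x, y, z; rewrite !star_flip // !oppr_eq0.
have m1I' : m1 \in ~: (a |: I) by rewrite !inE negb_or m1a.
have m2J' : m2 \in ~: (b |: J) by rewrite !inE negb_or m2b.
have i1I' : i1 \notin ~: (a |: I) by rewrite !inE i1I orbT.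
have i2J' : i2 \notin ~: (b |: J) by rewrite !inE i2J orbT.
have i1a : i1 != a by apply: contraNneq aI => <-.
have i2b : i2 != b by apply: contraNneq bJ => <-.
have [bI|bI] := boolP (b \in I); have [aJ|aJ] := boolP (a \in J).
- have [||||c [u E1 E2]] := star_pair_core bw' ab nc' aI' bJ'.
  + by rewrite !inE bI orbT.
  + by rewrite !inE aJ orbT.
  + by exists m1.
  + by exists m2.
  by exists c; split=> //; right.
- exfalso; apply: (star_pair_adj bw' ab aI' bJ'); rewrite ?inE ?bI ?orbT ?negb_or ?ab //.
    by exists m1.
  by exists i2.
- by exfalso; apply: (star_pair_adj bw ab aI bJ bI aJ); [exists i1|exists m2].
have [||c [u E1 E2]] := star_pair_core bw ab nc aI bJ bI aJ.
- by exists i1.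
- by exists i2.
by exists c; split=> //; left.
Qed.
End StarPairs.

Lemma sum4 (f : 'I_4 -> int) i j k l : uniq [:: i; j; k; l] ->
  \sum_m f m = f i + f j + f k + f l.
Proof.
move=> u; have full m : m \in [:: i; j; k; l].
  apply/negPn/negP => mn; have u' : uniq [:: m; i; j; k; l] by rewrite cons_uniq mn.
  by have := max_card (mem [:: m; i; j; k; l]); rewrite (card_uniqP u') card_ord.
rewrite -big_enum (perm_big [:: i; j; k; l]) /=; last first.
  by apply: uniq_perm => //; [exact: enum_uniq|move=> m; rewrite mem_enum full].
by rewrite !big_cons big_nil addr0 !addrA.
Qed.

(** * Quadruples of cochains without a common vertex *)

Section Quads.
Variable V : finType.
Implicit Types (u : V -> V -> int) (w : 'I_4 -> V -> V -> int) (a b c d e p q x y z v : V) (I J Y : {set V}).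
Implicit Types i j k l m : 'I_4.

(* The linking functions of the four triangles of a tetrahedron. *)
Record quad w : Prop := Quad {
  quad_antisym : forall i, antisym (w i);
  quad_bounded : forall i, bounded (w i);
  quad_pair : forall i j, i != j -> bounded (addw (w i) (w j));
  quad_sum : forall x y, \sum_i w i x y = 0
}.

Lemma quad_opp w : quad w -> quad (fun i x y => - w i x y).
Proof.
case=> an bd pr sm; split.
- by move=> i x y; rewrite (an i).
- by move=> i s /(bd i); rewrite /cyc sumrN normrN.
- by move=> i j ij s /(pr i j ij); rewrite !cyc_addw /cyc !sumrN -opprD normrN.
by move=> x y; rewrite sumrN sm oppr0.
Qed.

Lemma quad_sum4 w i j k l x y z : quad w -> uniq [:: i; j; k; l] ->
  tri (w i) x y z + tri (w j) x y z + tri (w k) x y z + tri (w l) x y z = 0.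
Proof.
move=> Q u; have h x' y' := quad_sum Q x' y'.
have := h x y; have := h y z; have := h z x.
by rewrite !(sum4 _ u) /tri => h1 h2 h3; lra.
Qed.

Lemma bounded_tri u x y z : antisym u -> bounded u -> -1 <= tri u x y z <= 1.
Proof.
move=> an bu; have [uq|nu] := boolP (uniq [:: x; y; z]); first exact: bounded3.
suff /eqP-> : tri u x y z == 0 by [].
by apply: contraNT nu; exact: tri_neq0_uniq.
Qed.

Lemma quad_pair_tri w i j x y z : quad w -> i != j ->
  -1 <= tri (w i) x y z + tri (w j) x y z <= 1.
Proof.
move=> Q ij; rewrite -tri_addw; apply: bounded_tri; [|exact: (quad_pair Q ij)].
exact/addw_antisym/(quad_antisym Q)/(quad_antisym Q).
Qed.

Lemma bounded4_tri u a b c d : antisym u -> bounded u -> uniq [:: a; b; c; d] ->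
  -1 <= tri u a b c + tri u a c d <= 1.
Proof.
move=> an bu uq; have := bounded4 bu uq; have := an a c; rewrite /tri => E.
by have -> : u a b + u b c + u c a + (u a c + u c d + u d a) = u a b + u b c + u c d + u d a
  by rewrite E; ring.
Qed.

Lemma quad_pair4 w i j a b c d : quad w -> i != j -> uniq [:: a; b; c; d] ->
  -1 <= tri (w i) a b c + tri (w i) a c d + (tri (w j) a b c + tri (w j) a c d) <= 1.
Proof.
move=> Q ij uq; have := bounded4_tri _ (quad_pair Q ij) uq; rewrite !tri_addw.
rewrite addrACA; apply.
exact/addw_antisym/(quad_antisym Q)/(quad_antisym Q).
Qed.

Lemma tri_eq0 u a : antisym u -> (forall x y, tri u a x y = 0) -> forall x y z, tri u x y z = 0.
Proof. by move=> an h x y z; have := tri_cocycle a x y z an; rewrite !h; lia. Qed.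

Lemma star_sum3 a b c x y z : uniq [:: a; b; c] -> let Y := ~: [set a; b; c] in
  tri (star a Y) x y z + tri (star b Y) x y z + tri (star c Y) x y z = 0.
Proof.
move=> uq Y; have [ab ac bc] : [/\ a != b, a != c & b != c].
  by move: uq; rewrite /= !inE negb_or !andbT => /andP[/andP[]].
have E x' y' : star a Y x' y' + star b Y x' y' + star c Y x' y' =
    (x' \in Y : nat)%:Z - (y' \in Y : nat)%:Z.
  have H v : ((v == a : nat) + (v == b : nat) + (v == c : nat) = (v \notin Y : nat))%N.
    rewrite !inE negbK; have [->|va] := eqVneq v a; first by rewrite (negbTE ab) (negbTE ac).
    have [->|vb] := eqVneq v b; first by rewrite (negbTE bc).
    by case: eqP.
  have := H x'; have := H y'; rewrite /star.
  by case: (x' \in Y); case: (y' \in Y); case: (x' == a); case: (x' == b); case: (x' == c);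
    case: (y' == a); case: (y' == b); case: (y' == c).
have := E x y; have := E y z; have := E z x; rewrite /tri; lra.
Qed.

Definition starY a b c : {set V} := ~: [set a; b; c].

Lemma no_common_vertex_eq u u' t t' :
  (forall x y z, tri u x y z = tri t x y z) -> (forall x y z, tri u' x y z = tri t' x y z) ->
  no_common_vertex u u' -> no_common_vertex t t'.
Proof.
move=> E E' h v; have [x [y [z [ne H]]]] := h v; exists x, y, z; split=> //.
by rewrite -E -E'.
Qed.

(** Where the first or the second star already takes the value 1 or -1, the bound on its sum with
    [w k] restricts the sign of [w k]. *)
Lemma third_star_values w i j k a b c : quad w -> uniq [:: i; j; k] -> uniq [:: a; b; c] ->
  (forall x y z, tri (w i) x y z = tri (star a (starY a b c)) x y z) ->
  (forall x y z, tri (w j) x y z = tri (star b (starY a b c)) x y z) ->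
  (exists y, y \in starY a b c) ->
  tri (w k) a b c = 0 /\ forall y, y \in starY a b c ->
    [/\ tri (w k) a b y = 0, tri (w k) b c y = tri (w k) a c y & tri (w k) b c y <= 0].
Proof.
move=> Q uq uabc Ei Ej [y0 y0Y]; have ank := quad_antisym Q k.
have [ij ik jk] : [/\ i != j, i != k & j != k].
  by move: uq; rewrite /= !inE negb_or !andbT => /andP[/andP[]].
have [ab ac bc] : [/\ a != b, a != c & b != c].
  by move: uabc; rewrite /= !inE negb_or !andbT => /andP[/andP[]].
have ba : b != a by rewrite eq_sym.
have ca : c != a by rewrite eq_sym.
have cb : c != b by rewrite eq_sym.
have nY v : v \in [:: a; b; c] -> (v \in starY a b c) = false.
  by rewrite !inE -orbA => ->.
have aY := nY a (mem_head _ _); have bY : (b \in starY a b c) = false by rewrite nY // !inE eqxx orbT.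
have cY : (c \in starY a b c) = false by rewrite nY // !inE eqxx !orbT.
have vals y : y \in starY a b c ->
    [/\ tri (w k) a b y = 0, tri (w k) a c y <= 0, tri (w k) b c y <= 0 & uniq [:: a; b; c; y]].
  move=> yY; have [ya yb yc] : [/\ y != a, y != b & y != c].
    by move: yY; rewrite !inE !negb_or => /andP[/andP[]].
  have i1 : tri (w i) a b y = 1 by rewrite Ei tri_star // yY bY.
  have j1 : tri (w j) a b y = -1 by rewrite Ej -tri_rot tri_star // yY aY.
  have i2 : tri (w i) a c y = 1 by rewrite Ei tri_star // yY cY.
  have j2 : tri (w j) b c y = 1 by rewrite Ej tri_star // yY cY.
  have := quad_pair_tri a b y Q ik; have := quad_pair_tri a b y Q jk.
  have := quad_pair_tri a c y Q ik; have := quad_pair_tri b c y Q jk.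
  rewrite i1 j1 i2 j2 => h1 h2 h3 h4; split; [lra|lra|lra|by distinct].
have K0 : tri (w k) a b c = 0.
  have [v1 _ _ U] := vals y0 y0Y.
  have [ya yb yc] : [/\ y0 != a, y0 != b & y0 != c].
    by move: y0Y; rewrite !inE !negb_or => /andP[/andP[]].
  (* The 4-cycle [b c a y0] with index [j] gives [tri (w k) a b c <= 0], and [a c b y0] with index
     [i] the opposite inequality. *)
  have := quad_pair4 Q jk (uniq_select a U (ks := [:: 1; 2; 0; 3]%N) isT).
  have := quad_pair4 Q ik (uniq_select a U (ks := [:: 0; 2; 1; 3]%N) isT).
  have i1 : tri (w i) a c b = 0 by rewrite Ei tri_star // bY cY.
  have i2 : tri (w i) a b y0 = 1 by rewrite Ei tri_star // bY y0Y.
  have j1 : tri (w j) b c a = 0 by rewrite Ej tri_star // aY cY.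
  have j2 : tri (w j) b a y0 = 1 by rewrite Ej tri_star // aY y0Y.
  rewrite /= i1 i2 j1 j2.
  have -> : tri (w k) a c b = - tri (w k) a b c by rewrite -tri_antisym // tri_rot.
  have -> : tri (w k) b c a = tri (w k) a b c by rewrite tri_rot.
  rewrite v1; have -> : tri (w k) b a y0 = - tri (w k) a b y0 by rewrite tri_antisym.
  rewrite v1 => h1 h2; lra.
split=> // y yY; have [v1 v2 v3 U] := vals y yY; split=> //.
by have := tri_cocycle a b c y ank; rewrite v1 K0; lra.
Qed.

(** By [star_pair] applied to [w i] and [w k], the centre is [b] or [c], or both stars have the
    flipped form, which requires a graph with exactly five vertices. The values found in
    [third_star_values] rule out [b] and the flipped form. *)
Lemma third_star w i j k a b c : quad w -> uniq [:: i; j; k] -> uniq [:: a; b; c] ->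
  (forall x y z, tri (w i) x y z = tri (star a (starY a b c)) x y z) ->
  (forall x y z, tri (w j) x y z = tri (star b (starY a b c)) x y z) ->
  (exists y, y \in starY a b c) ->
  (exists x y z, tri (w k) x y z != 0) -> no_common_vertex (w i) (w k) ->
  forall x y z, tri (w k) x y z = tri (star c (starY a b c)) x y z.
Proof.
move=> Q uq uabc Ei Ej exY [x0 [y0 [z0 nz]]] nc.
have [K0 vals] := third_star_values Q uq uabc Ei Ej exY.
have [y1 y1Y] := exY.
have ank := quad_antisym Q k.
have [ij ik jk] : [/\ i != j, i != k & j != k].
  by move: uq; rewrite /= !inE negb_or !andbT => /andP[/andP[]].
have [ab ac bc] : [/\ a != b, a != c & b != c].
  by move: uabc; rewrite /= !inE negb_or !andbT => /andP[/andP[]].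
have V0 : (0 < #|V|)%N by apply/card_gt0P; exists a.
have [e [K [eK Ek]]] := bounded_star ank (quad_bounded Q k) V0.
have bd : bounded (addw (star a (starY a b c)) (star e K)).
  apply: bounded_eq (quad_pair Q ik) => [| |x y z].
  - exact/addw_antisym/(quad_antisym Q)/(quad_antisym Q).
  - exact/addw_antisym/star_antisym/star_antisym.
  by rewrite (tri_addw (w i)) (tri_addw (star a _)) Ei Ek.
have aY : a \notin starY a b c by rewrite !inE eqxx.
have [c' [u' [[E1 E2]|[E1 E2]]]] : exists c', uniq [:: a; e; c'] /\
    ((starY a b c = ~: [set a; e; c'] /\ K = ~: [set a; e; c']) \/
     (~: (a |: starY a b c) = ~: [set a; e; c'] /\ ~: (e |: K) = ~: [set a; e; c'])).
  apply: star_pair => //; first exact: no_common_vertex_eq Ei Ek nc.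
    have [y1a y1b y1c] : [/\ y1 != a, y1 != b & y1 != c].
      by move: y1Y; rewrite !inE !negb_or => /andP[/andP[]].
    exists a, b, y1; rewrite tri_star //; last by rewrite eq_sym.
    by rewrite y1Y !inE eqxx orbT.
  by exists x0, y0, z0; rewrite -Ek.
- have KY : K = starY a b c by rewrite E1 E2.
  have ea : e != a by move: u'; rewrite /= !inE negb_or eq_sym => /andP[/andP[]].
  have : e \in [set a; b; c].
    by apply/negPn/negP => h; move: eK; rewrite KY /starY finset.in_setC h.
  rewrite !inE (negbTE ea) /= => /orP[/eqP eb|/eqP ec]; last by move=> x y z; rewrite Ek KY ec.
  exfalso; have [_ _] := vals y1 y1Y.
  have [y1a y1b y1c] : [/\ y1 != a, y1 != b & y1 != c].
    by move: y1Y; rewrite !inE !negb_or => /andP[/andP[]].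
  rewrite Ek eb tri_star //; last by rewrite eq_sym.
  by rewrite KY y1Y !inE eqxx !orbT.
exfalso; have mem v : (v \in ~: (a |: starY a b c)) = (v \in [set b; c]).
  rewrite !inE; have [->|_] := eqVneq v a; first by rewrite (negbTE ab) (negbTE ac).
  by rewrite /= negbK.
have memK v : (v \in ~: (e |: K)) = (v \in [set b; c]) by rewrite E2 -E1 mem.
have ea : e != a by move: u'; rewrite /= !inE negb_or eq_sym => /andP[/andP[]].
have eb : e != b by apply/eqP => eb; have := memK b; rewrite !inE eb !eqxx.
have ec : e != c by apply/eqP => ec; have := memK c; rewrite !inE ec !eqxx orbT.
have aK : a \in K by have := memK a; rewrite !inE (eq_sym a e) (negbTE ea) (negbTE ab) (negbTE ac) => /negbFE.
have bK : b \in K = false by have := memK b; rewrite !inE (eq_sym b e) (negbTE eb) eqxx => /negbTE.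
have cK : c \in K = false by have := memK c; rewrite !inE (eq_sym c e) (negbTE ec) eqxx orbT => /negbTE.
have eY : e \in starY a b c by rewrite !inE !negb_or ea eb.
have [_ + _] := vals e eY.
by rewrite !Ek ![tri _ _ c e]tri_rot !tri_star ?bK ?cK ?aK // eq_sym.
Qed.
End Quads.

Section QuadCases.
Variable V : finType.
Implicit Types (u : V -> V -> int) (w : 'I_4 -> V -> V -> int) (a b c d e p q x y z v : V) (I J Y : {set V}).
Implicit Types i j k l m : 'I_4.

Lemma starYC a b c : starY b a c = starY a b c.
Proof. by apply/setP => v; rewrite !inE [(v == b) || _]orbC. Qed.

Lemma starYAC a b c : starY a c b = starY a b c.
Proof. by apply/setP => v; rewrite !inE orbAC. Qed.

Lemma starY_card a b c : (5 <= #|V|)%N -> exists y z, [/\ y \in starY a b c, z \in starY a b c & y != z].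
Proof.
move=> V5; apply/card_gt1P; have := cardsC [set a; b; c].
have : (#|[set a; b; c]| <= 3)%N.
  have -> : #|[set a; b; c]| = #|[:: a; b; c]| by apply: eq_card => v; rewrite !inE -orbA.
  exact: card_size.
by rewrite /starY; lia.
Qed.

Lemma common_vertexP u t : ~ no_common_vertex u t ->
  exists v, forall x y z, x != v -> y != v -> z != v -> tri u x y z = 0 /\ tri t x y z = 0.
Proof.
move=> h; apply: contrapT => h'; apply: h => v; apply: contrapT => h2; apply: h'.
exists v => x y z xv yv zv; split; apply/eqP; apply: contrapT => /negP ne; apply: h2;
  exists x, y, z; split=> //; by [left|right].
Qed.

(** If [w k] shares a vertex with each of the two given stars, these vertices must be [a] and [b],
    since two vertices lie outside [abc]. All linked triangles of [w k] then contain the edge [ab],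
    on which [third_star_values] leaves only zeros. Otherwise [third_star] applies, and [w l]
    vanishes because the four sum to zero. *)
Lemma quad_positive w i j k l a b c : quad w -> uniq [:: i; j; k; l] -> uniq [:: a; b; c] ->
  (5 <= #|V|)%N ->
  (forall x y z, tri (w i) x y z = tri (star a (starY a b c)) x y z) ->
  (forall x y z, tri (w j) x y z = tri (star b (starY a b c)) x y z) ->
  (exists x y z, tri (w k) x y z != 0) ->
  (forall x y z, tri (w k) x y z = tri (star c (starY a b c)) x y z) /\
  (forall x y z, tri (w l) x y z = 0).
Proof.
move=> Q uq uabc V5 Ei Ej nz.
have [y [y' [yY y'Y yy']]] := starY_card a b c V5.
have exY : exists y, y \in starY a b c by exists y.
have uijk : uniq [:: i; j; k] := uniq_select i uq (ks := [:: 0; 1; 2]%N) isT.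
have ujik : uniq [:: j; i; k] := uniq_select i uq (ks := [:: 1; 0; 2]%N) isT.
have ubac : uniq [:: b; a; c] := uniq_select a uabc (ks := [:: 1; 0; 2]%N) isT.
have Ek : forall x y z, tri (w k) x y z = tri (star c (starY a b c)) x y z.
  have [nc|/common_vertexP[v hv]] := pselect (no_common_vertex (w i) (w k)).
    exact: third_star uijk uabc Ei Ej exY nz nc.
  have [nc|/common_vertexP[v' hv']] := pselect (no_common_vertex (w j) (w k)).
    rewrite -(starYC a b c).
    by apply: third_star ujik ubac _ _ _ nz nc; rewrite ?(starYC a b c).
  exfalso; have [K0 vals] := third_star_values Q uijk uabc Ei Ej exY.
  have ank := quad_antisym Q k.
  have [ab ac bc] : [/\ a != b, a != c & b != c].
    by move: uabc; rewrite /= !inE negb_or !andbT => /andP[/andP[]].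
  have ba : b != a by rewrite eq_sym.
  have ca : c != a by rewrite eq_sym.
  have cb : c != b by rewrite eq_sym.
  have nY z : z \in starY a b c -> [/\ z != a, z != b & z != c].
    by rewrite !inE !negb_or => /andP[/andP[]].
  have [ya yb yc] := nY y yY; have [y'a y'b y'c] := nY y' y'Y.
  have aY : (a \in starY a b c) = false by rewrite !inE eqxx.
  have bY : (b \in starY a b c) = false by rewrite !inE eqxx orbT.
  have cY : (c \in starY a b c) = false by rewrite !inE eqxx !orbT.
  have va : v = a.
    apply/eqP/negPn/negP => va.
    have C z t : z \in starY a b c -> t != a -> t \notin starY a b c -> v != z -> v != t -> False.
      move=> zY ta tY vz vt; have [za _ _] := nY z zY.
      have [] := hv a t z; rewrite 1?eq_sym //; rewrite 1?eq_sym //.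
      by rewrite Ei tri_star // zY (negbTE tY).
    have [vb|vb] := eqVneq v b.
      by apply: (C y c) => //; rewrite ?cY // vb // eq_sym.
    have [vy|vy] := eqVneq v y.
      by apply: (C y' b) => //; rewrite ?bY // vy.
    by apply: (C y b) => //; rewrite ?bY.
  have v'b : v' = b.
    apply/eqP/negPn/negP => vb.
    have C z t : z \in starY a b c -> t != b -> t \notin starY a b c -> v' != z -> v' != t -> False.
      move=> zY tb tY vz vt; have [_ zb _] := nY z zY.
      have [] := hv' b t z; rewrite 1?eq_sym //; rewrite 1?eq_sym //.
      by rewrite Ej tri_star // zY (negbTE tY).
    have [va'|va'] := eqVneq v' a.
      by apply: (C y c) => //; rewrite ?cY // va' // eq_sym.
    have [vy|vy] := eqVneq v' y.
      by apply: (C y' a) => //; rewrite ?aY // vy.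
    by apply: (C y a) => //; rewrite ?aY.
  subst v v'.
  have abz z : tri (w k) a b z = 0.
    have [->|za] := eqVneq z a; first by rewrite tri_xyx.
    have [->|zb] := eqVneq z b; first by rewrite tri_xyy.
    have [->|zc] := eqVneq z c; first exact: K0.
    by have [] := vals z; rewrite // !inE !negb_or za zb.
  have ak x z : tri (w k) a x z = 0.
    have [->|xb] := eqVneq x b; first exact: abz.
    have [->|zb] := eqVneq z b.
      by rewrite tri_swap // abz oppr0.
    by have [] := hv' a x z ab xb zb.
  by case: nz => x [z [t]]; rewrite (tri_eq0 ank ak) eqxx.
split=> // x z t; have := quad_sum4 x z t Q uq; rewrite Ei Ej Ek.
by have := star_sum3 x z t uabc; rewrite -/(starY a b c) /= => ->; rewrite add0r.
Qed.

Definition signed_stars w i j k l a b c (s : bool) : Prop :=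
  forall x y z, [/\ tri (w i) x y z = (-1) ^+ s * tri (star a (starY a b c)) x y z,
    tri (w j) x y z = (-1) ^+ s * tri (star b (starY a b c)) x y z,
    tri (w k) x y z = (-1) ^+ s * tri (star c (starY a b c)) x y z & tri (w l) x y z = 0].

Lemma quad_no_common_pair w i j k l : quad w -> uniq [:: i; j; k; l] -> (5 <= #|V|)%N ->
  (forall m, m != l -> exists x y z, tri (w m) x y z != 0) ->
  no_common_vertex (w i) (w j) ->
  exists a b c s, uniq [:: a; b; c] /\ signed_stars w i j k l a b c s.
Proof.
move=> Q uq V5 nz nc.
have [il jl kl] : [/\ i != l, j != l & k != l].
  by move: uq; rewrite /= !inE !negb_or !andbT -!andbA => /and4P[_ _ -> /and3P[_ -> ->]].
have ij : i != j by move: uq; rewrite /= !inE !negb_or -!andbA => /and3P[].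
have V0 : (0 < #|V|)%N by apply: leq_trans V5.
have [a [I [aI Ei]]] := bounded_star (quad_antisym Q i) (quad_bounded Q i) V0.
have [b [J [bJ Ej]]] := bounded_star (quad_antisym Q j) (quad_bounded Q j) V0.
have bd : bounded (addw (star a I) (star b J)).
  apply: bounded_eq (quad_pair Q ij) => [| |x y z].
  - exact/addw_antisym/(quad_antisym Q)/(quad_antisym Q).
  - exact/addw_antisym/star_antisym/star_antisym.
  by rewrite (tri_addw (w i)) (tri_addw (star a _)) Ei Ej.
have [x1 [y1 [z1 n1]]] := nz i il; have [x2 [y2 [z2 n2]]] := nz j jl.
have [c [uc [[IE JE]|[IE JE]]]] := star_pair bd (no_common_vertex_eq Ei Ej nc) aI bJ
  (ex_intro _ x1 (ex_intro _ y1 (ex_intro _ z1 (eq_ind _ (fun t => t != 0) n1 _ (Ei x1 y1 z1)))))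
  (ex_intro _ x2 (ex_intro _ y2 (ex_intro _ z2 (eq_ind _ (fun t => t != 0) n2 _ (Ej x2 y2 z2))))).
  rewrite IE in Ei; rewrite JE in Ej.
  have [Ek El] := quad_positive Q uq uc V5 Ei Ej (nz k kl).
  by exists a, b, c, false; split=> // x y z; rewrite expr0 !mul1r.
(* The flipped form becomes the positive one for the negated quadruple; this is where the sign [s]
   arises. *)
pose w' i x y := - w i x y.
have T i' x y z : tri (w' i') x y z = - tri (w i') x y z by rewrite /tri -!opprD.
have Ei' x y z : tri (w' i) x y z = tri (star a (starY a b c)) x y z.
  by rewrite T Ei -star_flip // IE.
have Ej' x y z : tri (w' j) x y z = tri (star b (starY a b c)) x y z.
  by rewrite T Ej -star_flip // JE.
have nzk : exists x y z, tri (w' k) x y z != 0.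
  by have [x [y [z h]]] := nz k kl; exists x, y, z; rewrite T oppr_eq0.
have [Ek El] := quad_positive (quad_opp Q) uq uc V5 Ei' Ej' nzk.
exists a, b, c, true; split=> // x y z; rewrite expr1 !mulN1r -Ei' -Ej' -Ek.
have := El x y z; rewrite -/(w' l) -/(w' k) !T !opprK => /eqP; rewrite oppr_eq0 => /eqP->.
by [].
Qed.

(** If each two of the three nonzero cochains share a vertex, the three shared vertices are distinct
    and each cochain is nonzero on the triangle they form. Three values of 1 or -1 cannot have
    pairwise opposite signs, as the bounds on pairs demand. *)
Lemma quad_no_common w i j k l : quad w -> uniq [:: i; j; k; l] -> (5 <= #|V|)%N ->
  (forall m, m != l -> exists x y z, tri (w m) x y z != 0) ->
  (forall v, exists x y z, [/\ x != v, y != v & z != v] /\ exists m, tri (w m) x y z != 0) ->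
  exists a b c s, uniq [:: a; b; c] /\ signed_stars w i j k l a b c s.
Proof.
move=> Q uq V5 nz nc.
have [h|/common_vertexP[v hv]] := pselect (no_common_vertex (w i) (w j)).
  exact: quad_no_common_pair.
have uq1 : uniq [:: i; k; j; l] := uniq_select i uq (ks := [:: 0; 2; 1; 3]%N) isT.
have uq2 : uniq [:: j; k; i; l] := uniq_select i uq (ks := [:: 1; 2; 0; 3]%N) isT.
have [h|/common_vertexP[v1 hv1]] := pselect (no_common_vertex (w i) (w k)).
  have [a [b [c [s [u S]]]]] := quad_no_common_pair Q uq1 V5 nz h.
  exists a, c, b, s; split; first exact: (uniq_select a u (ks := [:: 0; 2; 1]%N) isT).
  by move=> x y z; rewrite starYAC; have [] := S x y z.
have [h|/common_vertexP[v2 hv2]] := pselect (no_common_vertex (w j) (w k)).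
  have [a [b [c [s [u S]]]]] := quad_no_common_pair Q uq2 V5 nz h.
  exists c, a, b, s; split; first exact: (uniq_select a u (ks := [:: 2; 0; 1]%N) isT).
  by move=> x y z; rewrite starYC starYAC; have [] := S x y z.
exfalso.
have [il jl kl] : [/\ i != l, j != l & k != l].
  by move: uq; rewrite /= !inE !negb_or !andbT -!andbA => /and4P[_ _ -> /and3P[_ -> ->]].
have [ij ik jk] : [/\ i != j, i != k & j != k].
  by move: uq; rewrite /= !inE !negb_or -!andbA => /and4P[-> -> _ /andP[->]].
have all0 t : (forall x y z, x != t -> y != t -> z != t ->
    [/\ tri (w i) x y z = 0, tri (w j) x y z = 0 & tri (w k) x y z = 0]) -> False.
  move=> H; have [x [y [z [[xt yt zt] [m]]]]] := nc t.
  have [hi hj hk] := H x y z xt yt zt; have hl := quad_sum4 x y z Q uq.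
  rewrite hi hj hk !add0r in hl; suff -> : tri (w m) x y z = 0 by rewrite eqxx.
  have : m \in [:: i; j; k; l].
    apply/negPn/negP => mn; have u' : uniq [:: m; i; j; k; l] by rewrite cons_uniq mn.
    by have := max_card (mem [:: m; i; j; k; l]); rewrite (card_uniqP u') card_ord.
  by rewrite !inE => /or4P[]/eqP->.
have v12 : v != v1.
  by apply/eqP => E; apply: (all0 v) => x y z h1 h2 h3; have [] := hv x y z h1 h2 h3; rewrite -E in hv1;
     have [] := hv1 x y z h1 h2 h3.
have v13 : v != v2.
  by apply/eqP => E; apply: (all0 v) => x y z h1 h2 h3; have [] := hv x y z h1 h2 h3; rewrite -E in hv2;
     have [] := hv2 x y z h1 h2 h3.
have v23 : v1 != v2.
  by apply/eqP => E; apply: (all0 v1) => x y z h1 h2 h3; have [] := hv1 x y z h1 h2 h3; rewrite -E in hv2;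
     have [] := hv2 x y z h1 h2 h3.
(* All linked triangles of [w m] contain the edge [st]. By the cocycle identity all triangles on
   this edge have the same value, so if one is zero, [w m] vanishes. *)
have edge m s t r : m != l ->
    (forall x y z, x != s -> y != s -> z != s -> tri (w m) x y z = 0) ->
    (forall x y z, x != t -> y != t -> z != t -> tri (w m) x y z = 0) ->
    s != t -> s != r -> t != r -> tri (w m) s t r != 0.
  move=> ml hs ht st sr tr; have an := quad_antisym Q m; apply/negP => /eqP Z.
  have ts : t != s by rewrite eq_sym.
  have rs : r != s by rewrite eq_sym.
  have rt : r != t by rewrite eq_sym.
  have str x : tri (w m) s t x = 0.
    have [->|xs] := eqVneq x s; first by rewrite tri_xyx.
    have [->|xt] := eqVneq x t; first by rewrite tri_xyy.
    have := tri_cocycle s t x r an; rewrite (hs t x r) // (ht s x r) // Z.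
    by lra.
  have sxy x y : tri (w m) s x y = 0.
    have [->|xt] := eqVneq x t; first exact: str.
    have [->|yt] := eqVneq y t; last exact: ht.
    by rewrite tri_swap // str oppr0.
  by have [x [y [z]]] := nz m ml; rewrite (tri_eq0 an sxy) eqxx.
have ei : tri (w i) v v1 v2 != 0.
  by apply: edge => // x y z h1 h2 h3; [have [] := hv x y z h1 h2 h3|have [] := hv1 x y z h1 h2 h3].
have ej : tri (w j) v v1 v2 != 0.
  rewrite -tri_rot -tri_rot; apply: edge => //; rewrite 1?eq_sym // => x y z h1 h2 h3.
    by have [] := hv2 x y z h1 h2 h3.
  by have [] := hv x y z h1 h2 h3.
have ek : tri (w k) v v1 v2 != 0.
  rewrite -tri_rot; apply: edge => //; rewrite 1?eq_sym // => x y z h1 h2 h3.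
    by have [] := hv1 x y z h1 h2 h3.
  by have [] := hv2 x y z h1 h2 h3.
have b1 := quad_pair_tri v v1 v2 Q ij; have b2 := quad_pair_tri v v1 v2 Q ik.
have b3 := quad_pair_tri v v1 v2 Q jk.
move: ei ej ek b1 b2 b3; move: (tri _ _ _ _) (tri _ _ _ _) (tri _ _ _ _) => t1 t2 t3.
clear; lia.
Qed.
End QuadCases.

(** * Linking vectors as roots, and quadruples with a common vertex *)

Section Roots.
Implicit Types (f g : 'I_4 -> int) (i j k l m : 'I_4).

(* Zero or a root e_i - e_j of the root system A_3. *)
Definition root_or_zero f : Prop :=
  [/\ forall i, -1 <= f i <= 1, forall i j, i != j -> -1 <= f i + f j <= 1 & \sum_i f i = 0].

Lemma root_has1 f k : root_or_zero f -> f k != 0 -> exists i, f i = 1.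
Proof.
move=> [b1 b2 s0] fk; apply: contrapT => no.
have le0 i : f i <= 0.
  by have := b1 i; have : f i <> 1 by [move=> h; apply: no; exists i|]; lia.
have fk0 : f k < 0 by rewrite lt_neqAle fk le0.
have : \sum_i f i < 0.
  rewrite (bigD1 k) //=; have : \sum_(i | i != k) f i <= 0 by apply: sumr_le0.
  by move=> h; rewrite -[X in _ < X]addr0; exact: ltr_leD.
by rewrite s0 ltxx.
Qed.

Lemma root_hasN1 f k : root_or_zero f -> f k != 0 -> exists i, f i = -1.
Proof.
move=> [b1 b2 s0] fk; have [||i fi] := @root_has1 (fun i => - f i) k.
- split=> [i|i j ij|]; [have := b1 i; lia|have := b2 i j ij; lia|by rewrite sumrN s0 oppr0].
- by rewrite oppr_eq0.
by exists i; lia.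
Qed.

(** If neither the places of 1 nor those of -1 agree, the difference has entries of sum at most -2
    at the place of 1 in [f] and the place of -1 in [g]. *)
Lemma roots_share_index f g i j k : root_or_zero f -> root_or_zero g ->
  root_or_zero (fun m => g m - f m) -> f i = 1 -> f j = -1 -> g k != 0 -> g i = 1 \/ g j = -1.
Proof.
move=> rf rg [d1 d2 _] fi fj gk; have [k1 g1] := root_has1 rg gk; have [m gm] := root_hasN1 rg gk.
have [k1i|k1i] := eqVneq k1 i; first by left; rewrite -k1i.
have [mj|mj] := eqVneq m j; first by right; rewrite -mj.
have [im|im] := eqVneq i m; first by have := d1 i; rewrite fi im gm.
have [_ f2 _] := rf; have [_ g2 _] := rg.
have := d2 i m im; have := f2 m j mj; have := g2 k1 i k1i; rewrite g1 gm fi fj; lia.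
Qed.
End Roots.

Section QuadCommon.
Variable V : finType.
Implicit Types (w : 'I_4 -> V -> V -> int) (a b c d e p q x y z v : V).
Implicit Types i j k l m : 'I_4.

Lemma quad_root w x y z : quad w -> root_or_zero (fun i => tri (w i) x y z).
Proof.
move=> Q; split=> [i|i j ij|].
- exact: bounded_tri (quad_antisym Q i) (quad_bounded Q i).
- exact: quad_pair_tri.
by rewrite /tri !big_split /= !(quad_sum Q).
Qed.

(** When all nonzero vectors are e_k - e_j with the same [j], adding e_j turns each into a unit
    vector e_k. The vertex [x] gets the colour [k]; vertices with zero vector, such as [a], get the
    colour [j]. *)
Lemma quad_common_sign w q a j : quad w -> a != q ->
  (forall i x y z, x != q -> y != q -> z != q -> tri (w i) x y z = 0) ->
  (forall x, x != q -> (forall i, tri (w i) q a x = 0) \/ tri (w j) q a x = -1) ->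
  exists I : 'I_4 -> {set V},
    [/\ forall i k, i != k -> [disjoint I i & I k],
        (\bigcup_i I i)%SET = ([set: V] :\ q)%SET &
        forall i x y z, tri (w i) x y z = tri (star q (I i)) x y z].
Proof.
move=> Q aq off sgn.
pose f k x := tri (w k) q a x + (k == j : nat)%:Z.
have f01 k x : x != q -> f k x = 0 \/ f k x = 1.
  move=> xq; have [b1 b2 _] := quad_root q a x Q; rewrite /f.
  have [h|h] := sgn x xq; first by rewrite h add0r; case: (k == j); [right|left].
  have [->|kj] := eqVneq k j; first by rewrite h; left.
  by have := b1 k; have := b2 k j kj; rewrite h; lia.
pose I k := [set x | (x != q) && (f k x == 1)]%SET.
exists I; split.
- move=> k l kl; rewrite finset.disjoints_subset; apply/fintype.subsetP => x.
  rewrite !inE negb_and => /andP[xq /eqP fk]; rewrite xq /=.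
  apply/negP => /eqP fl; have [b1 b2 _] := quad_root q a x Q.
  have := b2 k l kl; move: fk fl; rewrite /f.
  have [h|h] := sgn x xq.
    rewrite !h !add0r; have [kj|//] := eqVneq k j; have [lj|//] := eqVneq l j.
    by rewrite kj lj eqxx in kl.
  have [kj|kj] := eqVneq k j; first by rewrite kj h.
  have [lj|lj] := eqVneq l j; first by rewrite lj h.
  by rewrite !addr0 => -> ->.
- apply/setP => x; rewrite !inE andbT; apply/finset.bigcupP/idP => [[k _]|xq].
    by rewrite inE => /andP[].
  have [h|h] := sgn x xq; first by exists j; rewrite // inE xq /f h eqxx.
  have [|k fk] := @root_has1 _ j (quad_root q a x Q); first by rewrite h.
  exists k; rewrite // inE xq /f fk; have [kj|//] := eqVneq k j.
  by move: fk; rewrite kj h.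
move=> i; apply: eq_tri_star; first exact: quad_antisym.
move=> x y xq yq; have an := quad_antisym Q i.
have IE z : z != q -> (z \in I i : nat)%:Z = f i z.
  by move=> zq; rewrite inE zq /=; case: (f01 i z zq) => ->.
rewrite !IE // /f; have := tri_cocycle q a x y an; rewrite (off i a x y) //; lra.
Qed.

(** Triangles missing [q] have value 0, so the vectors of [q a x] and [q a y] differ by that of
    [q x y], which is again zero or a root. Hence any two nonzero ones share a place of 1 or of -1,
    and then all share one. A common place of 1 is reduced to a common place of -1 by negation. *)
Lemma quad_common w q m : quad w ->
  (forall i x y z, x != q -> y != q -> z != q -> tri (w i) x y z = 0) ->
  (exists x y z, tri (w m) x y z != 0) ->
  exists (I : 'I_4 -> {set V}) (s : bool),
    [/\ forall i k, i != k -> [disjoint I i & I k],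
        (\bigcup_i I i)%SET = ([set: V] :\ q)%SET &
        forall i x y z, tri (w i) x y z = (-1) ^+ s * tri (star q (I i)) x y z].
Proof.
move=> Q off [x1 [y1 [z1 nz]]].
have [a aq] : exists a, a != q.
  have := tri_neq0_uniq (quad_antisym Q m) nz; rewrite /= !inE negb_or => /andP[/andP[xy _] _].
  by have [xq|xq] := eqVneq x1 q; [exists y1; rewrite eq_sym -xq|exists x1].
have R x y := quad_root q x y Q.
have diff x y : x != q -> y != q ->
    root_or_zero (fun i => tri (w i) q a y - tri (w i) q a x).
  move=> xq yq; have -> : (fun i => tri (w i) q a y - tri (w i) q a x) = (fun i => tri (w i) q x y).
    apply: funext => i; have := tri_cocycle q a x y (quad_antisym Q i).
    by rewrite (off i a x y) //; lra.
  exact: R.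
have [x0 [k0 [x0q k0x]]] : exists x k, x != q /\ tri (w k) q a x != 0.
  apply: contrapT => no; have an := quad_antisym Q m.
  have Z x : tri (w m) q a x = 0.
    have [->|xq] := eqVneq x q; first by rewrite tri_xyx.
    by apply/eqP/negPn/negP => h; apply: no; exists x, m.
  have Z' x y : tri (w m) q x y = 0.
    have [->|xq] := eqVneq x q; first by rewrite tri_xxy.
    have [->|yq] := eqVneq y q; first by rewrite tri_xyx.
    by have := tri_cocycle q a x y an; rewrite !Z (off m a x y) //; lra.
  by move: nz; rewrite (tri_eq0 an Z') eqxx.
have [i fi] := root_has1 (R a x0) k0x; have [j fj] := root_hasN1 (R a x0) k0x.
have [pos|neg] := pselect (forall x, x != q -> (forall i, tri (w i) q a x = 0) \/ tri (w j) q a x = -1).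
  have [I [h1 h2 h3]] := quad_common_sign Q aq off pos.
  by exists I, false; split=> // k x y z; rewrite expr0 mul1r.
(* Some [x2] lacks -1 at [j] and hence has 1 at [i]. If [x] lacked 1 at [i], it would have -1 at
   [j], and what it shares with [x2] would be a second -1. *)
have neg' x : x != q -> (forall k, tri (w k) q a x = 0) \/ tri (w i) q a x = 1.
  move=> xq; apply: contrapT => bad; apply: neg => x2 x2q; apply: contrapT => bad2.
  have nzx z : ~ (forall k, tri (w k) q a z = 0) -> exists k, tri (w k) q a z != 0.
    by move=> h; apply: contrapT => h'; apply: h => k; apply/eqP/negPn/negP => h2; apply: h'; exists k.
  have [k hk] : exists k, tri (w k) q a x != 0 by apply: nzx => h; apply: bad; left.
  have [k2 hk2] : exists k, tri (w k) q a x2 != 0 by apply: nzx => h; apply: bad2; left.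
  have [f2|f2] := roots_share_index (R a x0) (R a x2) (diff x0 x2 x0q x2q) fi fj hk2; last first.
    by apply: bad2; right.
  have [f3|f3] := roots_share_index (R a x0) (R a x) (diff x0 x x0q xq) fi fj hk.
    by apply: bad; right.
  have [j2 g2] := root_hasN1 (R a x2) hk2.
  have jj2 : j != j2 by apply/eqP => E; apply: bad2; right; rewrite E.
  have [f4|f4] := roots_share_index (R a x2) (R a x) (diff x2 x x2q xq) f2 g2 hk.
    by apply: bad; right.
  by have [_ b2 _] := R a x; have := b2 j j2 jj2; rewrite f3 f4.
pose w' k x y := - w k x y.
have T k x y z : tri (w' k) x y z = - tri (w k) x y z by rewrite /tri -!opprD.
have off' k x y z : x != q -> y != q -> z != q -> tri (w' k) x y z = 0.
  by move=> xq yq zq; rewrite T off // oppr0.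
have [|I [h1 h2 h3]] := @quad_common_sign w' q a i (quad_opp Q) aq off'.
  by move=> x /neg'[h|h]; [left => k; rewrite T h oppr0|right; rewrite T h].
by exists I, true; split=> // k x y z; rewrite expr1 mulN1r -h3 T opprK.
Qed.
End QuadCommon.

(** * Complete graphs *)

Section TriangleEdges.
Variable V : finType.
Implicit Types (x y z p q : V) (T U : seq V).

Lemma is_triangleP T : is_triangle T -> exists x y z, T = [:: x; y; z] /\ uniq [:: x; y; z].
Proof.
by case: T => [|x [|y [|z [|t T]]]] /andP[// u _]; exists x, y, z.
Qed.

Lemma cycle_edges_triangle x y z : uniq [:: x; y; z] -> cycle_edges [:: x; y; z] =
  [set A : {set V} | (A \subset [set x; y; z]) && (#|A| == 2)]%SET.
Proof.
move=> u; have [xy xz yz] : [/\ x != y, x != z & y != z].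
  by move: u; rewrite /= !inE negb_or !andbT => /andP[/andP[]].
have nx : next [:: x; y; z] x = y by rewrite /= eqxx.
have ny : next [:: x; y; z] y = z by rewrite /= eq_sym (negbTE xy) eqxx.
have nz : next [:: x; y; z] z = x.
  by rewrite /= [z == x]eq_sym (negbTE xz) [z == y]eq_sym (negbTE yz) eqxx.
apply/setP => A; rewrite inE; apply/imsetP/andP.
  have S a b : a \in [:: x; y; z] -> b \in [:: x; y; z] -> a != b ->
      ([set a; b] \subset [set x; y; z])%SET /\ #|[set a; b]%SET| == 2.
    move=> ha hb ab; rewrite cards2 ab; split=> //; apply/fintype.subsetP => v.
    by rewrite !inE => /orP[]/eqP->; rewrite -orbA; [move: ha|move: hb]; rewrite !inE.
  move=> [a]; rewrite !inE => /or3P[]/eqP-> ->; rewrite ?nx ?ny ?nz; apply: S;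
    rewrite ?inE ?eqxx ?orbT //; by rewrite eq_sym.
move=> [sA /cards2P[a [b [ab AE]]]].
have ha : a \in [:: x; y; z] by have := fintype.subsetP sA a; rewrite AE !inE eqxx -orbA; apply.
have hb : b \in [:: x; y; z] by have := fintype.subsetP sA b; rewrite AE !inE eqxx orbT -orbA; apply.
have C c d : c \in [:: x; y; z] -> next [:: x; y; z] c = d -> [set a; b]%SET = [set c; d]%SET ->
    exists2 t, t \in [:: x; y; z] & A = [set t; next [:: x; y; z] t]%SET.
  by move=> hc nc E; exists c => //; rewrite nc AE.
have hx : x \in [:: x; y; z] by rewrite inE eqxx.
have hy : y \in [:: x; y; z] by rewrite !inE eqxx orbT.
have hz : z \in [:: x; y; z] by rewrite !inE eqxx !orbT.
move: ha hb ab C; rewrite !inE => /or3P[]/eqP-> /or3P[]/eqP-> ab C; rewrite ?eqxx // in ab *.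
- exact: C hx nx erefl.
- by apply: C hz nz _; rewrite finset.setUC.
- by apply: C hx nx _; rewrite finset.setUC.
- exact: C hy ny erefl.
- exact: C hz nz erefl.
by apply: C hy ny _; rewrite finset.setUC.
Qed.

Lemma common_edges_triangle x y z p q r : uniq [:: x; y; z] -> uniq [:: p; q; r] ->
  common_edges [:: x; y; z] [:: p; q; r] =
  [set A : {set V} | (A \subset [set x; y; z] :&: [set p; q; r]) && (#|A| == 2)]%SET.
Proof.
move=> u1 u2; rewrite /common_edges !cycle_edges_triangle //.
apply/setP => A; rewrite !inE finset.subsetI.
by case: (_ \subset _) => //=; case: (_ == _); rewrite ?andbT ?andbF.
Qed.

(** The edges of a triangle are the pairs of its vertices, so common edges are pairs of common
    vertices. Edge conditions thus become counts of vertices: one common edge means two common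
    vertices. *)
Lemma card_common_edges x y z p q r : uniq [:: x; y; z] -> uniq [:: p; q; r] ->
  #|common_edges [:: x; y; z] [:: p; q; r]| = 'C(count (mem [:: p; q; r]) [:: x; y; z], 2).
Proof.
move=> u1 u2; rewrite common_edges_triangle // cards_draws; congr ('C(_, _)).
rewrite -size_filter -(card_uniqP (filter_uniq _ u1)); apply: eq_card => v.
by rewrite mem_filter !inE -!orbA andbC.
Qed.

(** A linked triangle of the star consists of [p], one vertex of [I] and one vertex outside [I]; the
    last one is in [abc] along with [p]. *)
Lemma triangle_star_count x y z p a b c : uniq [:: x; y; z] -> p \in [:: a; b; c] ->
  tri (star p (starY a b c)) x y z != 0 -> count (mem [:: a; b; c]) [:: x; y; z] = 2%N.
Proof.
move=> u pQ nz; have memY v : (v \in starY a b c) = (v \notin [:: a; b; c]) by rewrite !inE -!orbA.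
have pY : p \notin starY a b c by rewrite memY negbK.
have [[i iU iY] [j jU /andP[jY jp]]] := tri_star_neq0 pY nz.
have pU : p \in [:: x; y; z].
  rewrite !inE ![p == _]eq_sym; apply/negPn/negP; rewrite !negb_or => /and3P[xp yp zp].
  by move: nz; rewrite tri_star0 // eqxx.
have ne v v' : v \in starY a b c -> v' \notin starY a b c -> v != v' by move=> h; apply: contraNneq => <-.
have u' : uniq [:: i; j; p].
  by rewrite /= !inE negb_or jp (ne i j) // (ne i p).
have pe : perm_eq [:: i; j; p] [:: x; y; z].
  have sub : {subset [:: i; j; p] <= [:: x; y; z]}.
    by move=> v; rewrite !inE => /or3P[]/eqP->; rewrite -?in_cons; move: iU jU pU; rewrite !inE.
  have [_ E] := uniq_min_size u' sub (leqnn _).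
  exact: uniq_perm.
rewrite -(permP pe) /=; move: iY jY; rewrite !memY negbK => iQ jQ.
by move: iQ jQ pQ; rewrite !inE => /negbTE-> -> ->.
Qed.

Lemma count_triangle_star x y z a b c : uniq [:: x; y; z] ->
  count (mem [:: a; b; c]) [:: x; y; z] = 2%N ->
  exists2 p, p \in [:: a; b; c] & tri (star p (starY a b c)) x y z != 0.
Proof.
move=> u; have memY v : (v \in starY a b c) = (v \notin [:: a; b; c]) by rewrite !inE -!orbA.
have [xy xz yz] : [/\ x != y, x != z & y != z].
  by move: u; rewrite /= !inE negb_or !andbT => /andP[/andP[]].
have yx : y != x by rewrite eq_sym.
have zx : z != x by rewrite eq_sym.
have zy : z != y by rewrite eq_sym.
rewrite [count _ _]/= !addn0.
have [xQ|xQ] := boolP (x \in [:: a; b; c]); have [yQ|yQ] := boolP (y \in [:: a; b; c]);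
  have [zQ|zQ] := boolP (z \in [:: a; b; c]) => // _.
- by exists x => //; rewrite tri_star // !memY yQ zQ.
- by exists x => //; rewrite tri_star // !memY yQ zQ.
by exists y => //; rewrite -tri_rot tri_star // !memY xQ zQ.
Qed.
End TriangleEdges.

Lemma lkE (R : realType) (o : bool) (C D : curve R) : lk o C D = (-1) ^+ o * lk false C D.
Proof. by rewrite /lk expr0 mul1r. Qed.

Section StarsAndLinks.
Variables (R : realType) (V : finType) (g : embedding R V).
Implicit Types (u : V -> V -> int) (C : curve R).

Definition linking_weight C u : Prop :=
  antisym u /\ forall c, is_cycle c -> lk false C (cycle_curve g c) = cyc u c.

Lemma triangle_is_cycle (T : seq V) : is_triangle T -> is_cycle T.
Proof. by move=> /andP[u /eqP s]; rewrite /is_cycle u s. Qed.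

(** Comparison with the zero cochain: if all triangle sums vanish, so do all cycle sums. Linking a
    graph therefore means linking one of its triangles. *)
Lemma links_graphP C u : linking_weight C u ->
  links_graph C g <-> exists x y z, tri u x y z != 0.
Proof.
move=> [an E]; split=> [[c cc]|[x [y [z nz]]]].
  rewrite /linked E // => nz; apply: contrapT => no.
  have := @tri_eq_cyc _ u (fun _ _ => 0) an; case/eqP: nz.
  rewrite (@tri_eq_cyc _ u (fun _ _ => 0)) //; first by rewrite /cyc big1.
  move=> x y z; rewrite [RHS]/tri !addr0.
  by apply/eqP/negPn/negP => h; apply: no; exists x, y, z.
have uq := tri_neq0_uniq an nz; exists [:: x; y; z]; first by rewrite /is_cycle uq.
by rewrite /linked E ?cyc_tri // /is_cycle uq.
Qed.

Lemma links_in_starP (s : bool) C u p (O I : {set V}) : linking_weight C u ->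
  (forall x y z, tri u x y z = (-1) ^+ s * tri (star p I) x y z) ->
  star_partition p O I -> links_in_star s C g p O I.
Proof.
move=> [an E] S part; split=> // T tT.
have val T' : is_triangle T' -> lk s C (cycle_curve g T') = cyc (star p I) T'.
  move=> tT'; rewrite lkE E ?triangle_is_cycle //.
  have [x [y [z [-> uq]]]] := is_triangleP tT'.
  by rewrite !cyc_tri // S signrMK.
have /and4P[pO pI /pred0P dOI /eqP full] := part.
have inO v : v != p -> v \notin I -> v \in O.
  move=> vp vI; have : v \in [set: V]%SET by rewrite inE.
  by rewrite -full !inE (negbTE vp) (negbTE vI) orbF.
have star1 T' : is_triangle T' -> in_star p O I T' -> cyc (star p I) T' = 1.
  move=> tT' [q [r [k [qO rI TE]]]].
  have uq : uniq [:: p; q; r] by move: tT' => /andP[]; rewrite TE rot_uniq.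
  rewrite TE cyc_rot // cyc_tri // tri_star.
  - have := dOI q; rewrite /= qO /= => ->; by rewrite rI.
  - by apply: contraNneq pO => <-.
  by apply: contraNneq pI => <-.
have trev : is_triangle (rev T) by move: tT; rewrite /is_triangle rev_uniq size_rev.
have [x [y [z [TE uq]]]] := is_triangleP tT.
have revE : cyc (star p I) (rev T) = - cyc (star p I) T.
  have uq' : uniq [:: z; y; x] by rewrite (_ : [:: z; y; x] = rev [:: x; y; z]) ?rev_uniq.
  rewrite TE (_ : rev _ = [:: z; y; x]) // !cyc_tri // -tri_antisym; last exact: star_antisym.
  by rewrite -tri_rot.
rewrite val //; split.
- exact: star1.
- by move=> /(star1 _ trev); rewrite revE => /eqP; rewrite eqr_oppLR => /eqP.
move=> n1 n2; apply/eqP/negPn/negP; rewrite TE cyc_tri // => nz.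
have ne (a b : V) (hp : a != p) (hq : b != p) (nz' : tri (star p I) p a b != 0) :
    (a \in O /\ b \in I) \/ (b \in O /\ a \in I).
  move: nz'; rewrite tri_star //; have [aI|aI] := boolP (a \in I); have [bI|bI] := boolP (b \in I) => // _.
    by right; split=> //; exact: inO.
  by left; split=> //; exact: inO.
have [xy xz yz] : [/\ x != y, x != z & y != z].
  by move: uq; rewrite /= !inE negb_or !andbT => /andP[/andP[]].
have [xp|xp] := eqVneq x p.
  have yp : y != p by rewrite -xp eq_sym.
  have zp : z != p by rewrite -xp eq_sym.
  rewrite xp in nz TE; case: (ne y z yp zp nz) => [[hy hz]|[hz hy]].
    by apply: n1; exists y, z, 0%N.
  by apply: n2; exists z, y, 1%N; rewrite TE.
have [yp|yp] := eqVneq y p.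
  have zp : z != p by rewrite -yp eq_sym.
  rewrite yp -tri_rot in nz; rewrite yp in TE; case: (ne z x zp xp nz) => [[hz hx]|[hx hz]].
    by apply: n1; exists z, x, 2%N; rewrite TE.
  by apply: n2; exists x, z, 2%N; rewrite TE.
have [zp|zp] := eqVneq z p; last by move: nz; rewrite tri_star0 // eqxx.
rewrite zp tri_rot in nz; rewrite zp in TE; case: (ne x y xp yp nz) => [[hx hy]|[hy hx]].
  by apply: n1; exists x, y, 1%N; rewrite TE.
by apply: n2; exists y, x, 0%N; rewrite TE.
Qed.
End StarsAndLinks.

(** * The tetrahedron formed by T* and a further vertex *)

Section LinkedCompleteGraphs.
Variables (R : realType) (G H : finType) (g : embedding R G) (h : embedding R H).
Variable X : G -> G -> H -> H -> int.
Hypothesis Xl : forall k l, antisym (fun i j => X i j k l).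
Hypothesis Xr : forall i j, antisym (X i j).
Hypothesis lkX : forall c d, is_cycle c -> is_cycle d ->
  lk false (cycle_curve g c) (cycle_curve h d) =
  \sum_(x <- c) \sum_(y <- d) X x (next c x) y (next d y).
Hypothesis lkX' : forall c d, is_cycle c -> is_cycle d ->
  lk false (cycle_curve h d) (cycle_curve g c) =
  \sum_(x <- c) \sum_(y <- d) X x (next c x) y (next d y).

Definition weightG (c : seq G) : H -> H -> int := fun k l => cyc (fun i j => X i j k l) c.

Definition weightH (d : seq H) : G -> G -> int := fun i j => cyc (X i j) d.

Lemma cyc_weights c d : cyc (weightG c) d = cyc (weightH d) c.
Proof. exact: exchange_big. Qed.

Lemma weightG_linking c : is_cycle c -> linking_weight h (cycle_curve g c) (weightG c).
Proof.
move=> cc; split=> [k l|d cd]; first by rewrite /weightG /cyc -sumrN; apply: eq_bigr => x _; exact: Xr.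
by rewrite lkX // cyc_weights.
Qed.

Lemma weightH_linking d : is_cycle d -> linking_weight g (cycle_curve h d) (weightH d).
Proof.
move=> cd; split=> [i j|c cc]; last by rewrite lkX'.
by rewrite /weightH /cyc -sumrN; apply: eq_bigr => y _; exact: Xl.
Qed.

Hypothesis weak : forall c d, is_cycle c -> is_cycle d ->
  ~ strongly_linked (cycle_curve g c) (cycle_curve h d).

Lemma weightG_bounded c : is_cycle c -> bounded (weightG c).
Proof.
move=> cc d cd; have [_ <-] // := weightG_linking cc.
by have := weak cc cd; rewrite /strongly_linked; lia.
Qed.

Variables p1 p2 p3 : G.
Local Notation P := [:: p1; p2; p3].
Hypothesis uP : uniq P.

Let p12 : p1 != p2. Proof. by move: uP; rewrite /= !inE negb_or => /andP[/andP[]]. Qed.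
Let p13 : p1 != p3. Proof. by move: uP; rewrite /= !inE negb_or => /andP[/andP[]]. Qed.
Let p23 : p2 != p3. Proof. by move: uP; rewrite /= !inE !andbT => /andP[]. Qed.
Let p21 : p2 != p1. Proof. by rewrite eq_sym. Qed.
Let p31 : p3 != p1. Proof. by rewrite eq_sym. Qed.
Let p32 : p3 != p2. Proof. by rewrite eq_sym. Qed.

Local Notation fam := (tri_family p1 p2 p3).

Lemma notinP x : x \notin P -> [/\ x != p1, x != p2 & x != p3].
Proof. by rewrite !inE !negb_or => /and3P[]. Qed.

Lemma tri_family_triangle x i : x \notin P -> is_triangle (fam x i).
Proof.
move=> /notinP[x1 x2 x3]; case: i => -[|[|[|[|//]]]] ?; rewrite /tri_family /is_triangle [nth _ _ _]/= andbT.
all: by distinct.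
Qed.

Definition famw x i := weightG (fam x i).

Lemma cyc_family u x : x \notin P -> forall i : 'I_4, cyc u (fam x i) =
  nth 0 [:: tri u p1 p2 p3; tri u p3 p2 x; tri u x p1 p3; tri u p2 p1 x] i.
Proof.
move=> xP i; have /andP[uq _] := tri_family_triangle i xP.
by move: uq; case: i => -[|[|[|[|//]]]] ?; rewrite /tri_family [nth [::] _ _]/= => uq; exact: cyc_tri.
Qed.

(** Two faces of the tetrahedron run through their common edge in opposite directions, so together
    they bound a 4-cycle of G, to which weak linking applies. *)
Lemma famw_pair x (i j : 'I_4) : x \notin P -> i != j ->
  exists2 c, is_cycle c & forall k l, famw x i k l + famw x j k l = weightG c k l.
Proof.
move=> xP; have [x1 x2 x3] := notinP xP.
wlog ij : i j / (i < j)%N.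
  move=> W ne; have [lt|] := ltnP i j; first exact: W.
  rewrite leq_eqVlt => /orP[/eqP/val_inj E|lt]; first by rewrite E eqxx in ne.
  have [|c cc E] := W j i lt; first by rewrite eq_sym.
  by exists c => // k l; rewrite addrC.
move=> _.
have four a b c d : uniq [:: a; b; c; d] ->
    (forall u, antisym u -> cyc u (fam x i) + cyc u (fam x j) = u a b + u b c + u c d + u d a) ->
    exists2 c, is_cycle c & forall k l, famw x i k l + famw x j k l = weightG c k l.
  move=> uq E; exists [:: a; b; c; d]; first by rewrite /is_cycle uq.
  by move=> k l; rewrite /famw /weightG E ?cyc4.
have E u : antisym u -> forall k l : 'I_4, cyc u (fam x k) + cyc u (fam x l) =
   nth 0 [:: tri u p1 p2 p3; tri u p3 p2 x; tri u x p1 p3; tri u p2 p1 x] k +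
   nth 0 [:: tri u p1 p2 p3; tri u p3 p2 x; tri u x p1 p3; tri u p2 p1 x] l.
  by move=> _ k l; rewrite !cyc_family.
move: i j ij four; move=> [[|[|[|[|//]]]] ?] [[|[|[|[|//]]]] ?] //= _ four.
(* The 4-cycles for the pairs of faces 01, 02, 03, 12, 13, 23, in this order. *)
all: [> apply: (four p1 p2 x p3)|apply: (four p1 p2 p3 x)|apply: (four p2 p3 p1 x)
       |apply: (four p3 p2 x p1)|apply: (four p3 p2 p1 x)|apply: (four p1 p3 x p2)].
all: try by distinct.
all: move=> u an; rewrite E //= /tri; have := an p1 p2; have := an p1 p3; have := an p2 p3;
  have := an x p1; have := an x p2; have := an x p3; lra.
Qed.

Lemma famw_quad x : x \notin P -> quad (famw x).
Proof.
move=> xP; have cyF i := triangle_is_cycle (tri_family_triangle i xP); split.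
- by move=> i; have [] := weightG_linking (cyF i).
- by move=> i; exact: weightG_bounded.
- move=> i j ij; have [c cc E] := famw_pair xP ij.
  move=> d cd; have := weightG_bounded cc cd; congr (`|_| <= 1).
  by apply: eq_bigr => y _; rewrite -E.
move=> k l; rewrite !big_ord_recl big_ord0 /famw /weightG !cyc_family //= /tri.
have an := Xl k l.
have := an p1 p2; have := an p1 p3; have := an p2 p3; have := an x p1;
  have := an x p2; have := an x p3; move: (X p1 p2 k l) => t0; lra.
Qed.

Lemma tri_weights (T : seq G) (a b c : H) : is_triangle T -> uniq [:: a; b; c] ->
  tri (weightG T) a b c = cyc (weightH [:: a; b; c]) T.
Proof. by move=> tT uq; rewrite -cyc_tri // cyc_weights. Qed.

Hypothesis linkP : forall T : seq G, is_triangle T -> ~ same_unoriented T P ->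
  (links_graph (cycle_curve g T) h <-> common_edges T P <> finset.set0).

Lemma links_count (a b c : G) : uniq [:: a; b; c] -> count (mem P) [:: a; b; c] != 3%N ->
  (links_graph (cycle_curve g [:: a; b; c]) h <-> count (mem P) [:: a; b; c] = 2%N).
Proof.
move=> uq n3; have E := card_common_edges uq uP.
have le3 : (count (mem P) [:: a; b; c] <= 3)%N by exact: count_size.
rewrite linkP; last first.
- move=> same; move: E; rewrite /common_edges same -/(common_edges P P) card_common_edges //.
  have -> : count (mem P) P = size P by apply/eqP; rewrite -all_count; exact/allP.
  by move: (count _ _) n3 le3 => [|[|[|[|]]]].
- by rewrite /is_triangle uq.
split=> [ne|c2].
  have : (0 < #|common_edges [:: a; b; c] P|)%N by rewrite card_gt0; apply/eqP.
  by rewrite E; move: (count _ _) n3 le3 => [|[|[|[|]]]].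
by move=> e0; move: E; rewrite c2 e0 cards0.
Qed.

Lemma unlinked_weightH a b c d : uniq [:: a; b; c] -> (count (mem P) [:: a; b; c] < 2)%N ->
  is_triangle d -> tri (weightH d) a b c = 0.
Proof.
move=> uq lt2 td; have [x [y [z [-> uxyz]]]] := is_triangleP td.
have tT : is_triangle [:: a; b; c] by rewrite /is_triangle uq.
rewrite -cyc_tri // -tri_weights //; apply/eqP/negPn/negP => nz.
have L := weightG_linking (triangle_is_cycle tT).
have : links_graph (cycle_curve g [:: a; b; c]) h by apply/(links_graphP L); exists x, y, z.
rewrite links_count //; last by apply/eqP => E; rewrite E in lt2.
by move=> E; rewrite E in lt2.
Qed.

Lemma unlinked_weightH_P p x y d : p \in P -> x \notin P -> y \notin P -> is_triangle d ->
  tri (weightH d) p x y = 0.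
Proof.
move=> pP xP yP td; have cd := triangle_is_cycle td; have [an _] := weightH_linking cd.
have [->|xy] := eqVneq x y; first by rewrite tri_xyy.
apply: unlinked_weightH => //; last by rewrite [count _ _]/= pP (negbTE xP) (negbTE yP).
have ne v : v \notin P -> p != v by move=> vP; apply: contraNneq vP => <-.
by rewrite /= !inE negb_or !ne // xy.
Qed.

(** In the tetrahedron on [p], [q], [x], [y] with [p], [q] on T*, the faces [pxy] and [qxy] have one
    vertex on T* and do not link H. The cocycle identity equates the other two faces. *)
Lemma famw_indep x y i a b c : x \notin P -> y \notin P ->
  tri (famw x i) a b c = tri (famw y i) a b c.
Proof.
move=> xP yP.
have [an1 _] := weightG_linking (triangle_is_cycle (tri_family_triangle i xP)).
have [an2 _] := weightG_linking (triangle_is_cycle (tri_family_triangle i yP)).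
have [uq|nu] := boolP (uniq [:: a; b; c]); last first.
  have Z u : antisym u -> tri u a b c = 0.
    by move=> an; apply/eqP; apply: contraNT nu => /tri_neq0_uniq; apply.
  by rewrite !Z.
have td : is_triangle [:: a; b; c] by rewrite /is_triangle uq.
have [an _] := weightH_linking (triangle_is_cycle td).
rewrite !tri_weights ?tri_family_triangle // !cyc_family //.
have Z p : p \in P -> tri (weightH [:: a; b; c]) p x y = 0 by move=> pP; exact: unlinked_weightH_P.
have z1 := Z p1 ltac:(by rewrite inE eqxx).
have z2 := Z p2 ltac:(by rewrite !inE eqxx orbT).
have z3 := Z p3 ltac:(by rewrite !inE eqxx !orbT).
have D p q : p \in P -> q \in P -> tri (weightH [:: a; b; c]) p q x = tri (weightH [:: a; b; c]) p q y.
  by move=> pP qP; have := tri_cocycle p q x y an; rewrite !Z //; lra.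
have m1 : p1 \in P by rewrite inE eqxx.
have m2 : p2 \in P by rewrite !inE eqxx orbT.
have m3 : p3 \in P by rewrite !inE eqxx !orbT.
case: i {an1 an2} => -[|[|[|[|//]]]] ? //=; first exact: D.
  by rewrite -(tri_rot _ x p1 p3) -(tri_rot _ y p1 p3); exact: D.
exact: D.
Qed.

(** Triangles at [p1] suffice. Up to orientation each of them is some T_i(x) or has [p1] as its only
    vertex on T*. *)
Lemma tri_eq0_family u : antisym u ->
  (forall p x y, p \in P -> x \notin P -> y \notin P -> tri u p x y = 0) ->
  (forall x i, x \notin P -> cyc u (fam x i) = 0) -> (exists x, x \notin P) ->
  forall a b c, tri u a b c = 0.
Proof.
move=> an Z F [x0 x0P]; apply: (tri_eq0 (a := p1)) => // a b.
have m1 : p1 \in P by rewrite inE eqxx.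
have F0 : tri u p1 p2 p3 = 0 by have := F x0 ord0 x0P; rewrite cyc_family.
have F1 x : x \notin P -> tri u p1 p2 x = 0.
  by move=> xP; have := F x (inord 3) xP; rewrite cyc_family // inordK //= tri_antisym // => /eqP;
    rewrite oppr_eq0 => /eqP.
have F2 x : x \notin P -> tri u p1 p3 x = 0.
  by move=> xP; have := F x (inord 2) xP; rewrite cyc_family // inordK //= => <-; rewrite -tri_rot -tri_rot tri_rot.
have cas v : [\/ v = p1, v = p2, v = p3 | v \notin P].
  have [->|v1] := eqVneq v p1; first exact: Or41.
  have [->|v2] := eqVneq v p2; first exact: Or42.
  have [->|v3] := eqVneq v p3; first exact: Or43.
  by apply: Or44; rewrite !inE !negb_or v1 v2.
case: (cas a) => [->|->|->|aP]; first by rewrite tri_xxy.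
- case: (cas b) => [->|->|->|bP]; rewrite ?tri_xyx ?tri_xyy //; exact: F1.
- case: (cas b) => [->|->|->|bP]; rewrite ?tri_xyx ?tri_xyy //; last exact: F2.
  by rewrite tri_swap // F0 oppr0.
case: (cas b) => [->|->|->|bP]; rewrite ?tri_xyx //; last exact: Z.
  by rewrite tri_swap // F1 ?oppr0.
by rewrite tri_swap // F2 ?oppr0.
Qed.

Lemma triangleH_links x0 a b c : x0 \notin P -> uniq [:: a; b; c] ->
  (links_graph (cycle_curve h [:: a; b; c]) g <-> exists m, tri (famw x0 m) a b c != 0).
Proof.
move=> x0P uq; have td : is_triangle [:: a; b; c] by rewrite /is_triangle uq.
have L := weightH_linking (triangle_is_cycle td); have [an _] := L.
rewrite (links_graphP L); split=> [[x [y [z nz]]]|[m nz]].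
  apply: contrapT => no; case/eqP: nz; apply: tri_eq0_family => //; last by exists x0.
    by move=> p v v' pP vP v'P; exact: unlinked_weightH_P.
  move=> v i vP; rewrite -tri_weights ?tri_family_triangle // -/(famw v i).
  rewrite (famw_indep i a b c vP x0P).
  by apply/eqP/negPn/negP => nz; apply: no; exists i.
rewrite /famw tri_weights ?tri_family_triangle // in nz.
have [x [y [z [E u]]]] := is_triangleP (tri_family_triangle m x0P).
by exists x, y, z; rewrite -cyc_tri // -E.
Qed.

Lemma famw_links x i : x \notin P -> links_graph (cycle_curve g (fam x i)) h <->
  exists a b c, tri (famw x i) a b c != 0.
Proof.
by move=> xP; apply/links_graphP/weightG_linking/triangle_is_cycle/tri_family_triangle.
Qed.

Lemma famw_neq0 x (i : 'I_4) : x \notin P -> i != ord0 -> exists a b c, tri (famw x i) a b c != 0.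
Proof.
move=> xP i0; apply/famw_links => //; have [x1 x2 x3] := notinP xP.
have tT := tri_family_triangle i xP.
have C : count (mem P) (fam x i) = 2%N.
  have m1 : p1 \in P by rewrite inE eqxx.
  have m2 : p2 \in P by rewrite !inE eqxx orbT.
  have m3 : p3 \in P by rewrite !inE eqxx !orbT.
  by case: i i0 {tT} => -[|[|[|[|//]]]] ? // _; rewrite /tri_family [nth _ _ _]/= [count _ _]/= ?m1 ?m2 ?m3 (negbTE xP).
have [a [b [c [E u]]]] := is_triangleP tT; rewrite E in C *.
by apply/links_count => //; rewrite C.
Qed.
End LinkedCompleteGraphs.

(** The arcs from a vertex to itself are junk, so antisymmetry is known only off the diagonals. No
    cycle has such an edge, and the weight is reset to 0 there. *)
Lemma lk_cycles_antisym (R : realType) (V W : finType) (g : embedding R V) (h : embedding R W) :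
  disjointly_embedded g h ->
  exists X : V -> V -> W -> W -> int,
  [/\ forall k l, antisym (fun i j => X i j k l), forall i j, antisym (X i j),
      forall c d, is_cycle c -> is_cycle d -> lk false (cycle_curve g c) (cycle_curve h d) =
        \sum_(x <- c) \sum_(y <- d) X x (next c x) y (next d y) &
      forall c d, is_cycle c -> is_cycle d -> lk false (cycle_curve h d) (cycle_curve g c) =
        \sum_(x <- c) \sum_(y <- d) X x (next c x) y (next d y)].
Proof.
move=> dj; have [X [X1 X2 L1 L2]] := lk_cycles_bilinear dj.
pose X' i j k l := if (i == j) || (k == l) then 0 else X i j k l.
have E c d : is_cycle c -> is_cycle d -> \sum_(x <- c) \sum_(y <- d) X' x (next c x) y (next d y) =
    \sum_(x <- c) \sum_(y <- d) X x (next c x) y (next d y).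
  move=> cc cd; rewrite !big_seq; apply: eq_bigr => x xc; rewrite !big_seq; apply: eq_bigr => y yd.
  by rewrite /X' ![_ == next _ _]eq_sym (negbTE (next_neq cc xc)) (negbTE (next_neq cd yd)).
exists X'; split=> [k l i j|i j k l|c d cc cd|c d cc cd]; rewrite ?E ?L1 ?L2 //.
  rewrite /X' (eq_sym j i); case: (eqVneq i j) => [|ij]; first by rewrite oppr0.
  by case: (eqVneq k l) => [|kl] /=; [rewrite oppr0|rewrite X1].
rewrite /X' (eq_sym l k); case: (eqVneq i j) => [|ij]; first by rewrite oppr0.
by case: (eqVneq k l) => [|kl] /=; [rewrite oppr0|rewrite X2].
Qed.

Lemma star_partition_compl (V : finType) (p : V) (I : {set V}) : p \notin I ->
  star_partition p ([set: V] :\ p :\: I)%SET I.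
Proof.
move=> pI; apply/and4P; split=> //.
- by rewrite !inE eqxx andbF.
- by rewrite disjoint_sym finset.disjoints_subset; apply/fintype.subsetP => v vI; rewrite !inE vI.
by apply/eqP/setP => v; rewrite !inE; case: (v == p); case: (v \in I).
Qed.

Lemma star_partition_starY (V : finType) (a b c : V) : uniq [:: a; b; c] ->
  star_partition a [set b; c]%SET (starY a b c) /\ star_partition a (starY a b c) [set b; c]%SET.
Proof.
rewrite /= !inE negb_or !andbT => /andP[/andP[ab ac] bc].
have D : [disjoint [set b; c]%SET & starY a b c].
  rewrite finset.disjoints_subset; apply/fintype.subsetP => v.
  by rewrite !inE; case: (v == a); case: (v == b); case: (v == c).
have U : (a |: ([set b; c] :|: starY a b c))%SET == [set: V]%SET.
  by apply/eqP/setP => v; rewrite !inE; case: (v == a); case: (v == b); case: (v == c).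
have n1 : a \notin [set b; c]%SET by rewrite !inE negb_or ab.
have n2 : a \notin starY a b c by rewrite !inE eqxx.
by split; apply/and4P; split=> //; [rewrite disjoint_sym|rewrite [(_ :|: [set b; c])%SET]finset.setUC].
Qed.

Theorem theorem6p2 (R : realType) (m n : nat) (G H : finType)
    (g : embedding R G) (h : embedding R H) (p1 p2 p3 : G)
    (hm : (5 <= m)%N) (hn : (5 <= n)%N) (hG : #|G| = m) (hH : #|H| = n)
    (hdisj : disjointly_embedded g h)
    (hweak : weakly_linked g h)
    (hT : is_triangle [:: p1; p2; p3])
    (hTstar : forall T : seq G, is_triangle T ->
       ~ same_unoriented T [:: p1; p2; p3] ->
       (links_graph (cycle_curve g T) h <->
        common_edges T [:: p1; p2; p3] <> finset.set0)) :
  (caseD1 g h p1 p2 p3 \/ caseD2 g h p1 p2 p3) /\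
  ~ (caseD1 g h p1 p2 p3 /\ caseD2 g h p1 p2 p3).
Proof.
split; last by case=> -[q [hq _]] [nq _ _]; apply: nq; exists q.
have [X [Xl Xr L1 L2]] := lk_cycles_antisym hdisj.
have weak := hweak.2.
have uP : uniq [:: p1; p2; p3] by case/andP: hT.
have G5 : (5 <= #|G|)%N by rewrite hG.
have H5 : (5 <= #|H|)%N by rewrite hH.
have [x0 [_ [x0Y _ _]]] := starY_card p1 p2 p3 G5.
have inX x : (x \in starY p1 p2 p3) = (x \notin [:: p1; p2; p3]) by rewrite !inE -!orbA.
have x0P : x0 \notin [:: p1; p2; p3] by rewrite -inX.
pose w x i := famw X p1 p2 p3 x i.
have Q x : x \notin [:: p1; p2; p3] -> quad (w x) by exact: (famw_quad Xl Xr L1 weak uP).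
have wE x i a b c : x \notin [:: p1; p2; p3] -> tri (w x i) a b c = tri (w x0 i) a b c.
  by move=> xP; exact: (famw_indep Xl Xr L1 L2 uP hTstar).
have nz x (i : 'I_4) : x \notin [:: p1; p2; p3] -> i != ord0 -> exists a b c, tri (w x i) a b c != 0.
  by move=> xP; exact: (famw_neq0 Xr L1 uP hTstar xP).
have linkH a b c : uniq [:: a; b; c] ->
    (links_graph (cycle_curve h [:: a; b; c]) g <-> exists m, tri (w x0 m) a b c != 0).
  exact: (triangleH_links Xl Xr L1 L2 uP hTstar x0P).
have linkG x i : x \notin [:: p1; p2; p3] ->
    (links_graph (cycle_curve g (tri_family p1 p2 p3 x i)) h <-> exists a b c, tri (w x i) a b c != 0).
  by move=> xP; exact: (famw_links Xr L1 uP).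
have LG x i : x \notin [:: p1; p2; p3] -> linking_weight h (cycle_curve g (tri_family p1 p2 p3 x i)) (w x i).
  by move=> xP; exact/(weightG_linking Xr L1)/triangle_is_cycle/tri_family_triangle.
have i0 : ord0 = inord 0 :> 'I_4 by apply: val_inj; rewrite /= inordK.
have uI : uniq [:: inord 1; inord 2; inord 3; ord0 : 'I_4].
  by rewrite /= !inE -!val_eqE /= !inordK.
have [[q hq]|noq] := pselect (exists q, common_vertex g h q); [left|right].
  have off i x y z : x != q -> y != q -> z != q -> tri (w x0 i) x y z = 0.
    move=> xq yq zq; apply/eqP/negPn/negP => ne.
    have uq := tri_neq0_uniq (quad_antisym (Q _ x0P) i) ne.
    have : q \in [:: x; y; z].
      by apply: hq; [rewrite /is_triangle uq|apply/linkH => //; exists i].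
    by rewrite !inE ![q == _]eq_sym (negbTE xq) (negbTE yq) (negbTE zq).
  have n1 : inord 1 != ord0 :> 'I_4 by rewrite -val_eqE /= inordK.
  have [I [s [dI UI SI]]] := quad_common (Q _ x0P) off (nz x0 (inord 1) x0P n1).
  have qI i : q \notin I i.
    apply/negP => qi; have : q \in (\bigcup_i I i)%SET by apply/finset.bigcupP; exists i.
    by rewrite UI !inE eqxx.
  have Ine (i : 'I_4) : i != ord0 -> exists y, y \in I i.
    move=> /(nz x0 i x0P)[a [b [c]]]; rewrite SI mulf_eq0 signr_eq0 /=.
    by move=> /(tri_star_neq0 (qI i))[[y _ yI] _]; exists y.
  exists q; split=> //; exists I; split=> //.
  - exists s => x i xP; apply: (links_in_starP (LG x i xP)); last exact: star_partition_compl.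
    by move=> a b c; rewrite wE.
  - move=> i i1; have [|y yI] := Ine i; first by rewrite -val_eqE /= -lt0n.
    by apply/eqP => I0; rewrite I0 inE in yI.
  have -> : [:: p1; p2; p3] = tri_family p1 p2 p3 x0 ord0 by [].
  rewrite linkG //; split=> [/set0Pn[y yI]|[a [b [c]]]].
    (* A linked triangle of the star of [q] and [I ord0] also needs a vertex outside [I ord0]; any
       vertex of [I (inord 1)] is one, by disjointness. *)
    have [z zI] := Ine _ n1; exists q, z, y; rewrite SI mulf_eq0 signr_eq0 /= tri_star.
    - have := dI _ _ n1; rewrite finset.disjoints_subset => /fintype.subsetP/(_ z zI).
      by rewrite inE yI => /negbTE->.
    - by apply: contraNneq (qI (inord 1)) => <-.
    by apply: contraNneq (qI ord0) => <-.
  rewrite SI mulf_eq0 signr_eq0 /= => /(tri_star_neq0 (qI _))[[y _ yI] _].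
  by apply/set0Pn; exists y.
have nc v : exists x y z, [/\ x != v, y != v & z != v] /\ exists m, tri (w x0 m) x y z != 0.
  apply: contrapT => no; apply: noq; exists v => U /is_triangleP[x [y [z [-> uq]]]] /linkH-/(_ uq)[i ne].
  apply/negPn/negP; rewrite !inE !negb_or ![v == _]eq_sym => /and3P[xv yv zv].
  by apply: no; exists x, y, z; split=> //; exists i.
(* Index 0 goes last, as the one that is not known to be nonzero. That T* does not link H comes out
   of this. *)
have [q1 [q2 [q3 [s [uq S]]]]] : exists a b c s, uniq [:: a; b; c] /\
    signed_stars (w x0) (inord 1) (inord 2) (inord 3) ord0 a b c s.
  by apply: quad_no_common (Q _ x0P) uI H5 _ nc => i; exact: nz.
have S0 x y z : tri (w x0 ord0) x y z = 0 by have [] := S x y z.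
have S1 x y z : tri (w x0 (inord 1)) x y z = (-1) ^+ s * tri (star q1 (starY q1 q2 q3)) x y z by have [] := S x y z.
have S2 x y z : tri (w x0 (inord 2)) x y z = (-1) ^+ s * tri (star q2 (starY q1 q2 q3)) x y z by have [] := S x y z.
have S3 x y z : tri (w x0 (inord 3)) x y z = (-1) ^+ s * tri (star q3 (starY q1 q2 q3)) x y z by have [] := S x y z.
have cas (i : 'I_4) : [\/ i = ord0, i = inord 1, i = inord 2 | i = inord 3].
  case: i => -[|[|[|[|//]]]] ?; [apply: Or41|apply: Or42|apply: Or43|apply: Or44];
    by apply: val_inj; rewrite /= ?inordK.
split=> //.
  have -> : [:: p1; p2; p3] = tri_family p1 p2 p3 x0 ord0 by [].
  by rewrite linkG // => -[a [b [c]]]; rewrite S0 eqxx.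
exists q1, q2, q3; split; first by rewrite /is_triangle uq.
  move=> U /is_triangleP[x [y [z [-> uU]]]]; rewrite linkH // card_common_edges //.
  have le3 : (count (mem [:: q1; q2; q3]) [:: x; y; z] <= 3)%N by exact: count_size.
  split=> [[i]|c1].
    have star_case q : q \in [:: q1; q2; q3] -> (-1) ^+ s * tri (star q (starY q1 q2 q3)) x y z != 0 ->
        'C(count (mem [:: q1; q2; q3]) [:: x; y; z], 2) = 1%N.
      move=> qQ; rewrite mulf_eq0 signr_eq0 /= => /(triangle_star_count uU qQ) E.
      exact: (congr1 (fun k => 'C(k, 2)) E).
    case: (cas i) => ->; rewrite ?S0 ?S1 ?S2 ?S3 ?eqxx //; apply: star_case; by rewrite !inE eqxx ?orbT.
  have c2 : count (mem [:: q1; q2; q3]) [:: x; y; z] = 2%N.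
    by move: (count _ _) le3 c1 => [|[|[|[|]]]].
  have [q qQ ne] := count_triangle_star uU c2.
  move: qQ ne; rewrite !inE => /or3P[]/eqP-> ne; [exists (inord 1)|exists (inord 2)|exists (inord 3)];
    by rewrite ?S1 ?S2 ?S3 mulf_eq0 signr_eq0.
(* The relabelling is the identity: [q1], [q2], [q3] are already numbered as the centres of the
   stars of T_1, T_2, T_3. *)
exists p1, p2, p3, q1, q2, q3, s; split=> //.
have perm3 (V : eqType) (a b c : V) : uniq [:: a; b; c] -> uniq [:: b; a; c] /\ uniq [:: c; a; b].
  by move=> u; split; [exact: (uniq_select a u (ks := [:: 1; 0; 2]%N) isT)|exact: (uniq_select a u (ks := [:: 2; 0; 1]%N) isT)].
have [uq2 uq3] := perm3 _ _ _ _ uq; have [uP2 uP3] := perm3 _ _ _ _ uP.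
have Y2 (V : finType) (a b c : V) : starY b a c = starY a b c by exact: starYC.
have Y3 (V : finType) (a b c : V) : starY c a b = starY a b c by rewrite starYC starYAC.
have [pt1 pt1'] := star_partition_starY uq; have [pt2 pt2'] := star_partition_starY uq2.
have [pt3 pt3'] := star_partition_starY uq3.
have [gt1 gt1'] := star_partition_starY uP; have [gt2 gt2'] := star_partition_starY uP2.
have [gt3 gt3'] := star_partition_starY uP3.
rewrite (Y2 _ q1 q2 q3) in pt2; rewrite (Y3 _ q1 q2 q3) in pt3.
rewrite (Y2 _ p1 p2 p3) in gt2'; rewrite (Y3 _ p1 p2 p3) in gt3'.
split=> [x xX|y yY].
  have xP : x \notin [:: p1; p2; p3] by rewrite -inX.
  split; apply: (links_in_starP (LG x _ xP)) => // a b c; rewrite wE //.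
have [q12 q13 q23] : [/\ q1 != q2, q1 != q3 & q2 != q3].
  by move: uq; rewrite /= !inE negb_or !andbT => /andP[/andP[]].
have [y1 y2 y3] : [/\ y != q1, y != q2 & y != q3].
  by move: yY; rewrite !inE !negb_or => /andP[/andP[]].
have yQ : y \notin [:: q1; q2; q3] by rewrite !inE !negb_or y1 y2.
have [p12 p13 p23] : [/\ p1 != p2, p1 != p3 & p2 != p3].
  by move: uP; rewrite /= !inE negb_or !andbT => /andP[/andP[]].
have LH i := weightH_linking Xl L2 (triangle_is_cycle (tri_family_triangle uq i yQ)).
(* The weight of U_i(y) on G is compared with the expected star. By [tri_eq0_family] it is enough to
   check the T_j(x) and the triangles with one vertex on T*, on which both vanish. *)
have main (i : 'I_4) p (I : {set G}) : p \in [:: p1; p2; p3] -> {subset I <= [:: p1; p2; p3]} ->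
    tri (star p I) p1 p2 p3 = 0 ->
    (forall x, x \notin [:: p1; p2; p3] -> [/\
      cyc (star q1 (starY q1 q2 q3)) (tri_family q1 q2 q3 y i) = tri (star p I) p3 p2 x,
      cyc (star q2 (starY q1 q2 q3)) (tri_family q1 q2 q3 y i) = tri (star p I) x p1 p3 &
      cyc (star q3 (starY q1 q2 q3)) (tri_family q1 q2 q3 y i) = tri (star p I) p2 p1 x]) ->
    forall a b c, tri (weightH X (tri_family q1 q2 q3 y i)) a b c = (-1) ^+ s * tri (star p I) a b c.
  move=> pP IP T0 TE a b c.
  have [an _] := LH i; have tU := tri_family_triangle uq i yQ.
  have [u1 [u2 [u3 [UE uU]]]] := is_triangleP tU.
  set u := weightH X _ in an *.
  pose v x z := u x z - (-1) ^+ s * star p I x z.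
  have vE x z t : tri v x z t = tri u x z t - (-1) ^+ s * tri (star p I) x z t.
    by rewrite /tri /v; ring.
  have cycv c' : cyc v c' = cyc u c' - (-1) ^+ s * cyc (star p I) c'.
    by rewrite /cyc sumrB mulr_sumr.
  apply/eqP; rewrite -subr_eq0 -vE; apply/eqP; apply: (tri_eq0_family uP); last by exists x0.
  - by move=> x z; rewrite /v (an x z) (star_antisym p I x z) mulrN opprB addrC opprK.
  - move=> p' x z p'P xP zP; rewrite vE (unlinked_weightH_P Xl Xr L1 L2 uP hTstar p'P xP zP tU) sub0r.
    have nI t : t \notin [:: p1; p2; p3] -> t \notin I by move=> tP; apply: contra tP; exact: IP.
    have np t : t \notin [:: p1; p2; p3] -> t != p by move=> tP; apply: contraNneq tP => ->.
    have [->|p'p] := eqVneq p' p; last by rewrite tri_star0 ?(np x) ?(np z) // mulr0 oppr0.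
    by rewrite tri_star ?np // (negbTE (nI x xP)) (negbTE (nI z zP)) subrr mulr0 oppr0.
  move=> x j xP; rewrite cycv; have [E1 E2 E3] := TE x xP.
  (* Exchanging the two sums turns the weight of U_i(y) on T_j(x) into that of T_j(x) on U_i(y),
     which the stars found for H determine. *)
  have -> : cyc u (tri_family p1 p2 p3 x j) = tri (w x0 j) u1 u2 u3.
    by rewrite -(wE x) // /u -cyc_weights UE cyc_tri.
  rewrite (cyc_family uP _ xP); rewrite UE !cyc_tri // in E1 E2 E3.
  by case: (cas j) => ->; rewrite ?S0 ?S1 ?S2 ?S3 ?E1 ?E2 ?E3 ?inordK //= ?T0 ?mulr0 subrr.
have neH := (negbTE q12, negbTE q13, negbTE q23, negbTE y1, negbTE y2, negbTE y3,
  eq_sym q2 q1, eq_sym q3 q1, eq_sym q3 q2, eq_sym q1 y, eq_sym q2 y, eq_sym q3 y).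
have neP := (negbTE p12, negbTE p13, negbTE p23, eq_sym p2 p1, eq_sym p3 p1, eq_sym p3 p2).
have ev (i : 'I_4) (q : H) := cyc_family uq (star q (starY q1 q2 q3)) yQ i.
have sub3 : [/\ {subset [set p2; p3]%SET <= [:: p1; p2; p3]}, {subset [set p1; p3]%SET <= [:: p1; p2; p3]} &
    {subset [set p1; p2]%SET <= [:: p1; p2; p3]}].
  by split=> t; rewrite !inE => /orP[]->; rewrite ?orbT.
have [sub1 sub2 {}sub3] := sub3.
split.
- apply: (links_in_starP (LH _)); last exact: gt1'.
  apply: main => //; first by rewrite inE eqxx.
    by rewrite /tri /star !inE ?eqxx !neP.
  move=> x /notinP[x1 x2 x3]; rewrite !ev !inordK //=.
  have neX := (negbTE x1, negbTE x2, negbTE x3, eq_sym p1 x, eq_sym p2 x, eq_sym p3 x).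
  by split; rewrite /tri /star !inE ?eqxx !neH ?eqxx ?neP !neX.
- apply: (links_in_starP (LH _)); last exact: gt2'.
  apply: main => //; first by rewrite !inE eqxx orbT.
    by rewrite /tri /star !inE ?eqxx !neP.
  move=> x /notinP[x1 x2 x3]; rewrite !ev !inordK //=.
  have neX := (negbTE x1, negbTE x2, negbTE x3, eq_sym p1 x, eq_sym p2 x, eq_sym p3 x).
  by split; rewrite /tri /star !inE ?eqxx !neH ?eqxx ?neP !neX.
apply: (links_in_starP (LH _)); last exact: gt3'.
apply: main => //; first by rewrite !inE eqxx !orbT.
  by rewrite /tri /star !inE ?eqxx !neP.
move=> x /notinP[x1 x2 x3]; rewrite !ev !inordK //=.
have neX := (negbTE x1, negbTE x2, negbTE x3, eq_sym p1 x, eq_sym p2 x, eq_sym p3 x).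
by split; rewrite /tri /star !inE ?eqxx !neH ?eqxx ?neP !neX.
Qed.
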